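(* Fix $o\in M$ and $u_o\in O(M)$ with $\pi(u_o)=o$. The solution $\mathbf U$ to the RDE $$d\mathbf U=Y^{O(M)}_{d\mathbf Z_t}(u_t)\quad\text{with } u_0=u_o,\qquad \mathbf Z\in WG_p([0,T],\mathbb R^d\times so(d),(0,0)),$$ determines, until explosion, the inverse to the map $$WG_p([0,T],O(M),u_o)\ni\mathbf U\longmapsto\int_0^\cdot\theta^{Y^{O(M)}}(d\mathbf U_t)\in WG_p([0,T],\mathbb R^d\times so(d),(0,0));$$ that is, the solution of the RDE satisfies $\int_0^\cdot\theta^{Y^{O(M)}}(d\mathbf U)=\mathbf Z$ over $[0,\tau)$, with $\tau$ its possible explosion time, and any $\mathbf U\in WG_p([0,T],O(M),u_o)$ agrees with $\mathbf W$, the solution to the RDE $$d\mathbf W=Y^{O(M)}(w_t)\,d\Big[\int_0^t\theta^{Y^{O(M)}}(d\mathbf U_s)\Big]\quad\text{with } w_0=u_o\in O(M),$$ until the explosion time of this equation.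
   Context: Fix $T>0$, $p\in[2,3)$ and a control $\omega$, i.e. a continuous superadditive function $\omega:\{(s,t):0\le s\le t\le T\}\to[0,\infty)$ vanishing on the diagonal and positive off it. For a finite-dimensional normed space $W$, $WG_p(W)$ is the set of pairs $\mathbf X=(x,\mathbb X)$ of continuous maps $x:[0,T]\to W$ (the trace) and $\mathbb X:\{0\le s\le t\le T\}\to W\otimes W$ such that, with $x_{s,t}=x_t-x_s$: $\mathbb X_{s,t}=\mathbb X_{s,u}+\mathbb X_{u,t}+x_{s,u}\otimes x_{u,t}$ for $s\le u\le t$; $\sup_{s<t}|x_{s,t}|/\omega(s,t)^{1/p}<\infty$ and $\sup_{s<t}|\mathbb X_{s,t}|/\omega(s,t)^{2/p}<\infty$; and the symmetric part of $\mathbb X_{s,t}$ equals $\frac12 x_{s,t}\otimes x_{s,t}$. For continuous $g,h$ on $\{s\le t\}$, $g_{s,t}\simeq h_{s,t}$ means: there are $\delta>0$ and $C$ with $|g_{s,t}-h_{s,t}|\le C\,\omega(s,t)^{3/p}$ whenever $|t-s|\le\delta$. For bilinear $B$ and a tensor $A$, $B(a,b)|_{a\otimes b=A}$ denotes $\hat B(A)$, where $\hat B$ is the linear map on the tensor product with $\hat B(a\otimes b)=B(a,b)$. $E=\mathbb R^N$ and $M\subset E$ is an embedded submanifold of dimension $d$ with the induced Riemannian metric (locally $M$ is the zero set of a smooth map $F:U\to\mathbb R^{N-d}$, $U\subset E$ open, with surjective differential); $\tau_mM=\mathrm{Nul}(F'(m))\cong T_mM$; $P(m)$ is the orthogonal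 projection of $E$ onto $\tau_mM$, $Q=I_E-P$, and $dQ(\xi)$ is the derivative of $Q$ at $m$ along $\xi\in\tau_mM$. $\Gamma(TM)$: smooth vector fields. The same definitions apply to submanifolds of other Euclidean spaces. For an embedded submanifold $N$ of a Euclidean space $E'$: for $U\subset E'$ open, a smooth $\alpha:U\to\mathrm{Hom}(E',W)$ and $\mathbf X\in WG_p(E')$ with trace in $U$, $\int\alpha(d\mathbf X)$ is the unique $\mathbf Y=(y,\mathbb Y)\in WG_p(W)$ with $y_0=0$, $y_{s,t}\simeq\alpha(x_s)x_{s,t}+\alpha'(x_s)\mathbb X_{s,t}$, $\mathbb Y_{s,t}\simeq[\alpha(x_s)\otimes\alpha(x_s)]\mathbb X_{s,t}$, where $\alpha'(x)[v\otimes w]=(\partial_v\alpha)(x)w$. $WG_p(N)$ is the set of $\mathbf X\in WG_p(E')$ whose trace lies in $N$ and such that $\int\tilde\alpha(d\mathbf X)\equiv0$ for every finite-dimensional $W$ and every smooth $W$-valued one-form $\tilde\alpha$ on $E'$ with $\tilde\alpha|_{TN}\equiv0$. For $\mathbf X\in WG_p(N)$ and a smooth one-form $\alpha$ on $N$, $\int\alpha(d\mathbf X):=\int\tilde\alpha(d\mathbf X)$ for any smooth extension $\tilde\alpha$ of $\alpha$ to a neighbourhood of $N$. $WG_p(J,N,o)$ denotes the elements over the time interval $J$ starting at $o$. RDE on $N$ with linear $Y:\mathbb R^n\to\Gamma(TN)$ driven by $\mathbf Z=(z,\mathbb Z)$: $\mathbf X$ solves $d\mathbf X=Y_{d\mathbf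 Z}(x)$ (also written $Y(x)d\mathbf Z$) if $x_{s,t}\simeq Y_{z_{s,t}}(x_s)+(\partial_{Y_a}Y_b)(x_s)|_{a\otimes b=\mathbb Z_{s,t}}$ and $\mathbb X_{s,t}\simeq Y_a(x_s)\otimes Y_b(x_s)|_{a\otimes b=\mathbb Z_{s,t}}$; solutions on $[0,\tau)$ are understood on each $[0,T_0]$, $T_0<\tau$. Frame bundle: $O(M)=\{(m,g):m\in M,\ g:\mathbb R^d\to\tau_mM\text{ a linear isometry}\}$, an embedded submanifold of $E\times\mathrm{Hom}(\mathbb R^d,E)$, $\pi(m,g)=m$. For $a\in\mathbb R^d$ and $A\in so(d)$ (skew-symmetric matrices), $B_a(m,g)=(ga,-dQ(ga)g)$, $\mathcal V_A(m,g)=(0,gA)$, and $Y^{O(M)}_{(a,A)}:=B_a+\mathcal V_A$. The one-forms $\theta,\omega^\nabla$ on $O(M)$ are $\theta((\xi,h)_{(m,g)})=g^*\xi\in\mathbb R^d$ and $\omega^\nabla((\xi,h)_{(m,g)})=g^{-1}[h+dQ(\xi)g]\in so(d)$; $\theta^{Y^{O(M)}}:=(\theta,\omega^\nabla)$, an $\mathbb R^d\times so(d)$-valued one-form. *)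

(* Defs.v *)
From HB Require Import structures.
From mathcomp Require Import all_boot all_order all_algebra.
From mathcomp Require Import all_classical all_reals all_analysis.

Set Implicit Arguments.
Unset Strict Implicit.
Unset Printing Implicit Defensive.

Import Order.TTheory GRing.Theory Num.Theory.
Import numFieldNormedType.Exports.
Import VectorInternalTheory.

Local Open Scope classical_set_scope.
Local Open Scope ring_scope.

(* A finite-dimensional real normed space is a [vectType R].  All its norms are
   equivalent, and the notions below (continuity, smoothness, the relation
   [simeq], the bounds in [WG]) depend only on the equivalence class of the
   norm, so topology and norm are read in the coordinates [v2r : V -> 'rV]. *)
Section FiniteDim.
Variable R : realType.
Implicit Types V W : vectType R.

Definition vnorm V (v : V) : R := `|v2r v|.

Definition vopen V (U : set V) := open (v2r @` U).

Definition vcompact V (K : set V) := compact (v2r @` K).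

Definition coord_map V W (f : V -> W) : 'rV[R]_(dim V) -> 'rV[R]_(dim W) :=
  fun x => v2r (f (r2v x)).

Fixpoint Ck m n (k : nat) (U : set 'rV[R]_m) (f : 'rV[R]_m -> 'rV[R]_n) : Prop :=
  match k with
  | 0 => forall x, U x -> {for x, continuous f}
  | k'.+1 => (forall x, U x -> differentiable f x) /\
             (forall v, Ck k' U (fun x => 'D_v f x))
  end.

Definition smooth_on V W (U : set V) (f : V -> W) :=
  forall k, Ck k (v2r @` U) (coord_map f).

Definition pder V W (v : V) (f : V -> W) (x : V) : W :=
  r2v ('D_(v2r v) (coord_map f) (v2r x)).

(* V (x) V, through the coordinates of V *)
Definition tensor V := 'M[R]_(dim V).

Definition tens V (a b : V) : tensor V := (v2r a)^T *m v2r b.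

(* B(a, b)|_{a (x) b = A} for bilinear B: the value at A of the linear map
   induced by B, on the basis [r2v (delta_mx 0 i)] of V *)
Definition at_tensor V W (B : V -> V -> W) (A : tensor V) : W :=
  \sum_i \sum_j A i j *: B (r2v (delta_mx 0 i)) (r2v (delta_mx 0 j)).

End FiniteDim.

Section RoughPaths.
Variable R : realType.
Implicit Types V W : vectType R.

Definition triangle (S : R) : set (R * R) :=
  [set st | 0 <= st.1 /\ st.1 <= st.2 /\ st.2 <= S].

Definition control (T : R) (omega : R -> R -> R) :=
  [/\ {within triangle T, continuous (fun st => omega st.1 st.2)},
      (forall s u t, 0 <= s -> s <= u -> u <= t -> t <= T ->
         omega s u + omega u t <= omega s t),
      (forall s, 0 <= s -> s <= T -> omega s s = 0) &
      (forall s t, 0 <= s -> s < t -> t <= T -> 0 < omega s t)].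

(* Only the values at times 0 <= s <= t <= S matter for a path over [0, S]. *)
Record rpath V := RPath { trace : R -> V ; area : R -> R -> tensor V }.

HB.instance Definition _ V := gen_eqMixin (rpath V).
HB.instance Definition _ V := gen_choiceMixin (rpath V).

Definition rpath0 V : rpath V := RPath (fun=> 0) (fun _ _ => 0).

Definition incr V (x : R -> V) (s t : R) : V := x t - x s.

Definition eq_rpath V (S : R) (X X' : rpath V) :=
  (forall t, 0 <= t -> t <= S -> trace X t = trace X' t) /\
  (forall s t, 0 <= s -> s <= t -> t <= S -> area X s t = area X' s t).

Variables (p : R) (omega : R -> R -> R).

Definition simeq V (S : R) (g h : R -> R -> V) :=
  exists delta C : R, 0 < delta /\
    forall s t, 0 <= s -> s <= t -> t <= S -> `|t - s| <= delta ->
      vnorm (g s t - h s t) <= C * omega s t `^ (3 / p).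

(* WG_p(V) over the time interval [0, S] *)
Definition WG V (S : R) (X : rpath V) :=
  let x := trace X in
  [/\ {within `[0, S], continuous (fun t => v2r (x t))} /\
      {within triangle S, continuous (fun st => area X st.1 st.2)},
      (forall s u t, 0 <= s -> s <= u -> u <= t -> t <= S ->
         area X s t = area X s u + area X u t + tens (incr x s u) (incr x u t)),
      (exists C : R, forall s t, 0 <= s -> s < t -> t <= S ->
         vnorm (incr x s t) <= C * omega s t `^ (1 / p)),
      (exists C : R, forall s t, 0 <= s -> s < t -> t <= S ->
         vnorm (area X s t) <= C * omega s t `^ (2 / p)) &
      (forall s t, 0 <= s -> s <= t -> t <= S ->
         2^-1 *: (area X s t + (area X s t)^T) =
         2^-1 *: tens (incr x s t) (incr x s t))].

Definition WG_from V (S : R) (o : V) (X : rpath V) := WG S X /\ trace X 0 = o.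

(* Y is the integral over [0, S] of the one-form alpha, smooth near the trace
   of X, against dX *)
Definition is_integral V W (S : R) (alpha : V -> 'Hom(V, W))
    (X : rpath V) (Y : rpath W) :=
  [/\ WG_from S 0 Y,
      simeq S (incr (trace Y))
        (fun s t => alpha (trace X s) (incr (trace X) s t) +
           at_tensor (fun v w => pder v alpha (trace X s) w) (area X s t)) &
      simeq S (area Y)
        (fun s t => at_tensor (fun v w => tens (alpha (trace X s) v)
                                               (alpha (trace X s) w))
                              (area X s t))].

End RoughPaths.

Section Submanifolds.
Variable R : realType.
Implicit Types E V W : vectType R.

(* Near m, N is the zero set of F : U -> R^k, with surjective differential. *)
Definition local_equation E k (N : set E) (m : E) (U : set E) (F : E -> 'rV[R]_k) :=
  [/\ vopen U, U m, smooth_on U F,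
      (forall x, U x -> (N x <-> F x = 0)) &
      (forall x, U x -> forall w, exists v, pder v F x = w)].

Definition submanifold E (d : nat) (N : set E) :=
  exists2 k : nat, dim E = (d + k)%N &
    forall m, N m -> exists U (F : E -> 'rV[R]_k), local_equation N m U F.

(* tau_m N = Nul(F'(m)); it does not depend on the local equation. *)
Definition tangent E (N : set E) (m : E) : set E :=
  [set v | exists k U (F : E -> 'rV[R]_k),
     local_equation N m U F /\ pder v F m = 0].

(* Derivative at m, along xi tangent to N, of a function that is only
   meaningful on N: differentiate any smooth local extension. *)
Definition tangent_der E V (N : set E) (xi : E) (f : E -> V) (m : E) : V :=
  xget 0 [set v | exists U (g : E -> V),
    [/\ vopen U, U m, smooth_on U g, (forall x, N x -> U x -> g x = f x) &
        v = pder xi g m]].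

Variables (p : R) (omega : R -> R -> R).

(* WG_p(N) over [0, S] *)
Definition WGM E (S : R) (N : set E) (X : rpath E) :=
  [/\ WG p omega S X,
      (forall t, 0 <= t -> t <= S -> N (trace X t)) &
      (forall W (alpha : E -> 'Hom(E, W)), smooth_on setT alpha ->
         (forall m v, N m -> tangent N m v -> alpha m v = 0) ->
         is_integral p omega S alpha X (rpath0 W))].

Definition WGM_from E (S : R) (N : set E) (o : E) (X : rpath E) :=
  WGM S N X /\ trace X 0 = o.

(* A one-form on N is given by its values [alpha m v], m in N, v tangent to N
   at m; other values are irrelevant. *)
Definition extends_form E W (N : set E) (alpha : E -> E -> W)
    (U : set E) (beta : E -> 'Hom(E, W)) :=
  [/\ vopen U, N `<=` U, smooth_on U beta &
      forall m v, N m -> tangent N m v -> beta m v = alpha m v].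

Definition is_integral_form E W (S : R) (N : set E) (alpha : E -> E -> W)
    (X : rpath E) (Y : rpath W) :=
  exists U beta,
    extends_form N alpha U beta /\ is_integral p omega S beta X Y.

(* The integral over [0, S] of a smooth one-form on N.  Its values at times
   in [0, S] depend neither on the extension nor on the choice of Y. *)
Definition integral_form E W (S : R) (N : set E) (alpha : E -> E -> W)
    (X : rpath E) : rpath W :=
  xget (rpath0 W) [set Y | is_integral_form S N alpha X Y].

(* X solves dX = Y_{dZ}(x) on N, over [0, S] *)
Definition rde_solution E V (S : R) (N : set E) (Y : V -> E -> E)
    (Z : rpath V) (X : rpath E) :=
  [/\ WGM S N X,
      simeq p omega S (incr (trace X))
        (fun s t => Y (incr (trace Z) s t) (trace X s) +
           at_tensor (fun a b => tangent_der N (Y a (trace X s)) (Y b) (trace X s))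
                     (area Z s t)) &
      simeq p omega S (area X)
        (fun s t => at_tensor (fun a b => tens (Y a (trace X s)) (Y b (trace X s)))
                              (area Z s t))].

(* X is the solution started at x0 of the RDE driven by Z over [0, T], with
   possible explosion time tau: tau = +oo if X lives on all of [0, T];
   otherwise tau <= T, X lives on [0, tau) and its trace over [0, tau) stays
   in no compact subset of N. *)
Definition rde_solution_until E V (T : R) (N : set E) (Y : V -> E -> E)
    (Z : rpath V) (x0 : E) (X : rpath E) (tau : \bar R) :=
  [/\ (0 < tau)%E, trace X 0 = x0,
      (forall S : R, 0 <= S -> S <= T -> (S%:E < tau)%E ->
         rde_solution S N Y Z X) &
      tau = +oo%E \/
      exists2 r : R, tau = r%:E /\ r <= T &
        forall K : set E, vcompact K -> K `<=` N ->
          exists t, [/\ 0 <= t, t < r & ~ K (trace X t)]].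

End Submanifolds.

Section FrameBundle.
Variables (R : realType) (N d : nat).
Local Notation E := 'cV[R]_N.
Local Notation frameE := ('cV[R]_N * 'M[R]_(N, d))%type.

(* so(d), and the space R^d x so(d) *)
Definition so : {vspace 'M[R]_d} := lker (linfun (fun A : 'M[R]_d => A + A^T)).
Local Notation rd_so := ('cV[R]_d * subvs_of so)%type.

Variable M : set E.

Definition tproj (m : E) : 'M[R]_N :=
  xget 0 [set P : 'M[R]_N | forall v, tangent M m (P *m v) /\
    forall w, tangent M m w -> w^T *m (v - P *m v) = 0].

Definition nproj (m : E) : 'M[R]_N := 1%:M - tproj m.

Definition dQ (m xi : E) : 'M[R]_N := tangent_der M xi nproj m.

Definition frame_bundle : set frameE :=
  [set u | [/\ M u.1, (forall a, tangent M u.1 (u.2 *m a)) &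
     forall a b : 'cV[R]_d, (u.2 *m a)^T *m (u.2 *m b) = a^T *m b]].

Definition B_field (a : 'cV[R]_d) (u : frameE) : frameE :=
  (u.2 *m a, - dQ u.1 (u.2 *m a) *m u.2).

Definition V_field (A : 'M[R]_d) (u : frameE) : frameE := (0, u.2 *m A).

Definition Y_field (c : rd_so) (u : frameE) : frameE :=
  B_field c.1 u + V_field (vsval c.2) u.

Definition theta_form (u v : frameE) : 'cV[R]_d := u.2^T *m v.1.

(* For g with independent columns, [frame_inv g *m w] is the only a with
   g *m a = w, for each w in the range of g. *)
Definition frame_inv (g : 'M[R]_(N, d)) : 'M[R]_(d, N) := (pinvmx g^T)^T.

Definition connection_form (u v : frameE) : 'M[R]_d :=
  frame_inv u.2 *m (v.2 + dQ u.1 v.1 *m u.2).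

(* On tangent vectors of the frame bundle, [connection_form] is in so(d), and
   there [vsproj so] is only the cast to the type of so(d). *)
Definition thetaY_form (u v : frameE) : rd_so :=
  (theta_form u v, vsproj so (connection_form u v)).

End FrameBundle.

(* Main.v *)
From HB Require Import structures.
Require Import Defs.
From mathcomp Require Import all_boot all_order all_algebra.
From mathcomp Require Import all_classical all_reals all_analysis.
From mathcomp Require Import ring lra.

Set Implicit Arguments.
Unset Strict Implicit.
Unset Printing Implicit Defensive.

Import Order.TTheory GRing.Theory Num.Theory.
Import numFieldNormedType.Exports.
Import VectorInternalTheory.
Local Open Scope classical_set_scope.
Local Open Scope ring_scope.

(** The fields [Y_field M] trivialize the tangent bundle of the frame bundle OM and
    theta^Y is the inverse trivialization: Y (theta^Y v) = v for v tangent, and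
    theta^Y (Y_b) = b.  The theorem holds for every such pair ([parallelism]) whose
    one-form extends to the ambient space in a way linear in the point
    ([parallelism_inverse]); the geometry of OM only serves to exhibit the pair
    ([Y_parallelism], [beta0_extends]).

    From the equation to its driver.  If dX = Y_dZ (x), insert the expansion of X
    into the germ theta (x_s) x_st + theta' (x_s) X_st of the integral of theta.
    The first order terms give z_st since theta (Y_b) = b, and the second order
    terms cancel: they are what one gets by differentiating theta (Y_b) = b along
    Y_a ([dual_derivative], [rde_theta]).  So the integral of theta and Z have the
    same germ up to O(omega^(3/p)).  As 3/p > 1, an additive function which is
    O(omega^(3/p)) vanishes ([additive_small]), whence equality.

    From a path to the equation.  Let X be a rough path on N and Z its integral of
    theta.  By definition the integrals along X of all one-forms that vanish on TN
    are zero.  Apply this to al = chi * (1 - Y theta), with a cut-off chi and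
    local extensions of Y and theta, and to x^i * al: the resulting relations
    ([conormal]) say that X solves, near each of its points, the equation driven
    by Z ([wgm_chart_sol]).  Solutions are locally unique ([local_uniqueness]: a
    contraction argument on the distance of two solutions and on the difference
    of their local errors), and the set of times up to which two solutions agree
    is open and closed ([integral_rde]).

    Derivatives along N may be computed with any local extension, by the Lagrange
    multiplier rule [tangent_vanish].  Existence of the integral of theta
    is easy here, because theta^Y is the restriction of a one-form which depends
    linearly on the point of the ambient space: the first level of the integral
    is then explicit, and the second comes from sewing
    ([linear_integral_exists]).

    For OM itself, let Q be the projection onto the normal space of M, written as
    J^T (J J^T)^-1 J with J the Jacobian matrix of a local equation of M.  Near a
    frame, OM is the common zero set of F (m), J (m) g and g^T g - 1
    ([OM_tangent]).  Two identities do the rest: g g^T = 1 - Q, by counting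
    dimensions ([frame_complement]), and (1 - Q) dQ (1 - Q) = 0
    ([second_form]). *)

(** * Smooth scalar functions *)
Section ScalarSmooth.
Variables (R : realType) (n : nat).
Implicit Types (U : set 'rV[R]_n) (f g : 'rV[R]_n -> R).

(** The classes [Ck] for scalar functions.  Products make sense there, so that
    [sm] can be shown to be stable under the usual operations; [CkP] below
    returns to vector-valued maps. *)
Fixpoint sCk (k : nat) U f : Prop :=
  match k with
  | 0 => forall x, U x -> {for x, continuous f}
  | k'.+1 => (forall x, U x -> differentiable f x) /\
             (forall v, sCk k' U (fun x => 'D_v f x))
  end.

Definition sm U f := forall k, sCk k U f.

Lemma sm_diff U f x : sm U f -> U x -> differentiable f x.
Proof. by move=> /(_ 1%N)[+ _]; apply. Qed.

Lemma sm_der U f v : sm U f -> sm U (fun x => 'D_v f x).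
Proof. by move=> smf k; have [_] := smf k.+1; apply. Qed.

Lemma near_open U (P : 'rV[R]_n -> Prop) x :
  open U -> U x -> (forall y, U y -> P y) -> \forall y \near x, P y.
Proof. by move=> oU Ux H; apply: filterS (open_nbhs_nbhs (conj oU Ux)). Qed.

Lemma differentiable_near (f g : 'rV[R]_n -> R) x :
  (\forall y \near x, f y = g y) -> differentiable f x -> differentiable g x.
Proof.
move=> fg df; have fgx := nbhs_singleton fg.
have fg0 : \forall h \near (0 : 'rV[R]_n), f (h + x) = g (h + x).
  by move: fg; rewrite [\forall x \near _, f _ = _](near_shift 0) subr0.
have main : g \o shift x = cst (g x) + 'd f x +o_ 0 id.
  have /diff_locally H := df.
  apply/eqaddoP => e e0.
  have /eqaddoP/(_ e e0) := H => H1.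
  near=> h.
  have -> : (g \o shift x - (cst (g x) + 'd f x)) h =
     (f \o shift x - (cst (f x) + 'd f x)) h.
    by rewrite /= !fctE /= -fgx; congr (_ - _); apply/esym; near: h.
  by near: h.
have dfg : 'd g x = 'd f x :> (_ -> _).
  by apply: diff_unique => //; exact: diff_continuous.
by apply/diff_locallyP; rewrite dfg; split => //; exact: diff_continuous.
Unshelve. all: by end_near. Qed.

Lemma sCk_ext k U f g : open U -> (forall x, U x -> f x = g x) ->
  sCk k U f -> sCk k U g.
Proof.
move=> oU; elim: k f g => [|k IH] f g fg /=.
  move=> cf x Ux.
  have fgx : \forall y \near x, f y = g y by exact: (near_open oU Ux).
  have := cf x Ux; rewrite /prop_for /continuous_at (fg x Ux); apply: cvg_trans.

  exact: (@near_eq_cvg _ _ _ _ f g fgx).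
case=> df Hf; split=> [x Ux|v].
  by apply: differentiable_near (df x Ux); exact: (near_open oU Ux).
apply: IH (Hf v) => x Ux; apply: near_eq_derive; exact: (near_open oU Ux).
Qed.

Lemma sm_ext U f g : open U -> (forall x, U x -> f x = g x) -> sm U f -> sm U g.
Proof. by move=> oU fg Hf k; apply: sCk_ext (Hf k). Qed.

(** Induction on the order of differentiation does not prove that products are
    smooth, because the derivative of a product is no longer a product.  What
    works is a class of differentiable functions which is stable under
    derivation: all its members are smooth. *)
Lemma sm_coind U (S : ('rV[R]_n -> R) -> Prop) : open U ->
  (forall f, S f -> forall x, U x -> differentiable f x) ->
  (forall f, S f -> forall v, exists2 g, S g & forall x, U x -> 'D_v f x = g x) ->
  forall f, S f -> sm U f.
Proof.
move=> oU dS DS f Sf k; elim: k f Sf => [|k IH] f Sf /=.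
  by move=> x Ux; apply: differentiable_continuous; exact: dS.
split=> [x Ux|v]; first exact: dS.
have [g Sg fg] := DS f Sf v.
by apply: sCk_ext (IH g Sg) => // x Ux; rewrite fg.
Qed.

(** A function of one variable given with all its derivatives: composing with it
    stays inside a class stable under derivation. *)
Definition derseq (D : set R) (h : nat -> R -> R) :=
  forall i x, D x -> is_derive x 1 (h i) (h i.+1 x).

(** The least class to which [sm_coind] applies and which contains sums, products
    and compositions of smooth functions. *)
Inductive alg U : ('rV[R]_n -> R) -> Prop :=
| alg_sm f : sm U f -> alg U f
| alg_add f g : alg U f -> alg U g -> alg U (fun x => f x + g x)
| alg_mul f g : alg U f -> alg U g -> alg U (fun x => f x * g x)
| alg_comp D h i f : derseq D h -> (forall x, U x -> D (f x)) -> alg U f ->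
    alg U (fun x => h i (f x)).

Lemma derive_comp1 (h h' : R -> R) (f : 'rV[R]_n -> R) x v :
  differentiable f x -> is_derive (f x) 1 h (h' (f x)) ->
  differentiable (fun x => h (f x)) x /\
  'D_v (fun x => h (f x)) x = h' (f x) * 'D_v f x.
Proof.
move=> df dh; have dh' : differentiable h (f x) by apply/derivable1_diffP.
have dc : differentiable (h \o f) x by exact: differentiable_comp.
split => //; rewrite -[fun x => _]/(h \o f) !deriveE// diff_comp//=.
have [_ <-] := dh; rewrite deriveE// -[X in 'd h _ X = _]mulr1.
by rewrite [LHS]linearZ mulrC.
Qed.

Lemma sm_alg U f : open U -> alg U f -> sm U f.
Proof.
move=> oU.
have dif g : alg U g -> forall x, U x -> differentiable g x.
  elim=> {g} [g gs x Ux|g h _ IH1 _ IH2 x Ux|g h _ IH1 _ IH2 x Ux|D h i g dh UD _ IH x Ux].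
  - exact: sm_diff gs Ux.
  - by apply: differentiableD; [exact: IH1|exact: IH2].
  - by apply: differentiableM; [exact: IH1|exact: IH2].
  - by have [] := derive_comp1 0 (IH x Ux) (dh i (g x) (UD x Ux)).
apply: (sm_coind oU dif) => {}f; elim=> {f}.
- by move=> f Hf v; exists (fun x => 'D_v f x) => //; apply/alg_sm/sm_der.
- move=> f g af IH1 ag IH2 v.
  have [f' f'1 f'2] := IH1 v; have [g' g'1 g'2] := IH2 v.
  exists (fun x => f' x + g' x) => [|x Ux]; first exact: alg_add.
  by rewrite -f'2// -g'2// -deriveD//; apply/diff_derivable/dif.
- move=> f g af IH1 ag IH2 v.
  have [f' f'1 f'2] := IH1 v; have [g' g'1 g'2] := IH2 v.
  exists (fun x => f x * g' x + g x * f' x) => [|x Ux].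
    by apply: alg_add; apply: alg_mul.
  by rewrite -f'2// -g'2// [LHS]deriveM//; apply/diff_derivable/dif.
- move=> D h i f dh UD af IH v.
  have [f' f'1 f'2] := IH v.
  exists (fun x => h i.+1 (f x) * f' x) => [|x Ux].
    by apply: alg_mul => //; apply: (alg_comp _ dh).
  have [_ ->] := derive_comp1 v (dif _ af x Ux) (dh i (f x) (UD x Ux)).
  by rewrite f'2.
Qed.

Lemma sm_cst U (c : R) : open U -> sm U (fun=> c).
Proof.
move=> oU.
apply: (@sm_coind U (fun f => exists c, f = fun=> c)) => //; last by exists c.
  by move=> f [d ->] x Ux; exact: differentiable_cst.
move=> f [d ->] v; exists (fun=> 0); first by exists 0.
by move=> x _; exact: derive_cst.
Qed.

Lemma sm_add U f g : open U -> sm U f -> sm U g -> sm U (fun x => f x + g x).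
Proof. by move=> oU sf sg; apply: sm_alg => //; apply: alg_add; exact: alg_sm. Qed.

Lemma sm_mul U f g : open U -> sm U f -> sm U g -> sm U (fun x => f x * g x).
Proof. by move=> oU sf sg; apply: sm_alg => //; apply: alg_mul; exact: alg_sm. Qed.

Lemma sm_comp U D h f : open U -> derseq D h -> (forall x, U x -> D (f x)) ->
  sm U f -> sm U (fun x => h 0%N (f x)).
Proof.
by move=> oU dh UD sf; apply: sm_alg => //; apply: (alg_comp _ dh) => //; exact: alg_sm.
Qed.

Lemma derseq_inv : derseq [set y | y != 0]
  (fun i y => (-1) ^+ i * i`!%:R * y ^- i.+1).
Proof.
move=> i y /= y0.
have H : is_derive y 1 (fun y : R => y ^- i.+1) (- (i.+1)%:R * y ^- i.+2).
  have y1 : (y ^+ i.+1)%R != 0 by rewrite expf_neq0.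
  have d1 : derivable (fun y : R => y ^+ i.+1) y 1 by exact: exprn_derivable.
  split; first by apply: derivableV.
  rewrite (@deriveV _ _ (fun y : R => y ^+ i.+1))// exp_derive /GRing.scale /=.
  rewrite mulr1 exprSr -[y ^+ i.+2]/(y ^+ (i.+1).+1) (exprSr _ i.+1) (exprSr _ i).
  by field; rewrite y0 expf_neq0.
have := is_deriveZ ((-1) ^+ i * i`!%:R : R) H.
move=> K; apply: is_derive_eq K _.
rewrite factS natrM [(-1) ^+ i.+1]exprS mulN1r /GRing.scale /=; set Y := y ^- i.+2.
by rewrite !mulNr !mulrN; congr (- _); rewrite !mulrA; congr (_ * _); rewrite -!mulrA; congr (_ * _); rewrite mulrC.
Qed.

Lemma sm_inv U f : open U -> (forall x, U x -> f x != 0) -> sm U f ->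
  sm U (fun x => (f x)^-1).
Proof.
move=> oU f0 sf; have := sm_comp oU derseq_inv f0 sf.
by apply: sm_ext => // x Ux; rewrite expr0 fact0 !mul1r expr1.
Qed.

Lemma sm_sum U (I : Type) (r : seq I) (P : pred I) (F : I -> 'rV[R]_n -> R) :
  open U -> (forall i, P i -> sm U (F i)) -> sm U (fun x => \sum_(i <- r | P i) F i x).
Proof.
move=> oU sF; elim: r => [|i r IH].
  by apply: sm_ext (sm_cst 0 oU) => // x _; rewrite big_nil.
have [Pi|Pi] := boolP (P i).
  by apply: sm_ext (sm_add oU (sF i Pi) IH) => // x _; rewrite big_cons Pi.
by apply: sm_ext IH => // x _; rewrite big_cons (negbTE Pi).
Qed.

Lemma sm_prod U (I : Type) (r : seq I) (P : pred I) (F : I -> 'rV[R]_n -> R) :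
  open U -> (forall i, P i -> sm U (F i)) -> sm U (fun x => \prod_(i <- r | P i) F i x).
Proof.
move=> oU sF; elim: r => [|i r IH].
  by apply: sm_ext (sm_cst 1 oU) => // x _; rewrite big_nil.
have [Pi|Pi] := boolP (P i).
  by apply: sm_ext (sm_mul oU (sF i Pi) IH) => // x _; rewrite big_cons Pi.
by apply: sm_ext IH => // x _; rewrite big_cons (negbTE Pi).
Qed.

Lemma sm_sub U U' f : U' `<=` U -> sm U f -> sm U' f.
Proof.
move=> UU' sf k; move: (sf k); elim: k f {sf} => [|k IH] f /=.
  by move=> H x /UU'; exact: H.
by move=> [H1 H2]; split=> [x /UU'|v]; [exact: H1 | exact: IH].
Qed.

Lemma sm_union U U' f : sm U f -> sm U' f -> sm (U `|` U') f.
Proof.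
move=> sf sf' k; move: (sf k) (sf' k); elim: k f {sf sf'} => [|k IH] f /=.
  by move=> H H' x [|]; [exact: H|exact: H'].
move=> [H1 H2] [H1' H2']; split=> [x [|]|v]; [exact: H1 |exact: H1'| exact: IH].
Qed.

End ScalarSmooth.

Section LinearSmooth.
Variable R : realType.

Lemma sm_scalar n (U : set 'rV[R]_n) (l : {scalar 'rV[R]_n}) : open U -> sm U l.
Proof.
move=> oU.
have lE : forall x, l x = \sum_i x 0 i * l (delta_mx 0 i).
  move=> x; rewrite {1}(row_sum_delta x) linear_sum; apply: eq_bigr => i _.
  by rewrite linearZ.
apply: sm_ext (_ : sm U (fun x => \sum_i x 0 i * l (delta_mx 0 i))) => //.
apply: sm_sum => // i _; apply: sm_mul => //; last exact: sm_cst.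
move=> [|k] /=.
  by move=> x _; exact: coord_continuous.
split; first by move=> x _; exact: differentiable_coord.
move=> v; apply: sCk_ext (sm_cst (v 0 i) oU k) => // x _.
have dd := @differentiable_coord R _ _ x 0 i.
have @f : {linear 'rV[R]_n -> R}.
  by exists (fun N : 'M[R]_(_, _) => N 0 i); do 2![eexists]; do ?[constructor];
     rewrite ?mxE// => ? *; rewrite ?mxE//; move=> ?; rewrite !mxE.
rewrite deriveE//.
by rewrite (_ : (fun _ => _) = f) // diff_lin //; exact: coord_continuous.
Qed.

End LinearSmooth.

(** * Smooth maps between finite-dimensional spaces *)
Section VectorValued.
Variable R : realType.

Lemma differentiable_rV m n (F : 'rV[R]_m -> 'rV[R]_n) x :
  (forall j, differentiable (fun y => F y 0 j) x) -> differentiable F x.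
Proof.
move=> dF.
have -> : F = \sum_(j < n) (fun y => F y 0 j *: (delta_mx 0 j : 'rV[R]_n)).
  by apply/funext => y; rewrite fct_sumE {1}(row_sum_delta (F y)).
by apply: differentiable_sum => j; apply: differentiableZl.
Qed.

Lemma differentiable_rV_coord m n (F : 'rV[R]_m -> 'rV[R]_n) x j :
  differentiable F x -> differentiable (fun y => F y 0 j) x.
Proof.
move=> dF; apply: (@differentiable_comp _ _ _ _ F (fun N : 'rV[R]_n => N 0 j)) => //.
exact: differentiable_coord.
Qed.

Lemma derive_rV_coord m n (F : 'rV[R]_m -> 'rV[R]_n) x v j :
  differentiable F x -> ('D_v F x) 0 j = 'D_v (fun y => F y 0 j) x.
Proof. by move=> dF; rewrite derive_mx ?mxE//; exact: diff_derivable. Qed.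

Lemma CkP m n (U : set 'rV[R]_m) (F : 'rV[R]_m -> 'rV[R]_n) : open U ->
  (forall k, Ck k U F) <-> (forall j, sm U (fun x => F x 0 j)).
Proof.
move=> oU; split=> [FC j k|Fs k].
  move: (FC k) => {FC}; elim: k F => [|k IH] F /=.
    move=> cF x Ux; apply: (@continuous_comp _ _ _ F (fun N : 'rV[R]_n => N 0 j)).
      exact: cF.
    exact: coord_continuous.
  move=> [dF DF]; split=> [x Ux|v]; first exact/differentiable_rV_coord/dF.
  apply: sCk_ext (IH _ (DF v)) => // x Ux; exact/derive_rV_coord/dF.
have {}Fs : forall j, sCk k U (fun x => F x 0 j) by move=> j; exact: Fs.
elim: k F Fs => [|k IH] F Fs /=.
  move=> x Ux.
  have -> : F = \sum_(j < n) (fun y => F y 0 j *: (delta_mx 0 j : 'rV[R]_n)).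
    by apply/funext => y; rewrite fct_sumE {1}(row_sum_delta (F y)).
  rewrite /prop_for; elim/big_ind : _ => [|f g cf cg|j _].
  - exact: cst_continuous.
  - exact: continuousD.
  - by apply: continuousZl; exact: Fs.
have dF x : U x -> differentiable F x.
  by move=> Ux; apply: differentiable_rV => j; apply: (Fs j).1.
split=> // v; apply: IH => j; apply: sCk_ext ((Fs j).2 v) => // x Ux.
by rewrite derive_rV_coord//; exact: dF.
Qed.

Lemma mulmx_differentiable m n (A : 'M[R]_(m, n)) x :
  differentiable (fun y : 'rV[R]_m => y *m A) x.
Proof.
apply: differentiable_rV => j.
pose l := fun y : 'rV[R]_m => (y *m A) 0 j.
have ls : scalar l by move=> a u w; rewrite /l mulmxDl -scalemxAl !mxE.
pose L := HB.pack_for {scalar 'rV[R]_m} l (GRing.isLinear.Build _ _ _ _ l ls).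
exact: (@sm_diff _ _ setT L x (sm_scalar L openT) I).
Qed.

Lemma mulmx_derive m n (A : 'M[R]_(m, n)) x v :
  'D_v (fun y : 'rV[R]_m => y *m A) x = v *m A.
Proof.
rewrite deriveE; last exact: mulmx_differentiable.
have -> : (fun y : 'rV[R]_m => y *m A) = mulmxr A by [].
rewrite diff_lin// => y.
exact/differentiable_continuous/mulmx_differentiable.
Qed.

Lemma sm_mulmx m n (A : 'M[R]_(m, n)) U (f : 'rV[R]_n -> R) : open U -> sm U f ->
  sm [set y | U (y *m A)] (fun y => f (y *m A)).
Proof.
move=> oU.
have oU' : open [set y : 'rV[R]_m | U (y *m A)].
  apply: (open_comp (f := fun y : 'rV[R]_m => y *m A)) => //.
  by move=> y _; exact/differentiable_continuous/mulmx_differentiable.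
move=> sf.
apply: (@sm_coind _ _ _ (fun g => exists2 f, sm U f & g = fun y => f (y *m A))) => //.
- move=> _ [{}f {}sf ->] x /= Ux.
  apply: (@differentiable_comp _ _ _ _ (fun y : 'rV[R]_m => y *m A) f).
    exact: mulmx_differentiable.
  exact: sm_diff sf Ux.
- move=> _ [{}f {}sf ->] v.
  exists (fun y => 'D_(v *m A) f (y *m A)).
    by exists (fun z => 'D_(v *m A) f z) => //; exact: sm_der.
  move=> x /= Ux.
  have df := sm_diff sf Ux.
  have dm := @mulmx_differentiable _ _ A x.
  have H : differentiable (f \o (fun y : 'rV[R]_m => y *m A)) x.
    exact: differentiable_comp.
  rewrite -[fun y => f (y *m A)]/(f \o (fun y : 'rV[R]_m => y *m A)).
  rewrite !deriveE// diff_comp//=.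
  by rewrite -[X in 'd f _ X = _]deriveE// mulmx_derive.
- by exists f.
Qed.

End VectorValued.

Section OnVectType.
Variable R : realType.
Implicit Types V W : vectType R.

Definition smf V (U : set V) (f : V -> R) := sm (v2r @` U) (f \o r2v).
Definition ds V (v : V) (f : V -> R) (x : V) : R := 'D_(v2r v) (f \o r2v) (v2r x).

Lemma imv2r V (U : set V) : v2r @` U = [set y | U (r2v y)].
Proof.
apply/seteqP; split => [_ [x Ux <-]|y Uy] /=; first by rewrite v2rK.
by exists (r2v y) => //; rewrite r2vK.
Qed.

Lemma imv2r_in V (U : set V) x : (v2r @` U) (v2r x) = U x.
Proof. by rewrite imv2r /= v2rK. Qed.

Lemma smf_ext V (U : set V) f g : vopen U -> (forall x, U x -> f x = g x) ->
  smf U f -> smf U g.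
Proof. by move=> oU fg; apply: sm_ext => // y; rewrite imv2r /=; exact: fg. Qed.

Lemma smf_cst V (U : set V) c : vopen U -> smf U (fun=> c).
Proof. exact: sm_cst. Qed.

Lemma smf_add V (U : set V) f g : vopen U -> smf U f -> smf U g ->
  smf U (fun x => f x + g x).
Proof. exact: sm_add. Qed.

Lemma smf_mul V (U : set V) f g : vopen U -> smf U f -> smf U g ->
  smf U (fun x => f x * g x).
Proof. exact: sm_mul. Qed.

Lemma smf_opp V (U : set V) f : vopen U -> smf U f -> smf U (fun x => - f x).
Proof.
move=> oU sf; apply: smf_ext (smf_mul oU (smf_cst (-1) oU) sf) => // x _.
by rewrite mulN1r.
Qed.

Lemma smf_sum V (U : set V) (I : Type) (r : seq I) (P : pred I) (F : I -> V -> R) :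
  vopen U -> (forall i, P i -> smf U (F i)) -> smf U (fun x => \sum_(i <- r | P i) F i x).
Proof. exact: (@sm_sum _ _ _ _ r P (fun i => F i \o r2v)). Qed.

Lemma smf_prod V (U : set V) (I : Type) (r : seq I) (P : pred I) (F : I -> V -> R) :
  vopen U -> (forall i, P i -> smf U (F i)) -> smf U (fun x => \prod_(i <- r | P i) F i x).
Proof. exact: (@sm_prod _ _ _ _ r P (fun i => F i \o r2v)). Qed.

Lemma smf_inv V (U : set V) f : vopen U -> (forall x, U x -> f x != 0) -> smf U f ->
  smf U (fun x => (f x)^-1).
Proof. by move=> oU f0; apply: sm_inv => // y; rewrite imv2r; exact: f0. Qed.

Lemma smf_comp V (U : set V) D h f : vopen U -> derseq D h ->
  (forall x, U x -> D (f x)) -> smf U f -> smf U (fun x => h 0%N (f x)).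
Proof.
by move=> oU dh UD; apply: (sm_comp oU dh) => y; rewrite imv2r; exact: UD.
Qed.

Lemma smf_sub V (U U' : set V) f : U' `<=` U -> smf U f -> smf U' f.
Proof. by move=> UU'; apply: sm_sub; exact: image_subset. Qed.

Lemma smf_union V (U U' : set V) f : smf U f -> smf U' f -> smf (U `|` U') f.
Proof. by move=> sf sf'; rewrite /smf image_setU; exact: sm_union. Qed.

Lemma smf_ds V (U : set V) v f : smf U f -> smf U (ds v f).
Proof.
move=> sf; rewrite /smf (_ : ds v f \o r2v = fun y => 'D_(v2r v) (f \o r2v) y).
  exact: sm_der.
by apply/funext => y; rewrite /ds /= r2vK.
Qed.

Lemma smf_diff V (U : set V) f x : smf U f -> U x ->
  differentiable (f \o r2v) (v2r x).
Proof. by move=> sf Ux; apply: (sm_diff sf); rewrite imv2r_in. Qed.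

Lemma ds_ext V (U : set V) v f g x : vopen U -> U x -> (forall y, U y -> f y = g y) ->
  ds v f x = ds v g x.
Proof.
move=> oU Ux fg; apply: near_eq_derive.
apply: (@near_open _ _ (v2r @` U)); rewrite ?imv2r_in//.
by move=> y; rewrite imv2r; exact: fg.
Qed.

Lemma dsD V (U : set V) v f g x : smf U f -> smf U g -> U x ->
  ds v (fun y => f y + g y) x = ds v f x + ds v g x.
Proof.
move=> sf sg Ux; rewrite /ds -deriveD//; apply: diff_derivable; exact: smf_diff Ux.
Qed.

Lemma dsM V (U : set V) v f g x : smf U f -> smf U g -> U x ->
  ds v (fun y => f y * g y) x = f x * ds v g x + ds v f x * g x.
Proof.
move=> sf sg Ux; rewrite /ds.
have /= -> := @deriveM _ _ (f \o r2v) (g \o r2v) (v2r x) (v2r v).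
- by rewrite /= v2rK /GRing.scale /= [_ * g x]mulrC.
- by apply: diff_derivable; exact: smf_diff Ux.
- by apply: diff_derivable; exact: smf_diff Ux.
Qed.

Lemma ds_cst V (v : V) c x : ds v (fun=> c) x = 0.
Proof. exact: derive_cst. Qed.

Lemma ds_sum V (U : set V) v (I : Type) (r : seq I) (F : I -> V -> R) x :
  vopen U -> (forall i, smf U (F i)) -> U x ->
  ds v (fun y => \sum_(i <- r) F i y) x = \sum_(i <- r) ds v (F i) x.
Proof.
move=> oU sF Ux; elim: r => [|i r IH].
  by rewrite big_nil -[RHS](ds_cst v 0 x); apply: (ds_ext v oU Ux) => y _; rewrite big_nil.
rewrite big_cons -IH -(dsD (U := U))//; last exact: smf_sum.
by apply: (ds_ext v oU Ux) => y _; rewrite big_cons.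
Qed.

Lemma dsZ V (U : set V) v c f x : vopen U -> smf U f -> U x ->
  ds v (fun y => c * f y) x = c * ds v f x.
Proof.
by move=> oU sf Ux; rewrite (dsM v (smf_cst c oU) sf Ux) ds_cst mul0r addr0.
Qed.

Lemma dsN V (U : set V) v f x : vopen U -> smf U f -> U x ->
  ds v (fun y => - f y) x = - ds v f x.
Proof.
move=> oU sf Ux; rewrite -mulN1r -(dsZ _ _ oU sf Ux).
by apply: (ds_ext v oU Ux) => y _; rewrite mulN1r.
Qed.

Lemma ds_dirP V (U : set V) a v w f x : smf U f -> U x ->
  ds (a *: v + w) f x = a * ds v f x + ds w f x.
Proof.
move=> sf Ux; have df := smf_diff sf Ux.
by rewrite /ds !deriveE// !linearP.
Qed.

Lemma ds_dir0 V f (x : V) : ds 0 f x = 0.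
Proof. by rewrite /ds linear0 derive0. Qed.

Lemma ds_dir_sum V (U : set V) (I : Type) (r : seq I) (c : I -> R) (v : I -> V) f x :
  smf U f -> U x ->
  ds (\sum_(i <- r) c i *: v i) f x = \sum_(i <- r) c i * ds (v i) f x.
Proof.
move=> sf Ux; elim: r => [|i r IH]; first by rewrite !big_nil ds_dir0.
by rewrite !big_cons (ds_dirP _ _ _ sf Ux) IH.
Qed.

Lemma linear_coordE V W (L : V -> W) : linear L ->
  exists A : 'M[R]_(dim V, dim W), forall v, v2r (L v) = v2r v *m A.
Proof.
move=> Ll; pose F := fun x : 'rV[R]_(dim V) => v2r (L (r2v x)).
have Fl : linear F by move=> a u w; rewrite /F !linearP /= Ll linearP.
pose FL := HB.pack_for {linear 'rV[R]_(dim V) -> 'rV[R]_(dim W)} F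
  (GRing.isLinear.Build _ _ _ _ F Fl).
by exists (lin1_mx FL) => v; rewrite mul_rV_lin1 /= /F v2rK.
Qed.

Lemma vopen_lin V W (L : V -> W) (U : set W) : linear L -> vopen U -> vopen (L @^-1` U).
Proof.
move=> /linear_coordE[A LA] oU.
rewrite /vopen imv2r (_ : [set y | _] = [set y | (v2r @` U) (y *m A)]).
  apply: (open_comp (f := fun y : 'rV[R]__ => y *m A)) => //.
  by move=> y _; exact/differentiable_continuous/mulmx_differentiable.
have eA y : y *m A = v2r (L (r2v y)) by rewrite LA r2vK.
by apply/funext => y; rewrite /mkset eA imv2r_in.
Qed.

Lemma smf_complin V W (L : V -> W) (U : set W) f : linear L -> vopen U -> smf U f ->
  smf (L @^-1` U) (fun x => f (L x)).
Proof.
move=> Ll oU sf; have [A LA] := linear_coordE Ll.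
have eA y : y *m A = v2r (L (r2v y)) by rewrite LA r2vK.
have := @sm_mulmx _ _ _ A _ _ oU sf.
rewrite /smf.
have -> : v2r @` (L @^-1` U) = [set y | (v2r @` U) (y *m A)].
  by rewrite imv2r; apply/funext => y; rewrite /mkset eA imv2r_in.
by congr (sm _ _); apply/funext => y /=; rewrite eA v2rK.
Qed.

Lemma ds_complin V W (L : V -> W) (U : set W) f v x : linear L -> smf U f -> U (L x) ->
  ds v (fun x => f (L x)) x = ds (L v) f (L x).
Proof.
move=> Ll sf Ux; have [A LA] := linear_coordE Ll.
rewrite /ds (_ : _ \o r2v = (f \o r2v) \o (fun y => y *m A)); last first.
  by apply/funext => y /=; rewrite -[y in y *m A]r2vK -LA v2rK.
have df : differentiable (f \o r2v) (v2r x *m A) by rewrite -LA; exact: smf_diff Ux.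
have dm := @mulmx_differentiable _ _ _ A (v2r x).
rewrite deriveE; last exact: differentiable_comp.
rewrite diff_comp//= -[X in 'd _ _ X = _]deriveE// mulmx_derive -LA.
by rewrite [RHS]deriveE -?LA//; rewrite LA.
Qed.

Lemma scalar_coordE V (l : V -> R) : scalar l ->
  forall v, l v = \sum_i v2r v 0 i * l (r2v (delta_mx 0 i)).
Proof.
move=> ls v.
pose L := HB.pack_for {scalar V} l (GRing.isLinear.Build _ _ _ _ l ls).
rewrite -[l]/(L : _ -> _) -{1}(v2rK v) {1}(row_sum_delta (v2r v)) !linear_sum.
by apply: eq_bigr => i _; rewrite !linearZ.
Qed.

Lemma scalar_coord V i : scalar (fun v : V => v2r v 0 i).
Proof. by move=> a u w; rewrite linearP !mxE. Qed.

Lemma smf_lin V (U : set V) l : vopen U -> scalar l -> smf U l.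
Proof.
move=> oU ls.
have l's : scalar (l \o r2v) by move=> a u w; rewrite /= linearP ls.
pose L := HB.pack_for {scalar 'rV[R]_(dim V)} (l \o r2v) (GRing.isLinear.Build _ _ _ _ _ l's).
exact: (sm_scalar L).
Qed.

Lemma ds_lin V (l : V -> R) v x : scalar l -> ds v l x = l v.
Proof.
move=> ls.
have l's : scalar (l \o r2v) by move=> a u w; rewrite /= linearP ls.
pose L := HB.pack_for {scalar 'rV[R]_(dim V)} (l \o r2v) (GRing.isLinear.Build _ _ _ _ _ l's).
have dL y : differentiable L y by apply: (@sm_diff _ _ setT) => //; exact: (sm_scalar L openT).
rewrite /ds -[l \o r2v]/(L : _ -> _) deriveE// diff_lin /= ?v2rK// => y.
exact: differentiable_continuous.
Qed.

Lemma smooth_onP V W (U : set V) (f : V -> W) : vopen U ->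
  smooth_on U f <-> forall j, smf U (fun x => v2r (f x) 0 j).
Proof. by move=> oU; apply: (CkP (coord_map f) oU). Qed.

Lemma smooth_on_scalar V W (U : set V) (f : V -> W) l : vopen U -> scalar l ->
  smooth_on U f -> smf U (fun x => l (f x)).
Proof.
move=> oU ls /(smooth_onP _ oU) fs.
apply: smf_ext (smf_sum (index_enum _) oU
  (fun i (_ : true) => smf_mul oU (fs i) (smf_cst (l (r2v (delta_mx 0 i))) oU))) => //.
by move=> x Ux; rewrite (scalar_coordE ls).
Qed.

Lemma pder_coord V W (U : set V) (f : V -> W) v x j : vopen U -> smooth_on U f -> U x ->
  v2r (pder v f x) 0 j = ds v (fun x => v2r (f x) 0 j) x.
Proof.
move=> oU sf Ux; rewrite /pder r2vK derive_rV_coord//.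
by apply: (sf 1%N).1; rewrite imv2r_in.
Qed.

Lemma pder_scalar V W (U : set V) (f : V -> W) l v x : vopen U -> scalar l ->
  smooth_on U f -> U x -> l (pder v f x) = ds v (fun x => l (f x)) x.
Proof.
move=> oU ls sf Ux; rewrite (scalar_coordE ls).
have fs := (smooth_onP f oU).1 sf.
have sj j := smf_mul oU (fs j) (smf_cst (l (r2v (delta_mx 0 j))) oU).
transitivity (ds v (fun x => \sum_i v2r (f x) 0 i * l (r2v (delta_mx 0 i))) x).
  rewrite (ds_sum _ _ oU sj Ux); apply: eq_bigr => i _.
  rewrite (pder_coord _ _ oU sf Ux) (dsM v (fs i) (smf_cst _ oU) Ux).
  by rewrite ds_cst mulr0 add0r.
by apply: (ds_ext v oU Ux) => y _; rewrite -(scalar_coordE ls).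
Qed.

End OnVectType.

(** * Cut-off functions *)
Section Bump.
Variable R : realType.
Implicit Types V W : vectType R.

(** The functions P(1/t) exp(-1/t), extended by 0: the family of all derivatives
    of exp(-1/t).  The derivative of the one given by P is the one given by
    X^2 (P - P'). *)
Definition hb (P : {poly R}) (t : R) : R :=
  if 0 < t then P.[t^-1] * expR (- t^-1) else 0.

Definition hb_step (P : {poly R}) : {poly R} := 'X ^+ 2 * (P - P^`()).

Lemma hb_pos P t : 0 < t -> hb P t = P.[t^-1] * expR (- t^-1).
Proof. by rewrite /hb => ->. Qed.

Lemma hb_npos P t : t <= 0 -> hb P t = 0.
Proof. by rewrite /hb ltNge => ->. Qed.

Lemma poly_bound (P : {poly R}) : exists2 C, 0 <= C &
  forall y, 1 <= y -> `|P.[y]| <= C * y ^+ size P.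
Proof.
exists (\sum_(i < size P) `|P`_i|); first by apply: sumr_ge0.
move=> y y1; rewrite horner_coef mulr_suml (le_trans (ler_norm_sum _ _ _))//.
apply: ler_sum => i _; rewrite normrM ler_wpM2l//.
have y0 : 0 <= y by lra.
by rewrite ger0_norm ?exprn_ge0// ler_weXn2l// ltnW.
Qed.

(** The exponential beats every power of 1/t: this is what makes these functions
    differentiable at 0. *)
Lemma hb_lin (P : {poly R}) : exists2 C, 0 <= C &
  forall t, t <= 1 -> `|hb P t| <= C * `|t|.
Proof.
have [C C0 HC] := poly_bound P.
set n := size P in HC.
exists (C * (n.+1)`!%:R); first by rewrite mulr_ge0.
move=> t t1; have [t0|t0] := ltP 0 t; last by rewrite hb_npos// normr0 !mulr_ge0.
rewrite hb_pos// normrM (ger0_norm (expR_ge0 _)) (gtr0_norm t0).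
have y1 : 1 <= t^-1 by rewrite invf_ge1.
have y0 : 0 < t^-1 by rewrite invr_gt0.
apply: le_trans (ler_wpM2r (expR_ge0 _) (HC _ y1)) _.
rewrite -!mulrA ler_wpM2l// expRN ler_pdivrMr ?expR_gt0//.
have := @expR_ge1Dxn _ t^-1 n (ltW y0).
have f0 : 0 < (n.+1)`!%:R :> R by rewrite ltr0n fact_gt0.
move=> H; have {H} : t^-1 ^+ n.+1 / (n.+1)`!%:R <= expR t^-1 by lra.
rewrite ler_pdivrMr// => H.
have -> : (n.+1)`!%:R * t * expR t^-1 = t * (expR t^-1 * (n.+1)`!%:R) by ring.
apply: le_trans (ler_wpM2l (ltW t0) H).
by rewrite exprS mulrA divff ?mul1r// gt_eqF.
Qed.

Lemma is_derive_hb (P : {poly R}) (t : R) : is_derive t 1 (hb P) (hb (hb_step P) t).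
Proof.
have [t0|t0|->] := ltgtP t 0.
- rewrite hb_npos ?ltW//.
  apply: (@near_eq_is_derive R R R (fun=> 0) (hb P) t 1 0).
  near=> y; rewrite hb_npos//.
  by apply/ltW; near: y; exact: lt_nbhsl.
- rewrite hb_pos//.
  apply: (@near_eq_is_derive R R R (fun t : R => P.[t^-1] * expR (- t^-1)) (hb P) t 1).
    near=> y; rewrite hb_pos//.
    by near: y; exact: lt_nbhsr.
  have t0' : t != 0 by rewrite gt_eqF.
  have dV : is_derive t 1 (fun t : R => t^-1) (- t ^- 2).
    by apply: is_derive_eq (is_deriveV t0' (is_derive_id t 1)) _; rewrite /GRing.scale /= mulr1.
  have dP : is_derive t 1 (fun t : R => P.[t^-1]) (P^`().[t^-1] * - t ^- 2).
    exact: (@is_derive1_comp _ (horner P)).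
  have dN : is_derive t 1 (fun t : R => - t^-1) (t ^- 2).
    by apply: is_derive_eq (is_deriveN dV) _; rewrite opprK.
  have dE : is_derive t 1 (fun t : R => expR (- t^-1)) (expR (- t^-1) * t ^- 2).
    exact: (@is_derive1_comp _ expR).
  apply: is_derive_eq (is_deriveM dP dE) _.
  rewrite /hb_step !hornerE exprVn.
  transitivity (P.[t^-1] * (expR (- t^-1) * t ^- 2) +
    expR (- t^-1) * (P^`().[t^-1] * - t ^- 2)); first by [].
  by ring.
- rewrite hb_npos//.
  have [C C0 HC] := hb_lin ('X * P).
  have Q h : h != 0 -> h^-1 * hb P h = hb ('X * P) h.
    move=> h0; rewrite /hb; case: ifP => h1; last by rewrite mulr0.
    by rewrite hornerM hornerX mulrA.
  have lim0 : h^-1 *: (hb P (h *: 1 + 0) - hb P 0) @[h --> 0^'] --> (0 : R).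
    apply/cvgrPdist_le => e e0; near=> h.
    have h0 : h != 0 by near: h; exact: nbhs_dnbhs_neq.
    rewrite sub0r normrN addr0 (hb_npos P (lexx 0)) subr0 /GRing.scale /= mulr1 Q//.
    have hC : `|h| <= e / (C + 1).
      by near: h; apply: dnbhs0_le; rewrite divr_gt0//; lra.
    have h1 : `|h| <= 1 by near: h; apply: dnbhs0_le.
    apply: le_trans (HC h (le_trans (ler_norm h) h1)) _.
    apply: le_trans (ler_wpM2l C0 hC) _.
    have C1 : 0 < C + 1 by lra.
    rewrite mulrA ler_pdivrMr// mulrDr mulr1 [C * e]mulrC; lra.
  by split; [apply/cvg_ex; exists 0 | exact: cvg_lim lim0].
Unshelve. all: by end_near. Qed.

Lemma derseq_hb (P : {poly R}) : derseq setT (fun i => hb (iter i hb_step P)).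
Proof. by move=> i x _; exact: is_derive_hb. Qed.

Lemma hb1_gt0 t : 0 < t -> 0 < hb 1 t.
Proof. by move=> t0; rewrite hb_pos// hornerC mul1r expR_gt0. Qed.

Lemma hb1_ge0 t : 0 <= hb 1 t.
Proof. by have [t0|/hb_npos->//] := ltP 0 t; rewrite ltW// hb1_gt0. Qed.

Lemma vopen_gt V (U : set V) (f : V -> R) c : vopen U -> smf U f ->
  vopen [set x | U x /\ c < f x].
Proof.
move=> oU sf; rewrite /vopen openE => y; rewrite imv2r /= => -[Uy cy].
have Uy' : (v2r @` U) y by rewrite imv2r.
have cf := differentiable_continuous (sm_diff sf Uy').
have := cf _ (lt_nbhsr cy).
rewrite /interior nbhs_simpl /= => H.
have H2 := open_nbhs_nbhs (conj oU Uy').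
by apply: filterS2 H H2 => z H1 Uz; split => //; move: Uz; rewrite imv2r.
Qed.

Lemma vopen_setI V (U U' : set V) : vopen U -> vopen U' -> vopen (U `&` U').
Proof. by move=> oU oU'; rewrite /vopen imv2r; have := openI oU oU'; rewrite !imv2r. Qed.

Lemma vopen_setT V : vopen [set: V].
Proof. by rewrite /vopen imv2r; exact: openT. Qed.

(** With q the squared distance to u, r^2 = 2 a the square of the radius of a ball
    inside U and h(t) = exp(-1/t) extended by 0, the function
    chi = h(a - q) / (h(a - q) + h(q - a/2)) is 1 for q < a/2 and 0 for q >= a.
    Since chi vanishes near the complement of U, multiplication by chi turns
    functions which are smooth on U only into globally smooth ones. *)
Lemma cutoff V (U : set V) u : vopen U -> U u ->
  exists (chi : V -> R) (U1 : set V), [/\ vopen U1, U1 u, U1 `<=` U,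
    (forall x, U1 x -> chi x = 1) /\ (forall x, ~ U x -> chi x = 0) &
    forall f, smf U f -> smf setT (fun x => chi x * f x)].
Proof.
move=> oU Uu.
have [r r0 rU] : exists2 r, 0 < r & forall y, `|y - v2r u| < r -> U (r2v y).
  have Uu' : (v2r @` U) (v2r u) by rewrite imv2r_in.
  have /nbhs_normP[r r0 H] := open_nbhs_nbhs (conj oU Uu').
  by exists r => // y yr; have := H y; rewrite imv2r /=; apply; rewrite /= distrC.
pose q (x : V) := \sum_i (v2r x 0 i - v2r u 0 i) * (v2r x 0 i - v2r u 0 i).
have sT : vopen [set: V] by exact: vopen_setT.
have sq : smf setT q.
  apply: smf_sum => // i _.
  have sc : smf setT (fun x : V => v2r x 0 i - v2r u 0 i).
    apply: smf_add => //; last exact: smf_cst.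
    by apply: smf_lin => //; exact: scalar_coord.
  exact: smf_mul.
have qU x : q x < r ^+ 2 -> U x.
  move=> qr; rewrite -(v2rK x); apply: rU.
  have [->|n0] := eqVneq (v2r x - v2r u) 0; first by rewrite normr0.
  have [[i0 i] /= e] : exists i, mx_norm (v2r x - v2r u) = `|(v2r x - v2r u) i.1 i.2|.
    by apply: mx_norm_neq0; apply: contra_neq n0; exact: mx_norm_eq0.
  rewrite [X in X < _]/Num.Def.normr /= e (ord1 i0) !mxE -(@ltr_pXn2r _ 2)// ?nnegrE ?ltW//.
  apply: le_lt_trans qr; rewrite real_normK ?num_real// expr2.
  by rewrite /q (bigD1 i)//= lerDl sumr_ge0// => j _; rewrite -expr2 sqr_ge0.
pose a := r ^+ 2 / 2.
have a0 : 0 < a by rewrite divr_gt0// exprn_gt0.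
have shb c s : smf setT (fun x => hb 1 (c + s * q x)).
  apply: (smf_comp sT (derseq_hb 1)) => //.
  by apply: smf_add => //; [exact: smf_cst|apply: smf_mul => //; exact: smf_cst].
pose A x := hb 1 (a + (-1) * q x).
pose B x := hb 1 (- (a / 2) + 1 * q x).
have AB0 x : 0 < A x + B x.
  have [qa|qa] := ltP (q x) a.
    by rewrite ltr_pwDl ?hb1_ge0// hb1_gt0//; lra.
  rewrite ltr_wpDl ?hb1_ge0// hb1_gt0//; lra.
pose chi x := A x * (A x + B x)^-1.
have schi : smf setT chi.
  apply: smf_mul => //; first exact: shb.
  apply: smf_inv => // [x _|]; first by rewrite gt_eqF.
  by apply: smf_add => //; exact: shb.
have chi0 x : a <= q x -> chi x = 0.
  by move=> aq; rewrite /chi /A hb_npos ?mul0r//; lra.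
exists chi, [set x | setT x /\ - (a/2) < (-1) * q x]; split.
- by apply: vopen_gt => //; apply: smf_mul => //; exact: smf_cst.
- split=> //; have -> : q u = 0 by rewrite /q big1// => i _; rewrite subrr mulr0.
  by rewrite mulr0 oppr_lt0 divr_gt0.
- by move=> x [_ H]; apply: qU; rewrite /a in H; have := sqr_ge0 r; lra.
- split=> x; last first.
    move=> nU; apply: chi0; rewrite leNgt; apply/negP => H; apply: nU.
    by apply: qU; rewrite /a in H; have := sqr_ge0 r; lra.
  move=> [_ H]; rewrite /chi.
  have B0 : B x = 0 by rewrite /B hb_npos//; lra.
  by have := AB0 x; rewrite B0 addr0 => A0; rewrite divff// gt_eqF.
- move=> f sf.
  have o2 : vopen [set x | setT x /\ a < q x] by exact: vopen_gt.
  have : smf (U `|` [set x | setT x /\ a < q x]) (fun x => chi x * f x).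
    apply: smf_union; first by apply: smf_mul => //; exact: smf_sub schi.
    apply: smf_ext (smf_cst 0 o2) => // x [_ /= H].
    by rewrite chi0 ?mul0r// ltW.
  rewrite (_ : _ `|` _ = setT)//; apply/seteqP; split=> // x _.
  have [H|H] := ltP a (q x); [by right | left; apply: qU; rewrite /a in H].
  have : 0 < r ^+ 2 by rewrite exprn_gt0.
  lra.
Qed.
End Bump.

(** Matrices carry a norm and a complete uniformity; this instance records that
    they form complete normed modules, as the Banach fixed point theorem asks. *)
HB.instance Definition _ (R : realType) (m n : nat) :=
  Uniform_isComplete.Build 'M[R]_(m, n) (@mx_complete R m n).

(** * Functions vanishing on a submanifold *)
Section MeanValue.
Variable R : realType.

Lemma MVT_line n (f : 'rV[R]_n -> R) x h :
  (forall t, 0 <= t -> t <= 1 -> differentiable f (x + t *: h)) ->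
  exists t, [/\ 0 <= t, t <= 1 & f (x + h) - f x = 'D_h f (x + t *: h)].
Proof.
move=> df.
pose l (t : R) := x + t *: h.
have dl (t : R) : is_derive t 1 l h.
  have d1 : is_derive t 1 (fun _ : R => x) 0 by exact: is_derive_cst.
  have d2 : is_derive t 1 (fun t : R => t *: h) h.
    have dd : differentiable (fun t : R => t *: h) t by [].
    split; first exact: diff_derivable.
    rewrite deriveE//.
    by rewrite diff_val scale1r.
  by have := is_deriveD d1 d2; rewrite add0r.
have dg (t : R) : 0 <= t -> t <= 1 -> is_derive t 1 (f \o l) ('D_h f (l t)).
  move=> t0 t1; have dft := df t t0 t1.
  have [/derivable1_diffP dlt lh] := dl t.
  split; first by apply/derivable1_diffP; exact: differentiable_comp.
  rewrite deriveE; last exact: differentiable_comp.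
  by rewrite diff_comp//= -[in RHS]lh !deriveE.
have := @MVT_segment R (f \o l) (fun t => 'D_h f (l t)) 0 1 ler01.
case.
- by move=> t; rewrite in_itv /= => /andP[t0 t1]; apply: dg; exact: ltW.
- apply: derivable_within_continuous => t; rewrite in_itv /= => /andP[t0 t1].
  by have [] := dg t t0 t1.
move=> t; rewrite in_itv /= => /andP[t0 t1]; rewrite /l /= scale1r scale0r addr0 subr0 mulr1.
by exists t.
Qed.

Lemma derive_sum_coord n (f : 'rV[R]_n -> R) x h : differentiable f x ->
  'D_h f x = \sum_i h 0 i * 'D_(delta_mx 0 i) f x.
Proof.
move=> df; rewrite deriveE// {1}(row_sum_delta h) linear_sum; apply: eq_bigr => i _.
by rewrite linearZ /= deriveE.
Qed.

Lemma ler_coord_norm m n (x : 'M[R]_(m, n)) i j : `|x i j| <= `|x|.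
Proof.
rewrite [leRHS]/Num.Def.normr /= mx_normrE.
exact: (le_bigmax _ (fun k => `|x k.1 k.2|) (i, j)).
Qed.

Lemma norm_rV_le m n (x : 'M[R]_(m, n)) c : 0 <= c -> (forall i j, `|x i j| <= c) -> `|x| <= c.
Proof.
move=> c0 H; rewrite /Num.Def.normr /= mx_normrE (bigmax_le _ c0)// => -[i j] _.
Qed.

Lemma lip_bound n (f : 'rV[R]_n -> R) x h c :
  (forall t, 0 <= t -> t <= 1 -> differentiable f (x + t *: h)) ->
  (forall t i, 0 <= t -> t <= 1 -> `|'D_(delta_mx 0 i) f (x + t *: h)| <= c) ->
  `|f (x + h) - f x| <= n%:R * c * `|h|.
Proof.
move=> df dc; have [t [t0 t1 ->]] := MVT_line df.
rewrite derive_sum_coord; last exact: df.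
apply: le_trans (ler_norm_sum _ _ _) _.
have -> : n%:R * c * `|h| = \sum_(i < n) (`|h| * c).
  by rewrite sumr_const card_ord -mulr_natl; ring.
apply: ler_sum => i _; rewrite normrM ler_pM//; first exact: ler_coord_norm.
exact: dc.
Qed.

(** When B is a right inverse of the differential of G at m, the map
    w |-> w - G (m + w B) + G m + y has a small derivative near 0, hence is a
    contraction of a small ball; its fixed point solves G x = G m + y. *)
Lemma locally_onto n k (U : set 'rV[R]_n) (G : 'rV[R]_n -> 'rV[R]_k) m (B : 'M[R]_(k, n)) :
  open U -> U m -> (forall j, sm U (fun x => G x 0 j)) ->
  (forall i j, 'D_(row i B) (fun x => G x 0 j) m = (i == j)%:R) ->
  exists2 rho, 0 < rho & forall y, `|y| <= rho -> exists2 x, U x & G x = G m + y.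
Proof.
move=> oU Um sG dG.
pose L (w : 'rV[R]_k) := m + w *m B.
have dL w : differentiable L w.
  apply: (@differentiableD _ _ _ (fun=> m) (fun w => w *m B)) => //.
  exact: mulmx_differentiable.
have cL : continuous L by move=> w; exact: differentiable_continuous.
pose U' := [set w | U (L w)].
have oU' : open U' by apply: (open_comp (f := L)) => // w _; exact: cL.
pose phi j (w : 'rV[R]_k) : R := w 0 j - G (L w) 0 j.
have dG' w j : U' w -> differentiable (fun w => G (L w) 0 j) w.
  move=> Uw; apply: (@differentiable_comp _ _ _ _ L (fun x => G x 0 j)) => //.
  exact: (sm_diff (sG j)).
have dphi w j : U' w -> differentiable (phi j) w.
  move=> Uw; apply: differentiableB; first exact: differentiable_coord.
  exact: dG'.
have Dphi w i j : U' w ->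
  'D_(delta_mx 0 i) (phi j) w = (i == j)%:R - 'D_(row i B) (fun x => G x 0 j) (L w).
  move=> Uw; rewrite /phi.
  have d1 : differentiable (fun w : 'rV[R]_k => w 0 j) w by exact: differentiable_coord.
  have d2 := dG' w j Uw.
  rewrite (@deriveB _ _ _ (fun w : 'rV[R]_k => w 0 j) (fun w => G (L w) 0 j)); last 2 first.
  - exact: diff_derivable.
  - exact: diff_derivable.
  congr (_ - _).
    have := @derive_rV_coord R k k id w (delta_mx 0 i) j.
    rewrite derive_id mxE /= => <-//; first by rewrite eq_sym.
  rewrite deriveE//.
  rewrite -[fun w => G (L w) 0 j]/((fun x => G x 0 j) \o L).
  have d3 := sm_diff (sG j) Uw.
  rewrite diff_comp//= -deriveE//.
  suff -> : 'd L w (delta_mx 0 i) = row i B by [].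
  rewrite -deriveE// (@deriveD _ _ _ (fun=> m) (fun w => w *m B))//; last first.
    by apply: diff_derivable; exact: mulmx_differentiable.
  by rewrite derive_cst add0r mulmx_derive -rowE.
have U'0 : U' 0 by rewrite /U' /L /= mul0mx addr0.
pose c : R := (2 * k.+1%:R)^-1.
have c0 : 0 < c by rewrite invr_gt0 mulr_gt0.
have [r r0 Hr] : exists2 r, 0 < r & forall w, `|w| <= r ->
    U' w /\ forall i j, `|'D_(delta_mx 0 i) (phi j) w| <= c.
  have nU : \forall w \near (0 : 'rV[R]_k), U' w := open_nbhs_nbhs (conj oU' U'0).
  have nD i j : \forall w \near (0 : 'rV[R]_k),
      `|(i == j)%:R - 'D_(row i B) (fun x => G x 0 j) (L w)| <= c.
    have c1 : {for (0 : 'rV[R]_k),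
        continuous (fun w => (i == j)%:R - 'D_(row i B) (fun x => G x 0 j) (L w))}.
      apply: continuousB; first exact: cst_continuous.
      apply: (@continuous_comp _ _ _ L (fun z => 'D_(row i B) (fun x => G x 0 j) z)).
        exact: cL.
      apply: (sm_der (row i B) (sG j) 0%N).
      exact: U'0.
    have /cvgrPdist_le/(_ c c0) := c1.
    have L0 : L 0 = m by rewrite /L mul0mx addr0.
    rewrite L0 dG subrr.
    by apply: filterS => w; rewrite sub0r normrN.
  have {}nD : \forall w \near (0 : 'rV[R]_k), forall i j,
      `|(i == j)%:R - 'D_(row i B) (fun x => G x 0 j) (L w)| <= c.
    have nDi i : \forall w \near (0 : 'rV[R]_k), forall j,
        `|(i == j)%:R - 'D_(row i B) (fun x => G x 0 j) (L w)| <= c.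
      exact: (@filter_forall _ _ (fun j w => `|(i == j)%:R -
        'D_(row i B) (fun x => G x 0 j) (L w)| <= c) _ _ (nD i)).
    exact: (@filter_forall _ _ (fun i w => forall j, `|(i == j)%:R -
        'D_(row i B) (fun x => G x 0 j) (L w)| <= c) _ _ nDi).
  have nUD : \forall w \near (0 : 'rV[R]_k), U' w /\ forall i j,
      `|(i == j)%:R - 'D_(row i B) (fun x => G x 0 j) (L w)| <= c by exact: filterI nU nD.
  have /nbhs_normP[r /= r0 H] := nUD.
  exists (r / 2); first by rewrite divr_gt0.
  move=> w wr; have [|Uw Dw] := H w.
    by rewrite /= sub0r normrN; apply: le_lt_trans wr _; lra.
  by split=> // i j; rewrite Dphi.
exists (r / 2); first by rewrite divr_gt0.
move=> y yr.
pose Bl := [set w : 'rV[R]_k | `|w| <= r].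
pose f (w : 'rV[R]_k) : 'rV[R]_k := w - G (L w) + G m + y.
have fphi w w' : `|w| <= r -> `|w'| <= r -> `|f w - f w'| <= 2^-1 * `|w - w'|.
  move=> wr wr'.
  have -> : f w - f w' = \row_j (phi j w - phi j w').
    by apply/rowP => j; rewrite /f /phi !mxE; ring.
  apply: norm_rV_le => [|i j]; first by rewrite mulr_ge0.
  rewrite (ord1 i) mxE.
  have seg t : 0 <= t -> t <= 1 -> `|w' + t *: (w - w')| <= r.
    move=> t0 t1; have -> : w' + t *: (w - w') = (1 - t) *: w' + t *: w.
      by rewrite scalerBr scalerBl scale1r; apply/rowP => ?; rewrite !mxE; ring.
    apply: le_trans (ler_normD _ _) _; rewrite !normrZ.
    rewrite (ger0_norm t0) ger0_norm; last lra.
    have -> : r = (1 - t) * r + t * r by ring.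
    by apply: lerD; apply: ler_wpM2l => //; lra.
  have := @lip_bound k (phi j) w' (w - w') c.
  rewrite [w' + (w - w')]addrC subrK => H.
  apply: le_trans (H _ _) _.
  - by move=> t t0 t1; apply: dphi; exact: (Hr _ (seg t t0 t1)).1.
  - by move=> t i' t0 t1; exact: (Hr _ (seg t t0 t1)).2.
  rewrite ler_wpM2r// /c invfM mulrCA ler_piMr//.
  by rewrite ler_pdivrMr ?mul1r ?ler_nat.
have fB w : `|w| <= r -> `|f w| <= r.
  move=> wr; have -> : f w = (f w - f 0) + y.
    rewrite /f /L !mul0mx !addr0; apply/rowP => j; rewrite !mxE; ring.
  apply: le_trans (ler_normD _ _) _.
  have := fphi w 0 wr; rewrite normr0 subr0 => /(_ (ltW r0)).
  by move=> H; lra.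
have fisfun : {homo f : x / Bl x} by move=> w; exact: fB.
pose ff := @mkfun_fun _ _ Bl Bl f fisfun.
have ctr : is_contraction ff.
  exists 2^-1%:nng; split=> /=; first lra.
  by move=> [w w'] [/= wr wr']; exact: fphi.
have Bcl : closed Bl.
  apply: (@closed_comp _ _ (fun w : 'rV[R]_k => `|w|) [set t | t <= r]).
    by move=> w _; exact: norm_continuous.
  exact: closed_le.
have Bn : Bl !=set0 by exists 0; rewrite /Bl /= normr0 ltW.
have [w Bw wE] := banach_fixed_point ctr Bcl Bn.
exists (L w); first exact: (Hr w Bw).1.
move: wE; rewrite /ff /= /mkfun /f => wE.
apply/rowP => j; move/rowP/(_ j): wE; rewrite !mxE; lra.
Qed.

End MeanValue.

Section Lagrange.
Variable R : realType.

(** The Lagrange multiplier rule.  If the derivative of f along v were not 0, then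
    (F, f) would have a surjective differential at m, for F the local equation
    of N; by [locally_onto] it would take a value (0, rho) with rho > 0, at a
    point which lies on N because F vanishes there. *)
Lemma tangent_vanish (V : vectType R) (N : set V) m v (U : set V) (f : V -> R) :
  N m -> tangent N m v -> vopen U -> U m -> smf U f ->
  (forall x, U x -> N x -> f x = 0) -> ds v f m = 0.
Proof.
move=> Nm [k [U1 [F [[oU1 U1m sF NF surj] dF]]]] oU Um sf f0.
apply/eqP/negP => /negP dn0; set c := ds v f m in dn0.
pose U2 := U `&` U1.
have oU2 : vopen U2 by exact: vopen_setI.
have U2m : U2 m by [].
pose G (y : 'rV[R]_(dim V)) : 'rV[R]_(k + 1) := row_mx (F (r2v y)) (f (r2v y))%:M.
have idsc j : scalar (fun w : 'rV[R]_k => w 0 j) by move=> a u w; rewrite !mxE.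
have sFj j : smf U1 (fun x => F x 0 j) by exact: (smooth_on_scalar oU1 (idsc j) sF).
have GlE j : (fun y => G y 0 (lshift 1 j)) = (fun x => F x 0 j) \o r2v.
  by apply/funext => y; rewrite /G row_mxEl.
have GrE j : (fun y => G y 0 (rshift k j)) = f \o r2v.
  by apply/funext => y; rewrite /G row_mxEr (ord1 j) mxE eqxx mulr1n.
have sG j : sm (v2r @` U2) (fun y => G y 0 j).
  case: (split_ordP j) => j' ->.
    rewrite [fun y => _]GlE; apply: sm_sub (sFj j').
    by apply: image_subset => ? [].
  rewrite [fun y => _]GrE; apply: sm_sub sf.
  by apply: image_subset => ? [].
have pF w j : pder w F m 0 j = ds w (fun x => F x 0 j) m.
  exact: (pder_scalar w oU1 (idsc j) sF U1m).
(* v is killed by the differential of F, so it corrects the last coordinate only *)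
have surj2 (w : 'rV[R]_k) (s : R) : exists u : V,
    (forall j, ds u (fun x => F x 0 j) m = w 0 j) /\ ds u f m = s.
  have [u uw] := surj m U1m w.
  exists (((s - ds u f m) / c) *: v + u); split.
    by move=> j; rewrite (ds_dirP _ _ _ (sFj j) U1m) -!pF dF uw mxE mulr0 add0r.
  by rewrite (ds_dirP _ _ _ sf Um) -/c divfK// subrK.
have [B HB] : exists B : 'M[R]_(k + 1, dim V), forall i j,
    'D_(row i B) (fun x => G x 0 j) (v2r m) = (i == j)%:R.
  pose t i := surj2 (lsubmx (delta_mx 0 i : 'rV[R]_(k + 1))) ((delta_mx 0 i : 'rV[R]_(k + 1)) 0 (rshift k 0)).
  exists (\matrix_i v2r (sval (cid (t i)))) => i j.
  rewrite rowK; case: cid => u /= [u1 u2].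
  case: (split_ordP j) => j' ->.
    by rewrite GlE -/(ds u (fun x => F x 0 j') m) u1 !mxE eqxx /= eq_sym.
  by rewrite GrE -/(ds u f m) u2 (ord1 j') !mxE eqxx /= eq_sym.
have U2m' : (v2r @` U2) (v2r m) by rewrite imv2r_in.
have [rho rho0 H] := locally_onto oU2 U2m' sG HB.
have [|x] := H (row_mx 0 rho%:M).
  apply: norm_rV_le => [|i j]; first exact: ltW.
  rewrite (ord1 i) {i}; case: (split_ordP j) => j' ->.
    by rewrite row_mxEl mxE normr0 ltW.
  by rewrite row_mxEr (ord1 j') mxE eqxx mulr1n gtr0_norm.
rewrite imv2r /= => -[Ux U1x]; rewrite /G v2rK.
have [/(NF m U1m)/= -> _] : N m /\ True by [].
rewrite (f0 m Um Nm) add_row_mx addr0 => /eq_row_mx[Fx fx].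
have Nx : N (r2v x) by apply/(NF _ U1x).
move/matrixP/(_ 0 0): fx; rewrite !mxE eqxx !mulr1n (f0 _ Ux Nx) add0r => e.
by move: rho0; rewrite -e ltxx.
Qed.

End Lagrange.

(** * Controls and the sewing of almost additive functions *)
Section BigO.
Variables (R : realType).

Definition bO (I : Type) (D : I -> Prop) (q f : I -> R) :=
  exists C, forall i, D i -> `|f i| <= C * q i.

Variables (I : Type) (D : I -> Prop).
Implicit Types (q f g : I -> R).

Lemma bO_ext q f g : (forall i, D i -> f i = g i) -> bO D q f -> bO D q g.
Proof. by move=> fg [C H]; exists C => i Di; rewrite -fg// H. Qed.

Lemma bO0 q : bO D q (fun=> 0).
Proof. by exists 0 => i _; rewrite normr0 mul0r. Qed.

Lemma bO_add q f g : bO D q f -> bO D q g -> bO D q (fun i => f i + g i).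
Proof.
move=> [C H] [C' H']; exists (C + C') => i Di.
by rewrite mulrDl (le_trans (ler_normD _ _))// lerD ?H ?H'.
Qed.

Lemma bO_opp q f : bO D q f -> bO D q (fun i => - f i).
Proof. by move=> [C H]; exists C => i Di; rewrite normrN H. Qed.

Lemma bO_sub q f g : bO D q f -> bO D q g -> bO D q (fun i => f i - g i).
Proof. by move=> Hf Hg; apply: bO_add => //; exact: bO_opp. Qed.

Lemma bO_mul q q' f g : bO D q f -> bO D q' g ->
  bO D (fun i => q i * q' i) (fun i => f i * g i).
Proof.
move=> [C H] [C' H']; exists (C * C') => i Di.
by rewrite normrM mulrACA ler_pM ?H ?H'.
Qed.

Lemma bO_mono q q' f : (exists2 c, 0 <= c & forall i, D i -> 0 <= q i <= c * q' i) ->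
  bO D q f -> bO D q' f.
Proof.
move=> [c c0 qq'] [C H]; exists (`|C| * c) => i Di.
have /andP[q0 qc] := qq' i Di.
apply: le_trans (H i Di) _.
apply: le_trans (ler_wpM2r q0 (ler_norm C)) _.
by rewrite -mulrA ler_wpM2l.
Qed.

Lemma bO_le q q' f : (forall i, D i -> 0 <= q i <= q' i) -> bO D q f -> bO D q' f.
Proof. by move=> H; apply: bO_mono; exists 1 => // i Di; rewrite mul1r H. Qed.

Lemma bO_dom (D' : I -> Prop) q f : (forall i, D' i -> D i) -> bO D q f -> bO D' q f.
Proof. by move=> DD [C H]; exists C => i Di; apply: H; exact: DD. Qed.

Lemma bO_sum q (J : Type) (r : seq J) (F : J -> I -> R) :
  (forall j, bO D q (F j)) -> bO D q (fun i => \sum_(j <- r) F j i).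
Proof.
move=> H; elim: r => [|j r IH].
  by apply: bO_ext (bO0 q) => i _; rewrite big_nil.
by apply: bO_ext (bO_add (H j) IH) => i _; rewrite big_cons.
Qed.

Lemma bO_cst (c : R) : bO D (fun=> 1) (fun=> c).
Proof. by exists `|c| => i _; rewrite mulr1. Qed.

Lemma bO_bmul q f g : bO D (fun=> 1) f -> bO D q g -> bO D q (fun i => f i * g i).
Proof.
move=> H H'; have [C K] := bO_mul H H'; exists C => i Di.
by have := K i Di; rewrite mul1r.
Qed.

Lemma bO_bmulr q f g : bO D q f -> bO D (fun=> 1) g -> bO D q (fun i => f i * g i).
Proof. by move=> H H'; apply: bO_ext (bO_bmul H' H) => i _; rewrite mulrC. Qed.
End BigO.

Lemma bO_map (R : realType) (I J : Type) (D : I -> Prop) (D' : J -> Prop) (phi : J -> I)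
    (q f : I -> R) :
  (forall j, D' j -> D (phi j)) -> bO D q f -> bO D' (q \o phi) (f \o phi).
Proof. by move=> H [C K]; exists C => j Dj; apply: K; exact: H. Qed.

Section Control.
Variables (R : realType) (T p : R) (omega : R -> R -> R).
Hypotheses (T0 : 0 < T) (p2 : 2 <= p) (p3 : p < 3) (Hom : control T omega).

(** The scale of a rough path: increments are O(r), areas are O(r^2), and germs
    related by [simeq] differ by O(r^3). *)
Definition rr (s t : R) : R := omega s t `^ (1 / p).

Lemma p_gt0 : 0 < p. Proof. by apply: lt_le_trans p2. Qed.

Lemma om_ge0 s t : 0 <= s -> s <= t -> t <= T -> 0 <= omega s t.
Proof.
have [_ _ H1 H2] := Hom => s0 st tT.
have [e|st'] := eqVneq s t.
  by subst t; rewrite H1.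
by apply: ltW; apply: H2 => //; rewrite lt_neqAle st'.
Qed.

Lemma om_mono s s' t' t : 0 <= s -> s <= s' -> s' <= t' -> t' <= t -> t <= T ->
  omega s' t' <= omega s t.
Proof.
have [_ H _ _] := Hom => s0 ss' st t't tT.
have := H s s' t s0 ss' (le_trans st t't) tT.
have := H s' t' t (le_trans s0 ss') st t't tT.
have := @om_ge0 s s' s0 ss' (le_trans st (le_trans t't tT)).
have := @om_ge0 t' t (le_trans s0 (le_trans ss' st)) t't tT.
lra.
Qed.

Lemma rr_ge0 s t : 0 <= rr s t. Proof. exact: powR_ge0. Qed.

Lemma rr_ss s : 0 <= s -> s <= T -> rr s s = 0.
Proof.
have [_ _ H _] := Hom => s0 sT.
by rewrite /rr H// powR0// mul1r invr_eq0 gt_eqF// p_gt0.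
Qed.

Lemma rrX k s t : rr s t ^+ k = omega s t `^ (k%:R / p).
Proof. by rewrite -powR_mulrn ?powR_ge0// /rr -powRrM mul1r mulrC. Qed.

Lemma rr_mono s s' t' t : 0 <= s -> s <= s' -> s' <= t' -> t' <= t -> t <= T ->
  rr s' t' <= rr s t.
Proof.
move=> s0 ss' st tt tT; apply: ge0_ler_powR.
- by rewrite mul1r invr_ge0 ltW// p_gt0.
- by rewrite nnegrE om_ge0//; [exact: le_trans ss'|exact: le_trans tT].
- by rewrite nnegrE om_ge0//; exact: le_trans (le_trans ss' st) _.
- exact: om_mono.
Qed.

Lemma rr_le s t : 0 <= s -> s <= t -> t <= T -> rr s t <= rr 0 T.
Proof. by move=> s0 st tT; apply: rr_mono. Qed.

(** Halving the control multiplies r^3 by this factor.  It is less than 1/2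
    because p < 3, and all estimates below rest on that. *)
Definition half_fac : R := 2^-1 `^ (3 / p).
Lemma half_fac_lt : 2 * half_fac < 1.
Proof.
rewrite /half_fac -ltr_pdivlMl// mulr1.
have t1 : 1 < 3 / p by rewrite ltr_pdivlMr ?p_gt0// mul1r.
rewrite /powR gt_eqF// -[ltRHS](@lnK R 2^-1) ?posrE// ltr_expR.
have l2 : ln (2^-1 : R) < 0 by rewrite -ln1 ltr_ln ?posrE// invf_lt1// ltr1n.
by rewrite gtr_nMl.
Qed.

Lemma rr3_half s t s' t' : 0 <= s -> s <= t -> t <= T -> 0 <= s' -> s' <= t' -> t' <= T ->
  omega s' t' <= omega s t / 2 -> rr s' t' ^+ 3 <= half_fac * rr s t ^+ 3.
Proof.
move=> s0 st tT s'0 st' tT' H; rewrite !rrX /half_fac -powRM ?om_ge0//.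
apply: ge0_ler_powR => //.
- by rewrite divr_ge0// ltW// p_gt0.
- by rewrite nnegrE om_ge0.
- by rewrite nnegrE mulr_ge0// om_ge0.
- by rewrite mulrC.
Qed.

Definition maxK : R := 2 / (1 - 2 * half_fac).
Lemma maxK_gt0 : 0 < maxK.
Proof. by rewrite /maxK divr_gt0// subr_gt0 half_fac_lt. Qed.
Lemma maxK_eq : maxK = 2 * half_fac * maxK + 2.
Proof.
rewrite /maxK; have := half_fac_lt; set h := half_fac => H.
have h0 : 1 - 2 * h != 0 by rewrite gt_eqF// subr_gt0.
by field.
Qed.

(** Cut at the last partition point j such that omega (t a) (t j) is at most half
    of omega (t a) (t b).  By superadditivity omega (t j.+1) (t b) is at most half
    as well, so that induction on the two sides costs 2 * half_fac * maxK; the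
    two triples which glue the pieces cost 2, and maxK solves
    maxK = 2 * half_fac * maxK + 2. *)
Lemma max_ineq (A : R -> R -> R) C lo hi (t : nat -> R) a b :
  0 <= lo -> hi <= T -> 0 <= C ->
  (forall s u v, lo <= s -> s <= u -> u <= v -> v <= hi ->
     `|A s v - A s u - A u v| <= C * rr s v ^+ 3) ->
  (forall i j, (i <= j)%N -> t i <= t j) -> (forall i, lo <= t i /\ t i <= hi) ->
  (a <= b)%N ->
  `|\sum_(a <= i < b) A (t i) (t i.+1) - A (t a) (t b)| <= maxK * C * rr (t a) (t b) ^+ 3.
Proof.
move=> lo0 hiT C0 HA tm tin.
have t0 i : 0 <= t i by have [H _] := tin i; exact: le_trans H.
have tT i : t i <= T by have [_ H] := tin i; exact: le_trans hiT.
have Ass i : A (t i) (t i) = 0.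
  have [l h] := tin i.
  have := HA (t i) (t i) (t i) l (lexx _) (lexx _) h.
  rewrite rr_ss// expr0n mulr0 subrr sub0r normrN normr_le0 => /eqP //.
have [n] := ubnP (b - a)%N; elim: n a b => // n IH a b.
rewrite ltnS => ban ab.
have [e|ba] := eqVneq a b.
  subst b; rewrite big_geq// Ass subrr normr0.
  by apply: mulr_ge0; [apply: mulr_ge0 => //; exact/ltW/maxK_gt0 | apply/exprn_ge0/rr_ge0].
have ltab : (a < b)%N by rewrite ltn_neqAle ba.
pose P j := [&& (a <= j)%N, (j < b)%N & omega (t a) (t j) <= omega (t a) (t b) / 2].
have exP : exists j, P j.
  exists a; rewrite /P leqnn ltab /=.
  have [_ _ H _] := Hom; rewrite H// divr_ge0// om_ge0//; exact: tm.
have bP j : P j -> (j <= b)%N by move=> /and3P[_ /ltnW].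
have [j /and3P[aj jb oj] jmax] := ex_maxnP exP bP.
have R3 := @rr3_half (t a) (t b) _ _ (t0 a) (tm _ _ ab) (tT b).
have h1 := R3 _ _ (t0 a) (tm _ _ aj) (tT j) oj.
have h2 : rr (t j.+1) (t b) ^+ 3 <= half_fac * rr (t a) (t b) ^+ 3.
  apply: R3 => //; first exact: tm.
  have [jb1|jb1] := eqVneq j.+1 b.
    have [_ _ H _] := Hom; rewrite jb1 H// divr_ge0// om_ge0//; exact: tm.
  have lj : (j.+1 < b)%N by rewrite ltn_neqAle jb1.
  have : omega (t a) (t b) / 2 < omega (t a) (t j.+1).
    rewrite ltNge; apply/negP => H.
    have := jmax j.+1; rewrite /P lj H (leqW aj) /= => /(_ isT).
    by rewrite ltnn.
  have [_ H _ _] := Hom.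
  have := H (t a) (t j.+1) (t b) (t0 a) (tm _ _ (leqW aj)) (tm _ _ jb) (tT b).
  lra.
have I1 := IH a j _ aj.
have I2 := IH j.+1 b _ jb.
have {}I1 : `|\sum_(a <= i < j) A (t i) (t i.+1) - A (t a) (t j)| <=
    maxK * C * rr (t a) (t j) ^+ 3.
  apply: I1; apply: leq_trans ban; exact: ltn_sub2r.
have {}I2 : `|\sum_(j.+1 <= i < b) A (t i) (t i.+1) - A (t j.+1) (t b)| <=
    maxK * C * rr (t j.+1) (t b) ^+ 3.
  apply: I2; apply: leq_trans ban; apply: ltn_sub2l => //.
have [la ha] := tin a; have [lj hj] := tin j; have [lb hb'] := tin b.
have D1 := HA (t a) (t j) (t b) la (tm _ _ aj) (tm _ _ (ltnW jb)) hb'.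
have D2 := HA (t j) (t j.+1) (t b) lj (tm _ _ (leqnSn j)) (tm _ _ jb) hb'.
have D2' : C * rr (t j) (t b) ^+ 3 <= C * rr (t a) (t b) ^+ 3.
  rewrite ler_wpM2l// lerXn2r ?nnegrE ?rr_ge0//.
  by apply: rr_mono => //; [exact: tm | apply: tm; exact: ltnW].
rewrite (big_cat_nat aj (ltnW jb)) /= (big_ltn jb).
set S1 := \sum_(a <= i < j) _ in I1 *; set S2 := \sum_(j.+1 <= i < b) _ in I2 *.
have mC : 0 <= maxK * C by apply: mulr_ge0 => //; exact/ltW/maxK_gt0.
have J1 := le_trans I1 (ler_wpM2l mC h1).
have J2 := le_trans I2 (ler_wpM2l mC h2).
have -> : S1 + (A (t j) (t j.+1) + S2) - A (t a) (t b) =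
   (S1 - A (t a) (t j)) + (S2 - A (t j.+1) (t b)) -
   (A (t a) (t b) - A (t a) (t j) - A (t j) (t b)) -
   (A (t j) (t b) - A (t j) (t j.+1) - A (t j.+1) (t b)) by ring.
apply: le_trans (ler_normB _ _) _.
apply: le_trans (lerD (ler_normB _ _) (lexx _)) _.
apply: le_trans (lerD (lerD (ler_normD _ _) (lexx _)) (lexx _)) _.
apply: le_trans (lerD (lerD (lerD J1 J2) D1) (le_trans D2 D2')) _.
rewrite [in leRHS]maxK_eq le_eqVlt; apply/orP; left; apply/eqP; ring.
Qed.

(** Compactness of [0, T], as omega is continuous and vanishes on the diagonal. *)
Lemma om_unif e : 0 < e -> exists2 delta, 0 < delta &
  forall s t, 0 <= s -> s <= t -> t <= T -> t - s <= delta -> omega s t <= e.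
Proof.
move=> e0.
have [co _ oss _] := Hom.
pose P (d x : R) := 0 <= x -> forall t, x <= t -> t <= T -> t - x <= d -> omega x t <= e.
have /compact_near_coveringP cov := @segment_compact R 0 T.
have : \forall d \near (0 : R), `[0, T] `<=` P d.
  apply: (cov R (nbhs (0 : R)) P) => x; rewrite /= in_itv /= => /andP[x0 xT].
  have tr : triangle T (x, x) by split.
  have /subspace_continuousP/(_ _ tr) := co.
  move=> /cvgrPdist_le/(_ e e0) /=.
  move=> H; have : nbhs (x, x) [set st : R * R | triangle T st ->
    `|omega x x - omega st.1 st.2| <= e] := H.
  rewrite oss// => -[[A B] /= [nA nB] AB] {H}.
  have /nbhs_normP[r /= r0 Hr] := nA; have /nbhs_normP[r' /= r'0 Hr'] := nB.
  pose m := Num.min r r'.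
  have m0 : 0 < m by rewrite lt_min r0 r'0.
  exists ([set y | `|x - y| < m / 2], [set d : R | `|0 - d| < m / 2]).
    split; apply/nbhs_normP; exists (m / 2) => //=; by rewrite divr_gt0.
  move=> [y d] /= [ym dm] y0 t yt tT ytd.
  have mr : m <= r by rewrite /m ge_min lexx.
  have mr' : m <= r' by rewrite /m ge_min lexx orbT.
  have := AB (y, t).
  move=> H; apply: le_trans (ler_norm _) _; rewrite -normrN -sub0r; apply: H.
    split=> /=; first by apply: Hr => /=; lra.
    apply: Hr' => /=; move: ym dm; rewrite sub0r normrN !ltr_norml => /andP[? ?] /andP[? ?].
    by rewrite /=; apply/andP; split; lra.
  by split.
move=> /nbhs_normP[d /= d0 H].
exists (d / 2); first by rewrite divr_gt0.
move=> s t s0 st tT std; apply: (H (d / 2)) => //=.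
  by rewrite sub0r normrN gtr0_norm; lra.
by rewrite in_itv /= s0 (le_trans st).
Qed.

Lemma rr3_small e : 0 < e -> exists2 delta, 0 < delta &
  forall s t, 0 <= s -> s <= t -> t <= T -> t - s <= delta ->
    rr s t ^+ 3 <= e * omega s t.
Proof.
move=> e0.
have t1 : 0 < 3 / p - 1 by rewrite subr_gt0 ltr_pdivlMr ?p_gt0// mul1r.
have [d d0 H] := om_unif (powR_gt0 (3 / p - 1)^-1 e0).
exists d => // s t s0 st tT std; have := H s t s0 st tT std => Ho.
have o0 := om_ge0 s0 st tT.
rewrite rrX -mulr_powRB1// ?divr_gt0 ?p_gt0// mulrC ler_wpM2r//.
have -> : e = (e `^ (3 / p - 1)^-1) `^ (3 / p - 1).
  by rewrite -powRrM mulVf ?gt_eqF// powRr1// ltW.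
by apply: ge0_ler_powR; rewrite ?nnegrE ?powR_ge0// ltW.
Qed.

Definition upart (a b : R) (n i : nat) : R := a + (b - a) * (i%:R / n%:R).

Lemma sum_om a b (t : nat -> R) n : 0 <= a -> b <= T ->
  (forall i j, (i <= j)%N -> t i <= t j) -> (forall i, (i <= n)%N -> a <= t i /\ t i <= b) ->
  \sum_(0 <= i < n) omega (t i) (t i.+1) <= omega (t 0%N) (t n).
Proof.
move=> a0 bT tm tin; elim: n tin => [|n IH] tin.
  have [l h] := tin 0%N (leqnn _); have [_ _ oss _] := Hom.
  by rewrite big_geq// oss//; lra.
rewrite big_nat_recr//=.
have {}IH := IH (fun i h => tin i (leqW h)).
have [l h] := tin 0%N (leq0n _); have [l' h'] := tin n.+1 (leqnn _).
have [_ H _ _] := Hom.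
have := H (t 0%N) (t n) (t n.+1) (le_trans a0 l) (tm _ _ (leq0n n)) (tm _ _ (leqnSn n)) (le_trans h' bT).
lra.
Qed.

Lemma upart0 a b n : upart a b n 0 = a.
Proof. by rewrite /upart mul0r mulr0 addr0. Qed.

Lemma upartn a b n : upart a b n.+1 n.+1 = b.
Proof. by rewrite /upart divff ?mulr1 ?subrKC// pnatr_eq0. Qed.

Lemma upart_mono a b n i j : a <= b -> (i <= j)%N -> upart a b n i <= upart a b n j.
Proof. by move=> ab ij; rewrite /upart lerD2l ler_wpM2l ?subr_ge0// ler_wpM2r ?invr_ge0// ler_nat. Qed.

Lemma upart_in a b n i : a <= b -> (i <= n.+1)%N -> a <= upart a b n.+1 i /\ upart a b n.+1 i <= b.
Proof.
move=> ab inn; split; first by rewrite -{1}(upart0 a b n.+1) upart_mono.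
by rewrite -[leRHS](upartn a b n) upart_mono.
Qed.

Lemma upart_step a b n i : upart a b n.+1 i.+1 - upart a b n.+1 i = (b - a) / n.+1%:R.
Proof. by rewrite /upart -(natr1 i) mulrDl; ring. Qed.

Lemma upart_fine a b delta : a <= b -> 0 < delta -> exists n0, forall n, (n0 <= n)%N ->
  forall i, upart a b n.+1 i.+1 - upart a b n.+1 i <= delta.
Proof.
move=> ab d0; exists (Num.truncn ((b - a) / delta)) => n nn i.
rewrite upart_step ler_pdivrMr// mulrC -ler_pdivrMr//.
apply: ltW; apply: lt_le_trans (truncnS_gt _) _.
by rewrite ler_nat ltnS.
Qed.

(** r^3 = o(omega) near the diagonal, and the sums of omega are bounded. *)
Lemma sum_rr3_small a b e : 0 <= a -> a <= b -> b <= T -> 0 < e ->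
  exists n0, forall n, (n0 <= n)%N ->
    \sum_(0 <= i < n.+1) rr (upart a b n.+1 i) (upart a b n.+1 i.+1) ^+ 3 <= e.
Proof.
move=> a0 ab bT e0.
have o0 := om_ge0 a0 ab bT.
have e'0 : 0 < e / (omega a b + 1) by rewrite divr_gt0//; lra.
have [d d0 H] := rr3_small e'0.
have [n0 Hn] := upart_fine ab d0.
exists n0 => n nn.
have U i : (i <= n.+1)%N -> _ := fun h => @upart_in a b n i ab h.
apply: (@le_trans _ _ (\sum_(0 <= i < n.+1)
   e / (omega a b + 1) * omega (upart a b n.+1 i) (upart a b n.+1 i.+1))).
  rewrite !big_nat; apply: ler_sum => i /andP[_ ni].
  have [u1 u2] := U i (ltnW ni); have [v1 v2] := U i.+1 ni.
  apply: H.
  - exact: le_trans u1.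
  - exact: upart_mono.
  - exact: le_trans bT.
  - exact: Hn.
rewrite -mulr_sumr.
have := @sum_om a b (upart a b n.+1) n.+1 a0 bT (fun i j => @upart_mono a b n.+1 i j ab) (fun i h => @upart_in a b n i ab h).
rewrite upart0 upartn => S.
apply: le_trans (ler_wpM2l (ltW e'0) S) _.
rewrite mulrAC ler_pdivrMr; last lra.
by rewrite mulrDr mulr1 lerDl ltW.
Qed.

Lemma additive_sum (g : R -> R -> R) a b (t : nat -> R) n :
  (forall s u v, a <= s -> s <= u -> u <= v -> v <= b -> g s v = g s u + g u v) ->
  (forall i j, (i <= j)%N -> t i <= t j) -> (forall i, (i <= n)%N -> a <= t i /\ t i <= b) ->
  \sum_(0 <= i < n) g (t i) (t i.+1) = g (t 0%N) (t n).
Proof.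
move=> ga tm; elim: n => [|n IH] tin.
  have [l h] := tin 0%N (leqnn _).
  rewrite big_geq//; have := ga (t 0%N) (t 0%N) (t 0%N) l (lexx _) (lexx _) h; lra.
rewrite big_nat_recr//= IH => [|i h]; last exact: tin (leqW h).
have [l h] := tin 0%N (leq0n _); have [l' h'] := tin n.+1 (leqnn _).
by rewrite -ga//; exact: tm.
Qed.

(** The source of all uniqueness statements: an additive function equals its sum
    over every partition, and the sums of r^3 tend to 0 with the mesh. *)
Lemma additive_small (g : R -> R -> R) a b delta C :
  0 <= a -> a <= b -> b <= T -> 0 < delta ->
  (forall s u v, a <= s -> s <= u -> u <= v -> v <= b -> g s v = g s u + g u v) ->
  (forall s t, a <= s -> s <= t -> t <= b -> t - s <= delta -> `|g s t| <= C * rr s t ^+ 3) ->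
  g a b = 0.
Proof.
move=> a0 ab bT d0 ga gC.
apply/eqP; rewrite -normr_le0; apply/ler_addgt0Pr => e e0; rewrite add0r.
have C0 : 0 < `|C| + 1 by rewrite ltr_wpDl.
have [n1 H1] := sum_rr3_small a0 ab bT (divr_gt0 e0 C0).
have [n2 H2] := upart_fine ab d0.
pose n := maxn n1 n2.
have {}H1 := H1 n (leq_maxl _ _); have {}H2 := H2 n (leq_maxr _ _).
have U i (h : (i <= n.+1)%N) := @upart_in a b n i ab h.
have := @additive_sum g a b (upart a b n.+1) n.+1 ga (fun i j => @upart_mono a b n.+1 i j ab) U.
rewrite upart0 upartn => <-.
apply: le_trans (ler_norm_sum _ _ _) _.
apply: (@le_trans _ _ ((`|C| + 1) * \sum_(0 <= i < n.+1) rr (upart a b n.+1 i) (upart a b n.+1 i.+1) ^+ 3)).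
  rewrite mulr_sumr !big_nat; apply: ler_sum => i /andP[_ ni].
  have [u1 u2] := U i (ltnW ni); have [v1 v2] := U i.+1 ni.
  apply: le_trans (gC _ _ u1 _ v2 (H2 i)) _; first exact: upart_mono.
  by rewrite ler_wpM2r ?exprn_ge0 ?rr_ge0// (le_trans (ler_norm C))// lerDl.
by rewrite mulrC -ler_pdivlMr.
Qed.

(** If J is O(r^3), its sums over fine partitions tend to 0, so that the maximal
    inequality bounds J itself by its defect of additivity, whatever the
    constant k. *)
Lemma young_bound (J : R -> R -> R) a b k C :
  0 <= a -> b <= T -> 0 <= C ->
  (forall s t, a <= s -> s <= t -> t <= b -> `|J s t| <= k * rr s t ^+ 3) ->
  (forall s u v, a <= s -> s <= u -> u <= v -> v <= b ->
     `|J s v - J s u - J u v| <= C * rr s v ^+ 3) ->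
  forall s t, a <= s -> s <= t -> t <= b -> `|J s t| <= maxK * C * rr s t ^+ 3.
Proof.
move=> a0 bT C0 Jk dJ s t as' st tb.
apply/ler_addgt0Pr => e e0.
have s0 : 0 <= s by exact: le_trans as'.
have tT : t <= T by exact: le_trans bT.
have k0 : 0 < `|k| + 1 by rewrite ltr_wpDl.
have [n H1] := sum_rr3_small s0 st tT (divr_gt0 e0 k0).
have {}H1 := H1 n (leqnn n).
pose ti i := upart s t n.+1 (minn i n.+1).
have tm i j : (i <= j)%N -> ti i <= ti j.
  move=> ij; apply: upart_mono => //.
  by rewrite leq_min geq_minr andbT; apply: leq_trans (geq_minl _ _) ij.
have tin i : s <= ti i /\ ti i <= t by apply: upart_in => //; exact: geq_minr.
have HJ x y z : s <= x -> x <= y -> y <= z -> z <= t -> `|J x z - J x y - J y z| <= C * rr x z ^+ 3.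
  by move=> sx xy yz zt; apply: dJ => //; [exact: le_trans sx|exact: le_trans zt _].
have := max_ineq s0 tT C0 HJ tm tin (leq0n n.+1).
have -> : ti 0%N = s by rewrite /ti min0n upart0.
have -> : ti n.+1 = t by rewrite /ti minnn upartn.
set S := \sum_(0 <= i < n.+1) _ => HS.
have S1 : `|S| <= e.
  apply: le_trans (ler_norm_sum _ _ _) _.
  apply: (@le_trans _ _ ((`|k| + 1) * \sum_(0 <= i < n.+1) rr (upart s t n.+1 i) (upart s t n.+1 i.+1) ^+ 3)).
    rewrite mulr_sumr !big_nat; apply: ler_sum => i /andP[_ ni].
    have [u1 u2] := tin i; have [v1 v2] := tin i.+1.
    have -> : upart s t n.+1 i = ti i by rewrite /ti (minn_idPl (ltnW ni)).
    have -> : upart s t n.+1 i.+1 = ti i.+1 by rewrite /ti (minn_idPl ni).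
    apply: le_trans (Jk _ _ _ _ _) _.
    - exact: le_trans u1.
    - exact: tm.
    - exact: le_trans v2 _.
    - by rewrite ler_wpM2r ?exprn_ge0 ?rr_ge0// (le_trans (ler_norm k))// lerDl.
  by rewrite mulrC -ler_pdivlMr.
have -> : J s t = S - (S - J s t) by ring.
by apply: le_trans (ler_normB _ _) _; rewrite addrC; apply: lerD.
Qed.

Lemma rr_unif e : 0 < e -> exists2 delta, 0 < delta &
  forall s t, 0 <= s -> s <= t -> t <= T -> t - s <= delta -> rr s t <= e.
Proof.
move=> e0; have [d d0 H] := om_unif (powR_gt0 p e0).
exists d => // s t s0 st tT std; have := H s t s0 st tT std => Ho.
have -> : e = (e `^ p) `^ (1 / p).
  by rewrite -powRrM mul1r divff ?gt_eqF ?p_gt0// powRr1// ltW.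
apply: ge0_ler_powR; rewrite ?nnegrE ?powR_ge0//; last exact: om_ge0.
by rewrite divr_ge0// ltW// p_gt0.
Qed.

Lemma rr_continuous (f : R -> R) S C : S <= T ->
  (forall s t, 0 <= s -> s <= t -> t <= S -> `|f t - f s| <= C * rr s t) ->
  {within `[0, S], continuous f}.
Proof.
move=> ST fC; apply/subspace_continuousP => x; rewrite /= in_itv /= => /andP[x0 xS].
apply/cvgrPdist_le => e e0.
have C0 : 0 < `|C| + 1 by rewrite ltr_wpDl.
have [d d0 H] := rr_unif (divr_gt0 e0 C0).
have main s t : 0 <= s -> s <= t -> t <= S -> t - s <= d -> `|f t - f s| <= e.
  move=> s0 st tS std; apply: le_trans (fC s t s0 st tS) _.
  have r0 := rr_ge0 s t.
  apply: (@le_trans _ _ ((`|C| + 1) * rr s t)).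
    by rewrite ler_wpM2r// (le_trans (ler_norm C))// lerDl.
  by rewrite mulrC -ler_pdivlMr// H// (le_trans tS).
rewrite near_withinE; apply/nbhs_normP; exists d => //= y yd.
rewrite in_itv /= => /andP[y0 yS].
have : `|x - y| < d := yd; rewrite ltr_norml => /andP[yd1 yd2].
rewrite -[from_subspace _ _ x]/(f x) -[from_subspace _ _ y]/(f y).
have [xy|/ltW yx] := leP x y.
  by rewrite distrC; apply: main => //; lra.
by apply: main => //; lra.
Qed.

(** I t is the limit of the sums of A over the uniform partitions of [0, T], each
    of them stopped at t.  The maximal inequality, applied to the part of the
    partition in [s, t], compares I t - I s with A s t; the two incomplete cells
    at s and t contribute at most the sum of r^3, which tends to 0. *)
Lemma sewing (A : R -> R -> R) C : 0 <= C ->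
  (forall s u v, 0 <= s -> s <= u -> u <= v -> v <= T ->
     `|A s v - A s u - A u v| <= C * rr s v ^+ 3) ->
  exists I : R -> R, forall s t, 0 <= s -> s <= t -> t <= T ->
    `|I t - I s - A s t| <= maxK * C * rr s t ^+ 3.
Proof.
move=> C0 HA.
have T0' := ltW T0.
have Ass x : 0 <= x -> x <= T -> A x x = 0.
  move=> x0 xT.
  have := HA x x x x0 (lexx _) (lexx _) xT.
  rewrite rr_ss// expr0n mulr0 subrr sub0r normrN normr_le0 => /eqP //.
pose tau n i := upart 0 T n.+1 (minn i n.+1).
have tm n i j : (i <= j)%N -> tau n i <= tau n j.
  move=> ij; apply: upart_mono => //.
  by rewrite leq_min geq_minr andbT; apply: leq_trans (geq_minl _ _) ij.
have tin n i : 0 <= tau n i /\ tau n i <= T by apply: upart_in => //; exact: geq_minr.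
have tau0 n : tau n 0%N = 0 by rewrite /tau min0n upart0.
have taun n : tau n n.+1 = T by rewrite /tau minnn upartn.
pose e_ n := \sum_(0 <= i < n.+1) rr (tau n i) (tau n i.+1) ^+ 3.
have e_small e : 0 < e -> exists n0, forall n, (n0 <= n)%N -> e_ n <= e.
  move=> e0; have [n0 H] := sum_rr3_small (lexx 0) T0' (lexx T) e0.
  exists n0 => n nn; apply: le_trans (H n nn).
  rewrite le_eqVlt; apply/orP; left; apply/eqP; apply: eq_big_nat => i /andP[_ ni].
  by rewrite /tau (minn_idPl (ltnW ni)) (minn_idPl ni).
pose In n t := \sum_(0 <= i < n.+1) A (Num.min (tau n i) t) (Num.min (tau n i.+1) t).
have main n s t : 0 <= s -> s <= t -> t <= T ->
    `|In n t - In n s - A s t| <= maxK * C * rr s t ^+ 3 + C * e_ n.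
  move=> s0 st tT.
  have t0 : 0 <= t by exact: le_trans st.
  have sT : s <= T by exact: le_trans tT.
  pose u i := Num.max s (Num.min (tau n i) t).
  have um i j : (i <= j)%N -> u i <= u j.
    move=> ij; rewrite /u ge_max !le_max lexx /=.
    by apply/orP; right; rewrite le_min !ge_min lexx (tm n i j ij) orbT.
  have uin i : s <= u i /\ u i <= t.
    by rewrite /u le_max lexx ge_max st ge_min lexx orbT.
  have HJ x y z : s <= x -> x <= y -> y <= z -> z <= t ->
      `|A x z - A x y - A y z| <= C * rr x z ^+ 3.
    by move=> sx xy yz zt; apply: HA => //; [exact: le_trans sx|exact: le_trans zt _].
  have := max_ineq s0 tT C0 HJ um uin (leq0n n.+1).
  have -> : u 0%N = s.
    by rewrite /u tau0 (min_idPl t0) (max_idPl s0).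
  have -> : u n.+1 = t by rewrite /u taun (min_idPr tT) (max_idPr st).
  set Su := \sum_(0 <= i < n.+1) _ => HS.
  have -> : In n t - In n s - A s t = (Su - A s t) + (In n t - In n s - Su) by ring.
  apply: le_trans (ler_normD _ _) _; apply: lerD => //.
  rewrite /In /Su -!sumrB; apply: le_trans (ler_norm_sum _ _ _) _.
  rewrite /e_ mulr_sumr; apply: ler_sum => i _.
  have [x0 xT] := tin n i; have [y0 yT] := tin n i.+1.
  have xy := tm n i i.+1 (leqnSn i); rewrite /u.
  have Cr : 0 <= C * rr (tau n i) (tau n i.+1) ^+ 3.
    by rewrite mulr_ge0// exprn_ge0// rr_ge0.
  move: x0 xT y0 yT xy Cr; move: (tau n i) (tau n i.+1) => x y x0 xT y0 yT xy Cr.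
  have [sx|xs] : s <= x \/ x <= s by apply/orP; exact: le_total.
    rewrite [Num.min x s](min_idPr sx) [Num.min y s](min_idPr (le_trans sx xy)) Ass// subr0.
    have sx' : s <= Num.min x t by rewrite le_min sx.
    have sy' : s <= Num.min y t by rewrite le_min (le_trans sx).
    by rewrite (max_idPr sx') (max_idPr sy') subrr normr0.
  have [ys|sy] : y <= s \/ s <= y by apply/orP; exact: le_total.
    rewrite [Num.min x s](min_idPl xs) [Num.min y s](min_idPl ys).
    rewrite [Num.min x t](min_idPl (le_trans xs st)) [Num.min y t](min_idPl (le_trans ys st)).
    by rewrite (max_idPl xs) (max_idPl ys) Ass// subrr subr0 normr0.
  rewrite [Num.min x s](min_idPl xs) [Num.min y s](min_idPr sy).
  rewrite [Num.min x t](min_idPl (le_trans xs st)) (max_idPl xs).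
  have sy' : s <= Num.min y t by rewrite le_min sy.
  rewrite (max_idPr sy'); apply: le_trans (HA _ _ _ x0 xs sy' _) _.
    by rewrite ge_min tT orbT.
  rewrite ler_wpM2l// lerXn2r ?nnegrE ?rr_ge0//.
  by apply: rr_mono => //; rewrite ?ge_min ?lexx// (le_trans xs).
have In0 n : In n 0 = 0.
  rewrite /In big1// => i _.
  have [x0 _] := tin n i; have [y0 _] := tin n i.+1.
  by rewrite (min_idPr x0) (min_idPr y0) Ass.
have KC : 0 <= maxK * C by apply: mulr_ge0 => //; exact/ltW/maxK_gt0.
have cauchy t e : 0 <= t -> t <= T -> 0 < e -> exists n0, forall n m, (n0 <= n)%N -> (n0 <= m)%N ->
    `|In n t - In m t| <= e.
  move=> t0 tT e0.
  have K0 : 0 < 4 * (maxK * C + 1) by rewrite mulr_gt0//; lra.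
  have [N HN] := sum_rr3_small (lexx 0) t0 tT (divr_gt0 e0 K0).
  have {}HN := HN N (leqnn N).
  have c0 : 0 < e / (4 * (C + 1) * N.+1%:R).
    by rewrite divr_gt0// mulr_gt0// mulr_gt0//; lra.
  have [n0 Hn0] := e_small _ c0.
  exists n0 => n m nn mm.
  pose g a b := (In n b - In n a) - (In m b - In m a).
  have U i (h : (i <= N.+1)%N) := @upart_in 0 t N i t0 h.
  have ga s u v : 0 <= s -> s <= u -> u <= v -> v <= t -> g s v = g s u + g u v.
    by move=> _ _ _ _; rewrite /g; ring.
  have := @additive_sum g 0 t (upart 0 t N.+1) N.+1 ga (fun i j => @upart_mono 0 t N.+1 i j t0) U.
  rewrite upart0 upartn => gE.
  have -> : In n t - In m t = g 0 t by rewrite /g !In0 !subr0.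
  rewrite -gE; apply: le_trans (ler_norm_sum _ _ _) _.
  apply: (@le_trans _ _ (\sum_(0 <= i < N.+1) (2 * (maxK * C) *
     rr (upart 0 t N.+1 i) (upart 0 t N.+1 i.+1) ^+ 3 + C * (e_ n + e_ m)))).
    rewrite !big_nat; apply: ler_sum => i /andP[_ ni].
    have [u1 u2] := U i (ltnW ni); have [v1 v2] := U i.+1 ni.
    set a := upart 0 t N.+1 i in u1 u2 *; set b := upart 0 t N.+1 i.+1 in v1 v2 *.
    have ab : a <= b by exact: upart_mono.
    have bT : b <= T by exact: le_trans tT.
    have -> : g a b = (In n b - In n a - A a b) - (In m b - In m a - A a b).
      by rewrite /g; ring.
    apply: le_trans (ler_normB _ _) _.
    apply: le_trans (lerD (main n a b u1 ab bT) (main m a b u1 ab bT)) _.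
    by rewrite le_eqVlt; apply/orP; left; apply/eqP; ring.
  rewrite big_split /= -mulr_sumr sumr_const_nat subn0.
  set Sr := \sum_(0 <= i < N.+1) _ in HN *.
  have h1 : 2 * (maxK * C) * Sr <= e / 2.
    apply: le_trans (ler_wpM2l _ HN) _; first by rewrite mulr_ge0.
    rewrite mulrA ler_pdivrMr//.
    have -> : e / 2 * (4 * (maxK * C + 1)) = 2 * (maxK * C) * e + 2 * e by field.
    by rewrite lerDl mulr_ge0// ltW.
  have h2 : C * (e_ n + e_ m) *+ N.+1 <= e / 2.
    have H1 := Hn0 n nn; have H2 := Hn0 m mm.
    have H3 : C * (e_ n + e_ m) <= (C + 1) * (2 * (e / (4 * (C + 1) * N.+1%:R))).
      have en x : 0 <= e_ x by apply: sumr_ge0 => i _; rewrite exprn_ge0// rr_ge0.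
      have := en n; have := en m => ? ?.
      apply: ler_pM => //; [exact: addr_ge0 | by rewrite lerDl | ].
      by rewrite mulr_natl mulr2n lerD.
    rewrite -mulr_natr; apply: le_trans (ler_wpM2r _ H3) _ => //.
    rewrite le_eqVlt; apply/orP; left; apply/eqP; field.
    have N0 : 0 <= N%:R :> R by [].
    by apply/andP; split; rewrite gt_eqF//; lra.
  lra.
have cvg t : 0 <= t -> t <= T -> cvgn (fun n => In n t).
  move=> t0 tT; apply/cauchy_cvgP; apply/cauchy_ballP => e e0; near_simpl.
  have e2 : 0 < e / 2 by rewrite divr_gt0.
  have [n0 H] := cauchy t _ t0 tT e2.
  near=> n m => /=; rewrite -ball_normE /=.
  apply: le_lt_trans (H n m _ _) _; last lra.
    by near: n; exists n0.
  by near: m; exists n0.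
exists (fun t => limn (fun n => In n t)) => s t s0 st tT.
have t0 : 0 <= t by exact: le_trans st.
have sT : s <= T by exact: le_trans tT.
have H : (fun n => In n t - In n s - A s t) @ \oo -->
    limn (fun n => In n t) - limn (fun n => In n s) - A s t.
  by apply: cvgB; [apply: cvgB; exact: cvg | exact: cvg_cst].
apply/ler_addgt0Pr => e e0.
have C1 : 0 < C + 1 by lra.
have [n0 Hn0] := e_small _ (divr_gt0 (divr_gt0 e0 (ltr0n R 2)) C1).
have e2 : 0 < e / 2 by rewrite divr_gt0.
have /cvgrPdist_le/(_ _ e2)[n1 _ Hn1] := H.
pose n := maxn n0 n1.
have L1 := Hn1 n (leq_maxr _ _); have L2 := Hn0 n (leq_maxl _ _).
have L3 := main n s t s0 st tT.
move: L1; set L := _ - _ - A s t; set L' := In n t - In n s - A s t => L1.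
have -> : L = (L - L') + L' by ring.
apply: le_trans (ler_normD _ _) _; apply: le_trans (lerD L1 L3) _.
have : C * e_ n <= e / 2.
  apply: le_trans (ler_wpM2l C0 L2) _.
  by rewrite mulrA ler_pdivrMr// mulrC; apply: ler_wpM2l; lra.
lra.
Unshelve. all: by end_near. Qed.

End Control.

(** * Local uniqueness of solutions *)
Section BallEstimates.
Variables (R : realType) (n : nat).
Implicit Types (x h : 'rV[R]_n) (f : 'rV[R]_n -> R).

Lemma line_derive f x h (t : R) : differentiable f (x + t *: h) ->
  is_derive t 1 (fun t : R => f (x + t *: h)) ('D_h f (x + t *: h)).
Proof.
move=> dft; pose l (t : R) := x + t *: h.
have dl : is_derive t 1 l h.
  have d1 : is_derive t 1 (fun _ : R => x) 0 by exact: is_derive_cst.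
  have d2 : is_derive t 1 (fun t : R => t *: h) h.
    have dd : differentiable (fun t : R => t *: h) t by [].
    split; first exact: diff_derivable.
    by rewrite deriveE// diff_val scale1r.
  by have := is_deriveD d1 d2; rewrite add0r.
have [/derivable1_diffP dlt lh] := dl.
have dc : differentiable (f \o l) t by exact: differentiable_comp.
have dd : 'D_1 (f \o l) t = 'D_h f (l t).
  by rewrite deriveE// diff_comp//= -[in RHS]lh !deriveE.
by split; [exact/derivable1_diffP | exact: dd].
Qed.

Variables (U : set 'rV[R]_n) (c : 'rV[R]_n) (rho : R).
Let K := [set y : 'rV[R]_n | `|y - c| <= rho].
Hypotheses (oU : open U) (KU : K `<=` U).

Lemma ballK_convex x h t : K x -> K (x + h) -> 0 <= t -> t <= 1 -> K (x + t *: h).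
Proof.
rewrite /K /= => xK xhK t0 t1.
have -> : x + t *: h - c = (1 - t) *: (x - c) + t *: (x + h - c).
  by apply/rowP => j; rewrite !mxE; ring.
apply: le_trans (ler_normD _ _) _; rewrite !normrZ (ger0_norm t0) ger0_norm; last lra.
have -> : rho = (1 - t) * rho + t * rho by ring.
by apply: lerD; apply: ler_wpM2l => //; lra.
Qed.

Lemma ballK_compact : compact K.
Proof.
apply: bounded_closed_compact.
  exists (`|c| + `|rho|); split=> [|M HM y]; first exact: num_real.
  rewrite /K /= => yK; have -> : y = (y - c) + c by rewrite subrK.
  apply: le_trans (ler_normD _ _) _; apply: ltW; apply: le_lt_trans HM.
  by rewrite addrC lerD2l (le_trans yK)// ler_norm.
apply: (@closed_comp _ _ (fun w : 'rV[R]_n => `|w - c|) [set t | t <= rho]).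
  move=> w _; apply: continuous_comp; last exact: norm_continuous.
  by apply: continuousB => //; exact: cst_continuous.
exact: closed_le.
Qed.

Lemma ball_bounded f : sm U f -> bO K (fun=> 1) f.
Proof.
move=> sf.
have [K0|/set0P[x0 Kx0]] := eqVneq K set0.
  by exists 0 => x Kx; have : set0 x by rewrite -K0.
have cf : {within K, continuous (fun x => `|f x|)}.
  apply: continuous_in_subspaceT => x; rewrite inE => /KU Ux.
  apply: continuous_comp; last exact: norm_continuous.
  exact: differentiable_continuous (sm_diff sf Ux).
have Kn : K !=set0 by exists x0.
have [y _ ymax] := compact_EVT_max Kn ballK_compact cf.
by exists `|f y| => x Kx; rewrite mulr1; apply: ymax; rewrite inE.
Qed.

Definition D2 (q : 'rV[R]_n * 'rV[R]_n) := K q.1 /\ K (q.1 + q.2).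

Lemma ball_lip f : sm U f ->
  bO D2 (fun q => `|q.2|) (fun q => f (q.1 + q.2) - f q.1).
Proof.
move=> sf.
have H i : exists C, forall x, K x -> `|'D_(delta_mx 0 i) f x| <= C.
  have [C HC] := ball_bounded (sm_der (delta_mx 0 i) sf).
  by exists C => x Kx; have := HC x Kx; rewrite mulr1.
pose C i := sval (cid (H i)).
exists (n%:R * \sum_i `|C i|) => -[x h] [/= xK xhK].
apply: lip_bound => t.
  by move=> t0 t1; apply: (sm_diff sf); apply: KU; exact: ballK_convex.
move=> i t0 t1; apply: le_trans (_ : C i <= _).
  by rewrite /C; case: cid => /= Ci HCi; apply: HCi; exact: ballK_convex.
rewrite (bigD1 i)//= (le_trans (ler_norm _))// lerDl; exact: sumr_ge0.
Qed.

Definition D4 (q : ('rV[R]_n * 'rV[R]_n) * ('rV[R]_n * 'rV[R]_n)) :=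
  D2 q.1 /\ D2 q.2.

(* a quadruple ((x, h), (x', h')) stands for two increments f (x + h) - f x *)
Let q0 (q : ('rV[R]_n * 'rV[R]_n) * ('rV[R]_n * 'rV[R]_n)) := q.1.1 - q.2.1.
Let q1 (q : ('rV[R]_n * 'rV[R]_n) * ('rV[R]_n * 'rV[R]_n)) := q.1.2 - q.2.2.

(** One parameter t serves both segments, so that the right-hand side compares the
    derivatives at two points which are close when x and x', h and h' are. *)
Lemma MVT_diff f x h x' h' : sm U f -> D4 ((x, h), (x', h')) ->
  exists t, [/\ 0 <= t, t <= 1 &
    f (x + h) - f x - (f (x' + h') - f x') = 'D_h f (x + t *: h) - 'D_h' f (x' + t *: h')].
Proof.
move=> sf [[/= xK xhK] [/= xK' xhK']].
have dif y k t : K y -> K (y + k) -> 0 <= t -> t <= 1 -> differentiable f (y + t *: k).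
  by move=> yK ykK t0 t1; apply: (sm_diff sf); apply: KU; exact: ballK_convex.
pose g (t : R) := f (x + t *: h) - f (x' + t *: h').
have dg (t : R) : 0 <= t -> t <= 1 -> is_derive t 1 g ('D_h f (x + t *: h) - 'D_h' f (x' + t *: h')).
  move=> t0 t1.
  by apply: is_deriveB; apply: line_derive; exact: dif.
have := @MVT_segment R g (fun t => 'D_h f (x + t *: h) - 'D_h' f (x' + t *: h')) 0 1 ler01.
case.
- by move=> t; rewrite in_itv /= => /andP[t0 t1]; apply: dg; exact: ltW.
- apply: derivable_within_continuous => t; rewrite in_itv /= => /andP[t0 t1].
  by have [] := dg t t0 t1.
move=> t; rewrite in_itv /= => /andP[t0 t1].
rewrite /g !scale1r !scale0r !addr0 subr0 mulr1 => e.
by exists t; split=> //; rewrite -e; ring.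
Qed.

(** By [MVT_diff] the difference of two increments is not only small with h and h',
    but also with x - x' and h - h'. *)
Lemma ball_4pt f : sm U f ->
  bO D4 (fun q => `|q1 q| + `|q0 q| * `|q.1.2|)
        (fun q => f (q.1.1 + q.1.2) - f q.1.1 - (f (q.2.1 + q.2.2) - f q.2.1)).
Proof.
move=> sf.
have H i : exists C, 0 <= C /\ (forall x, K x -> `|'D_(delta_mx 0 i) f x| <= C) /\
   (forall x x', K x -> K x' -> `|'D_(delta_mx 0 i) f x - 'D_(delta_mx 0 i) f x'| <= C * `|x - x'|).
  have [C HC] := ball_bounded (sm_der (delta_mx 0 i) sf).
  have [C' HC'] := ball_lip (sm_der (delta_mx 0 i) sf).
  exists (`|C| + `|C'|); split; first exact: addr_ge0.
  split=> [x Kx|x x' Kx Kx'].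
    apply: le_trans (HC x Kx) _; rewrite mulr1 (le_trans (ler_norm _))// lerDl//.
  have := HC' (x', x - x'); rewrite /= subrKC => /(_ (conj Kx' _)) HH.
  have {}HH := HH _; apply: le_trans (HH _) _; first by rewrite /= subrKC.
  by rewrite ler_wpM2r// (le_trans (ler_norm _))// lerDr.
pose C i := sval (cid (H i)).
have rho0 x : K x -> 0 <= rho by move=> /(le_trans _)->.
exists (\sum_i C i * (2 * `|rho| + 2)) => -[[x h] [x' h']] D.
have [t [t0 t1 /= ->]] := MVT_diff sf D.
case: D => -[/= xK xhK] [/= xK' xhK'].
rewrite /q0 /q1 /=.
have pK : K (x + t *: h) by exact: ballK_convex.
have pK' : K (x' + t *: h') by exact: ballK_convex.
rewrite (derive_sum_coord h); last exact/(sm_diff sf)/KU.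
rewrite (derive_sum_coord h'); last exact/(sm_diff sf)/KU.
rewrite -sumrB mulr_suml; apply: le_trans (ler_norm_sum _ _ _) _.
apply: ler_sum => i _; rewrite /C; case: cid => /= Ci [Ci0 [Hb Hl]].
have h2 : `|h| <= 2 * `|rho|.
  have -> : h = (x + h - c) - (x - c) by apply/rowP => j; rewrite !mxE; ring.
  apply: le_trans (ler_normB _ _) _.
  have := le_trans xhK (ler_norm rho); have := le_trans xK (ler_norm rho).
  by move=> ? ?; lra.
have -> : h 0 i * 'D_'e_i f (x + t *: h) - h' 0 i * 'D_'e_i f (x' + t *: h') =
  h 0 i * ('D_'e_i f (x + t *: h) - 'D_'e_i f (x' + t *: h')) +
  (h - h') 0 i * 'D_'e_i f (x' + t *: h') by rewrite !mxE; ring.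
apply: le_trans (ler_normD _ _) _; rewrite !normrM.
have dp : `|x + t *: h - (x' + t *: h')| <= `|x - x'| + `|h - h'|.
  have -> : x + t *: h - (x' + t *: h') = (x - x') + t *: (h - h').
    by apply/rowP => j; rewrite !mxE; ring.
  apply: le_trans (ler_normD _ _) _; rewrite lerD2l normrZ ger0_norm//.
  by rewrite ler_piMl.
have e1 : `|h 0 i| * `|'D_'e_i f (x + t *: h) - 'D_'e_i f (x' + t *: h')| <=
    `|h| * (Ci * (`|x - x'| + `|h - h'|)).
  apply: ler_pM => //; first exact: ler_coord_norm.
  by apply: le_trans (Hl _ _ pK pK') _; rewrite ler_wpM2l.
have e2 : `|(h - h') 0 i| * `|'D_'e_i f (x' + t *: h')| <= `|h - h'| * Ci.
  by apply: ler_pM => //; [exact: ler_coord_norm|exact: Hb].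
apply: le_trans (lerD e1 e2) _.
set A := `|h| in h2 *; set B := `|x - x'|; set G := `|h - h'|.
have A0 : 0 <= A by exact: normr_ge0.
have B0 : 0 <= B by exact: normr_ge0.
have G0 : 0 <= G by exact: normr_ge0.
have -> : A * (Ci * (B + G)) + G * Ci = Ci * (A * B + (A + 1) * G) by ring.
rewrite -mulrA ler_wpM2l//.
have r0 : 0 <= `|rho| by [].
move: (`|rho|) r0 h2 => P r0 h2.
have : 0 <= P * (B * A) by rewrite !mulr_ge0.
have : 0 <= B * A by rewrite mulr_ge0.
have : A * G <= 2 * P * G by rewrite ler_wpM2r.
have -> : (2 * P + 2) * (G + B * A) = 2 * P * G + 2 * G + 2 * (P * (B * A)) + 2 * (B * A) by ring.
have -> : A * B + (A + 1) * G = B * A + A * G + G by ring.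
lra.
Qed.

Lemma ball_taylor f : sm U f ->
  bO D4 (fun q => (`|q.1.2| + `|q.2.2|) * `|q1 q| + `|q.1.2| * `|q.1.2| * `|q0 q|)
        (fun q => f (q.1.1 + q.1.2) - f q.1.1 - 'D_(q.1.2) f q.1.1 -
                 (f (q.2.1 + q.2.2) - f q.2.1 - 'D_(q.2.2) f q.2.1)).
Proof.
move=> sf.
have H i : exists C, 0 <= C /\
   (forall x h x' h', D4 ((x, h), (x', h')) ->
     `|'D_(delta_mx 0 i) f (x + h) - 'D_(delta_mx 0 i) f x -
      ('D_(delta_mx 0 i) f (x' + h') - 'D_(delta_mx 0 i) f x')| <= C * (`|h - h'| + `|x - x'| * `|h|)) /\
   (forall x h, K x -> K (x + h) -> `|'D_(delta_mx 0 i) f (x + h) - 'D_(delta_mx 0 i) f x| <= C * `|h|).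
  have [C HC] := ball_4pt (sm_der (delta_mx 0 i) sf).
  have [C' HC'] := ball_lip (sm_der (delta_mx 0 i) sf).
  exists (`|C| + `|C'|); split; first exact: addr_ge0.
  split=> [x h x' h' D|x h Kx Kx'].
    apply: le_trans (HC _ D) _; rewrite ler_wpM2r ?addr_ge0 ?mulr_ge0//.
    by rewrite (le_trans (ler_norm _))// lerDl.
  have := HC' (x, h) (conj Kx Kx') => /= HH; apply: le_trans HH _.
  by rewrite ler_wpM2r// (le_trans (ler_norm _))// lerDr.
pose C i := sval (cid (H i)).
exists (\sum_i C i) => -[[x h] [x' h']] D.
have [t [t0 t1 e]] := MVT_diff sf D.
have [[/= xK xhK] [/= xK' xhK']] := D.
rewrite /q0 /q1 /=.
have pK : K (x + t *: h) by exact: ballK_convex.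
have pK' : K (x' + t *: h') by exact: ballK_convex.
have -> : f (x + h) - f x - 'D_h f x - (f (x' + h') - f x' - 'D_h' f x') =
  (f (x + h) - f x - (f (x' + h') - f x')) - ('D_h f x - 'D_h' f x') by ring.
rewrite e.
rewrite !(derive_sum_coord h); [|exact/(sm_diff sf)/KU|exact/(sm_diff sf)/KU].
rewrite !(derive_sum_coord h'); [|exact/(sm_diff sf)/KU|exact/(sm_diff sf)/KU].
rewrite -!sumrB mulr_suml; apply: le_trans (ler_norm_sum _ _ _) _.
apply: ler_sum => i _; rewrite /C; case: cid => /= Ci [Ci0 [H4 Hl]].
set a := 'D_'e_i f (x + t *: h); set b := 'D_'e_i f (x' + t *: h').
set a0 := 'D_'e_i f x; set b0 := 'D_'e_i f x'.
have -> : h 0 i * a - h' 0 i * b - (h 0 i * a0 - h' 0 i * b0) =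
  h 0 i * (a - a0 - (b - b0)) + (h - h') 0 i * (b - b0) by rewrite !mxE; ring.
apply: le_trans (ler_normD _ _) _; rewrite !normrM.
have e1 : `|h 0 i| * `|a - a0 - (b - b0)| <= `|h| * (Ci * (`|h - h'| + `|x - x'| * `|h|)).
  apply: ler_pM => //; first exact: ler_coord_norm.
  have D' : D4 ((x, t *: h), (x', t *: h')) by split.
  apply: le_trans (H4 _ _ _ _ D') _; rewrite ler_wpM2l//.
  rewrite -scalerBr !normrZ ger0_norm//; apply: lerD; first by rewrite ler_piMl.
  by rewrite ler_wpM2l// ler_piMl.
have e2 : `|(h - h') 0 i| * `|b - b0| <= `|h - h'| * (Ci * `|h'|).
  apply: ler_pM => //; first exact: ler_coord_norm.
  apply: le_trans (Hl _ _ xK' pK') _.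
  by rewrite ler_wpM2l// normrZ ger0_norm// ler_piMl.
apply: le_trans (lerD e1 e2) _.
by rewrite le_eqVlt; apply/orP; left; apply/eqP; ring.
Qed.

End BallEstimates.

Section LocalUniqueness.
Variables (R : realType) (T p : R) (omega : R -> R -> R).
Hypotheses (T0 : 0 < T) (p2 : 2 <= p) (p3 : p < 3) (Hom : control T omega).
Local Notation r := (rr p omega).

Variables (n q : nat) (U : set 'rV[R]_n) (c : 'rV[R]_n) (rho : R).
Let K := [set y : 'rV[R]_n | `|y - c| <= rho].
Hypotheses (oU : open U) (KU : K `<=` U).
Variable F : 'I_q -> 'I_n -> 'rV[R]_n -> R.
Hypothesis sF : forall i k, sm U (F i k).

(** F2 i j is the derivative of the field F j along the field F i. *)
Definition F2 i j k (y : 'rV[R]_n) := \sum_l F i l y * 'D_(delta_mx 0 l) (F j k) y.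

Lemma sF2 i j k : sm U (F2 i j k).
Proof. by apply: sm_sum => // l _; apply: sm_mul => //; exact: sm_der. Qed.

Variables (z : R -> 'I_q -> R) (ZZ : R -> R -> 'I_q -> 'I_q -> R).

(** One step of the second order Euler scheme of the equation driven by (z, ZZ). *)
Definition euler k (s t : R) (y : 'rV[R]_n) :=
  \sum_i (z t i - z s i) * F i k y + \sum_i \sum_j ZZ s t i j * F2 i j k y.

Variables (a b : R).
Hypotheses (a0 : 0 <= a) (ab : a < b) (bT : b <= T).
Let D (st : R * R) := [/\ a <= st.1, st.1 <= st.2 & st.2 <= b].
Hypothesis zO : forall i, bO D (fun st => r st.1 st.2) (fun st => z st.2 i - z st.1 i).
Hypothesis ZO : forall i j, bO D (fun st => r st.1 st.2 * r st.1 st.2) (fun st => ZZ st.1 st.2 i j).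
Hypothesis chen : forall s u v i j, a <= s -> s <= u -> u <= v -> v <= b ->
  ZZ s v i j = ZZ s u i j + ZZ u v i j + (z u i - z s i) * (z v j - z u j).

Let sol (x : R -> 'rV[R]_n) :=
  (forall t, a <= t -> t <= b -> K (x t)) /\
  (forall k, bO D (fun st => r st.1 st.2 ^+ 3)
     (fun st => x st.2 0 k - x st.1 0 k - euler k st.1 st.2 (x st.1))).

Variables (x x' : R -> 'rV[R]_n).
Hypotheses (solx : sol x) (solx' : sol x').

Let J s t : 'rV[R]_n := \row_k ((x t 0 k - x s 0 k - euler k s t (x s)) -
                                (x' t 0 k - x' s 0 k - euler k s t (x' s))).

(* an index (m, (s, u, v)) carries a bound m for the distance of the two paths *)
Let D3 b' (i : R * (R * R * R)) :=
  [/\ 0 <= i.1 /\ `|x i.2.1.1 - x' i.2.1.1| <= i.1,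
      a <= i.2.1.1, i.2.1.1 <= i.2.1.2, i.2.1.2 <= i.2.2 & i.2.2 <= b'].

Let gE (i : R * (R * R * R)) :=
  i.1 * r i.2.1.1 i.2.2 ^+ 2 + `|J i.2.1.1 i.2.1.2|.
Let gr (i : R * (R * R * R)) := r i.2.1.1 i.2.2.

Let wl (y : R -> 'rV[R]_n) l s u := (y u - y s) 0 l - \sum_i (z u i - z s i) * F i l (y s).

(** By Chen's relation the scheme is consistent: over s <= u <= v its defect only
    involves Taylor remainders of the fields, besides the term wl, which is the
    increment of y minus its first order part. *)
Lemma euler_expand k (y : R -> 'rV[R]_n) s u v : a <= s -> s <= u -> u <= v -> v <= b -> K (y s) ->
  euler k u v (y u) + euler k s u (y s) - euler k s v (y s) =
  \sum_j (z v j - z u j) * ((F j k (y s + (y u - y s)) - F j k (y s) - 'D_(y u - y s) (F j k) (y s)) +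
      \sum_l 'D_(delta_mx 0 l) (F j k) (y s) * wl y l s u) +
  \sum_i \sum_j ZZ u v i j * (F2 i j k (y s + (y u - y s)) - F2 i j k (y s)).
Proof.
move=> as_ su uv vb Ks; rewrite subrKC.
have e1 j : - 'D_(y u - y s) (F j k) (y s) + \sum_l 'D_(delta_mx 0 l) (F j k) (y s) * wl y l s u =
    - \sum_i (z u i - z s i) * F2 i j k (y s).
  rewrite derive_sum_coord; last exact: (sm_diff (sF j k) (KU Ks)).
  rewrite -sumrN -big_split /= /wl -sumrN.
  transitivity (\sum_l \sum_i - ((z u i - z s i) * (F i l (y s) * 'D_'e_l (F j k) (y s)))).
    apply: eq_bigr => l _; rewrite mulrBr addrA [_ * (y u - y s) 0 l]mulrC addNr add0r.
    by rewrite mulr_sumr -sumrN; apply: eq_bigr => i _; ring.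
  by rewrite exchange_big /=; apply: eq_bigr => i _; rewrite /F2 mulr_sumr -sumrN.
transitivity (\sum_j (z v j - z u j) * (F j k (y u) - F j k (y s) - \sum_i (z u i - z s i) * F2 i j k (y s)) +
  \sum_i \sum_j ZZ u v i j * (F2 i j k (y u) - F2 i j k (y s))); last first.
  congr (_ + _); apply: eq_bigr => j _; congr (_ * _).
  by rewrite -e1; ring.
have e2 : \sum_j (z v j - z u j) * (F j k (y u) - F j k (y s) - \sum_i (z u i - z s i) * F2 i j k (y s)) =
   \sum_j (z v j - z u j) * (F j k (y u) - F j k (y s)) -
   \sum_i \sum_j (z u i - z s i) * (z v j - z u j) * F2 i j k (y s).
  rewrite exchange_big /= -sumrB; apply: eq_bigr => j _.
  by rewrite mulrBr mulr_sumr; congr (_ - _); apply: eq_bigr => i _; ring.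
rewrite e2 /euler.
have e3 : \sum_i \sum_j ZZ s v i j * F2 i j k (y s) =
   \sum_i \sum_j ZZ s u i j * F2 i j k (y s) + \sum_i \sum_j ZZ u v i j * F2 i j k (y s) +
   \sum_i \sum_j (z u i - z s i) * (z v j - z u j) * F2 i j k (y s).
  rewrite -!big_split /=; apply: eq_bigr => i _; rewrite -!big_split /=; apply: eq_bigr => j _.
  by rewrite (chen _ _ as_ su uv vb); ring.
have e4 : \sum_i (z v i - z s i) * F i k (y s) =
  \sum_i (z u i - z s i) * F i k (y s) + \sum_i (z v i - z u i) * F i k (y s).
  by rewrite -big_split /=; apply: eq_bigr => i _; ring.
have e5 : \sum_j (z v j - z u j) * (F j k (y u) - F j k (y s)) =
  \sum_j (z v j - z u j) * F j k (y u) - \sum_j (z v j - z u j) * F j k (y s).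
  by rewrite -sumrB; apply: eq_bigr => j _; ring.
have e6 : \sum_i \sum_j ZZ u v i j * (F2 i j k (y u) - F2 i j k (y s)) =
  \sum_i \sum_j ZZ u v i j * F2 i j k (y u) - \sum_i \sum_j ZZ u v i j * F2 i j k (y s).
  rewrite -sumrB; apply: eq_bigr => i _; rewrite -sumrB; apply: eq_bigr => j _; ring.
rewrite e3 e4 e5 e6; ring.
Qed.

Lemma defect_rearrange (xs xu xv ys yu yv esv esu euv esv' esu' euv' : R) :
  euv + esu - esv - (euv' + esu' - esv') =
  xv - xs - esv - (yv - ys - esv') - (xu - xs - esu - (yu - ys - esu')) -
  (xv - xu - euv - (yv - yu - euv')).
Proof. by ring. Qed.

Lemma bO_norm (I : Type) (DD : I -> Prop) (g : I -> R) (w : I -> 'rV[R]_n) :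
  (forall i, DD i -> 0 <= g i) -> (forall k, bO DD g (fun i => w i 0 k)) ->
  bO DD g (fun i => `|w i|).
Proof.
move=> g0 H; pose C k := sval (cid (H k)).
exists (\sum_k `|C k|) => i Di; rewrite normr_id.
apply: norm_rV_le => [|i' k]; first by rewrite mulr_ge0// ?g0// sumr_ge0.
rewrite (ord1 i'); apply: (@le_trans _ _ (`|C k| * g i)).
  rewrite /C; case: cid => /= Ck HCk; apply: le_trans (HCk i Di) _.
  by rewrite ler_wpM2r ?g0// ler_norm.
rewrite ler_wpM2r ?g0// (bigD1 k)//= lerDl; exact: sumr_ge0.
Qed.

Lemma bO_trans (I : Type) (DD : I -> Prop) (g G f : I -> R) :
  bO DD G f -> bO DD g G -> bO DD g f.
Proof.
move=> [C H] [C' H']; exists (`|C| * C') => i Di.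
apply: le_trans (H i Di) _; rewrite -mulrA; apply: le_trans (ler_wpM2l _ (H' i Di)) => //.
by rewrite -normrM ler_norm.
Qed.

Lemma r_mono s s' t' t : a <= s -> s <= s' -> s' <= t' -> t' <= t -> t <= b -> r s' t' <= r s t.
Proof.
move=> as_ ? ? ? tb; apply: (rr_mono p2 Hom) => //; last exact: le_trans bT.
exact: le_trans as_.
Qed.

(** Every term of the defect of the difference J of the two local errors carries
    the distance m of the two paths, or J itself, as a factor.  That is what
    allows a contraction argument. *)
Lemma J_defect b' : b' <= b -> a <= b' -> r a b' <= 1 -> forall k,
  bO (D3 b') (fun i => gr i * gE i)
     (fun i => J i.2.1.1 i.2.2 0 k - J i.2.1.1 i.2.1.2 0 k - J i.2.1.2 i.2.2 0 k).
Proof.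
move=> b'b ab' r1 k.
have a0' := a0; have bT' := bT.
have [Kx solx2] := solx; have [Kx' solx2'] := solx'.
pose m (i : R * (R * R * R)) := i.1.
pose Jn (i : R * (R * R * R)) := `|J i.2.1.1 i.2.1.2|.
pose gd i := gr i * m i + Jn i.
have gr01 i : D3 b' i -> 0 <= gr i <= 1.
  move=> [_ as_ su uv vb]; rewrite /gr rr_ge0 /=.
  by apply: le_trans r1; apply: r_mono => //; exact: le_trans su uv.
have gr0 i : D3 b' i -> 0 <= gr i by move=> /gr01/andP[].
have m0 i : D3 b' i -> 0 <= m i by move=> [[]].
have Jn0 i : 0 <= Jn i by exact: normr_ge0.
have gEE i : gE i = m i * (gr i * gr i) + Jn i by rewrite /gE expr2.
have gE0 i : D3 b' i -> 0 <= gE i.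
  by move=> Di; rewrite gEE addr_ge0 ?mulr_ge0 ?m0 ?gr0.
have le_uv i : D3 b' i -> 0 <= r i.2.1.2 i.2.2 <= gr i.
  move=> [_ as_ su uv vb]; rewrite /gr rr_ge0 /=.
  by apply: r_mono => //; exact: le_trans b'b.
have le_su i : D3 b' i -> 0 <= r i.2.1.1 i.2.1.2 <= gr i.
  move=> [_ as_ su uv vb]; rewrite /gr rr_ge0 /=.
  by apply: r_mono => //; exact: le_trans b'b.
pose uv (i : R * (R * R * R)) := (i.2.1.2, i.2.2).
pose su (i : R * (R * R * R)) := (i.2.1.1, i.2.1.2).
have Duv i : D3 b' i -> D (uv i) by move=> [_ ? ? ? ?]; split=> /=; lra.
have Dsu i : D3 b' i -> D (su i) by move=> [_ ? ? ? ?]; split=> /=; lra.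
have Ks i : D3 b' i -> K (x i.2.1.1) by move=> [_ ? ? ? ?]; apply: Kx; lra.
have Ks' i : D3 b' i -> K (x' i.2.1.1) by move=> [_ ? ? ? ?]; apply: Kx'; lra.
have Ku i : D3 b' i -> K (x i.2.1.2) by move=> [_ ? ? ? ?]; apply: Kx; lra.
have Ku' i : D3 b' i -> K (x' i.2.1.2) by move=> [_ ? ? ? ?]; apply: Kx'; lra.
have sq_le i (y : R) : D3 b' i -> 0 <= y <= gr i -> 0 <= y * y <= gr i * gr i.
  by move=> Di /andP[y0 yg]; rewrite mulr_ge0//= ler_pM.
have zuv j : bO (D3 b') gr (fun i => z i.2.2 j - z i.2.1.2 j).
  by apply: bO_le (bO_map Duv (zO j)) => i /le_uv.
have zsu j : bO (D3 b') gr (fun i => z i.2.1.2 j - z i.2.1.1 j).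
  by apply: bO_le (bO_map Dsu (zO j)) => i /le_su.
have Zuv j l : bO (D3 b') (fun i => gr i * gr i) (fun i => ZZ i.2.1.2 i.2.2 j l).
  by apply: bO_le (bO_map Duv (ZO j l)) => i Di; apply: sq_le => //; exact: le_uv.
have Zsu j l : bO (D3 b') (fun i => gr i * gr i) (fun i => ZZ i.2.1.1 i.2.1.2 j l).
  by apply: bO_le (bO_map Dsu (ZO j l)) => i Di; apply: sq_le => //; exact: le_su.
have bnd f : sm U f -> bO (D3 b') (fun=> 1) (fun i => f (x i.2.1.1)).
  by move=> sf; apply: (bO_map Ks (ball_bounded KU sf)).
have bnd' f : sm U f -> bO (D3 b') (fun=> 1) (fun i => f (x' i.2.1.1)).
  by move=> sf; apply: (bO_map Ks' (ball_bounded KU sf)).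
have mO : bO (D3 b') m (fun i => `|x i.2.1.1 - x' i.2.1.1|).
  by exists 1 => i [[_ H] _ _ _ _]; rewrite normr_id mul1r.
have lip f : sm U f -> bO (D3 b') m (fun i => f (x i.2.1.1) - f (x' i.2.1.1)).
  move=> sf; apply: bO_trans mO.
  pose phi (i : R * (R * R * R)) := (x' i.2.1.1, x i.2.1.1 - x' i.2.1.1).
  have Dphi i : D3 b' i -> D2 c rho (phi i).
    by move=> Di; split; rewrite /phi /= ?subrKC; [exact: Ks'|exact: Ks].
  by apply: bO_ext (bO_map Dphi (ball_lip KU sf)) => i Di; rewrite /= subrKC.
have err (y : R -> 'rV[R]_n) l : sol y -> bO (D3 b') (fun i => gr i * gr i)
    (fun i => y i.2.1.2 0 l - y i.2.1.1 0 l - euler l i.2.1.1 i.2.1.2 (y i.2.1.1)).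
  move=> [_ Hy]; apply: bO_le (bO_map Dsu (Hy l)) => i Di /=.
  have /andP[r0 rg] := le_su i Di; have /andP[g0 g1] := gr01 i Di.
  rewrite exprn_ge0//= !exprS expr0 mulr1.
  have rr1 : r i.2.1.1 i.2.1.2 <= 1 by exact: le_trans g1.
  have h1 : r i.2.1.1 i.2.1.2 * r i.2.1.1 i.2.1.2 <= gr i * gr i by rewrite ler_pM.
  have h2 : 0 <= r i.2.1.1 i.2.1.2 * r i.2.1.1 i.2.1.2 by rewrite mulr_ge0.
  by apply: le_trans h1; rewrite ler_piMl.
have w_euler (y : R -> 'rV[R]_n) l (i : R * (R * R * R)) : wl y l i.2.1.1 i.2.1.2 =
    (y i.2.1.2 0 l - y i.2.1.1 0 l - euler l i.2.1.1 i.2.1.2 (y i.2.1.1)) +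
    \sum_e \sum_f ZZ i.2.1.1 i.2.1.2 e f * F2 e f l (y i.2.1.1).
  by rewrite /wl /euler !mxE; ring.
have wO l : bO (D3 b') (fun i => gr i * gr i) (fun i => wl x l i.2.1.1 i.2.1.2).
  apply: (bO_ext (fun i _ => esym (w_euler x l i))); apply: bO_add; first exact: err.
  apply: bO_sum => e; apply: bO_sum => f; apply: bO_bmulr => //.
  by apply: bnd; exact: sF2.
have JO l : bO (D3 b') Jn (fun i => J i.2.1.1 i.2.1.2 0 l).
  by exists 1 => i _; rewrite mul1r; exact: ler_coord_norm.
have ggm_le i : D3 b' i -> 0 <= gr i * gr i * m i <= gE i.
  move=> Di; rewrite !mulr_ge0 ?gr0 ?m0//= gEE [m i * _]mulrC.
  by rewrite lerDl Jn0.
have Jn_le i : D3 b' i -> 0 <= Jn i <= gE i.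
  by move=> Di; rewrite Jn0 /= gEE lerDr !mulr_ge0 ?gr0 ?m0.
have gd_le i : D3 b' i -> 0 <= gr i * gd i <= gE i.
  move=> Di; have /andP[g0 g1] := gr01 i Di; rewrite /gd.
  rewrite mulr_ge0 ?addr_ge0 ?mulr_ge0 ?m0//= gEE mulrDr mulrA [m i * _]mulrC lerD2l.
  by rewrite ler_piMl.
have wdO l : bO (D3 b') gE (fun i => wl x l i.2.1.1 i.2.1.2 - wl x' l i.2.1.1 i.2.1.2).
  have E (i : R * (R * R * R)) : J i.2.1.1 i.2.1.2 0 l + \sum_e \sum_f ZZ i.2.1.1 i.2.1.2 e f *
      (F2 e f l (x i.2.1.1) - F2 e f l (x' i.2.1.1)) =
      wl x l i.2.1.1 i.2.1.2 - wl x' l i.2.1.1 i.2.1.2.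
    rewrite !w_euler mxE.
    under eq_bigr => e _ do (under eq_bigr => f _ do rewrite mulrBr; rewrite sumrB).
    by rewrite sumrB; ring.
  apply: (bO_ext (fun i _ => E i)); apply: bO_add; first by apply: bO_le (JO l).
  apply: bO_sum => e; apply: bO_sum => f.
  by apply: bO_le (bO_mul (Zsu e f) (lip _ (sF2 e f l))).
have gm0 i : D3 b' i -> 0 <= gd i.
  by move=> Di; rewrite addr_ge0 ?mulr_ge0 ?gr0 ?m0.
have hO (y : R -> 'rV[R]_n) (Hy : sol y)
   (bndy : forall f, sm U f -> bO (D3 b') (fun=> 1) (fun i => f (y i.2.1.1))) :
   bO (D3 b') gr (fun i => `|y i.2.1.2 - y i.2.1.1|).
  apply: bO_norm => // l.
  have E (i : R * (R * R * R)) : (y i.2.1.2 0 l - y i.2.1.1 0 l - euler l i.2.1.1 i.2.1.2 (y i.2.1.1)) +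
    (\sum_e (z i.2.1.2 e - z i.2.1.1 e) * F e l (y i.2.1.1) +
     \sum_e \sum_f ZZ i.2.1.1 i.2.1.2 e f * F2 e f l (y i.2.1.1)) =
    (y i.2.1.2 - y i.2.1.1) 0 l by rewrite /euler !mxE; ring.
  have gg_le i : D3 b' i -> 0 <= gr i * gr i <= gr i.
    by move=> Di; have /andP[g0 g1] := gr01 i Di; rewrite mulr_ge0//= ler_piMl.
  apply: (bO_ext (fun i _ => E i)); apply: bO_add.
    by apply: bO_le gg_le (err _ _ _).
  apply: bO_add.
    by apply: bO_sum => e; apply: bO_bmulr => //; exact: bndy.
  apply: bO_sum => e; apply: bO_sum => f; apply: bO_le gg_le _; apply: bO_bmulr => //.
  by apply: bndy; exact: sF2.
have h1O := hO x solx bnd; have h2O := hO x' solx' bnd'.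
have hdO : bO (D3 b') gd (fun i => `|x i.2.1.2 - x i.2.1.1 - (x' i.2.1.2 - x' i.2.1.1)|).
  apply: bO_norm => // l.
  have E (i : R * (R * R * R)) : (wl x l i.2.1.1 i.2.1.2 - wl x' l i.2.1.1 i.2.1.2) +
    \sum_e (z i.2.1.2 e - z i.2.1.1 e) * (F e l (x i.2.1.1) - F e l (x' i.2.1.1)) =
    (x i.2.1.2 - x i.2.1.1 - (x' i.2.1.2 - x' i.2.1.1)) 0 l.
    under eq_bigr => e _ do rewrite mulrBr.
    by rewrite sumrB /wl !mxE; ring.
  apply: (bO_ext (fun i _ => E i)); apply: bO_add.
    apply: bO_le (wdO l) => i Di; rewrite gE0//= /gd gEE lerD2r mulrC.
    have /andP[g0 g1] := gr01 i Di.
    by rewrite ler_wpM2r ?m0// ler_piMl.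
  apply: bO_sum => e; apply: bO_le (bO_mul (zsu e) (lip _ (sF e l))) => i Di.
  by rewrite mulr_ge0 ?gr0 ?m0//= /gd lerDl.
(* the increments of x and x' over [s, u], as a quadruple for ball_4pt and ball_taylor *)
pose psi (i : R * (R * R * R)) := ((x i.2.1.1, x i.2.1.2 - x i.2.1.1),
  (x' i.2.1.1, x' i.2.1.2 - x' i.2.1.1)).
have Dpsi i : D3 b' i -> D4 c rho (psi i).
  by move=> Di; split; split; rewrite /psi /= ?subrKC; [exact: Ks|exact: Ku|exact: Ks'|exact: Ku'].
have gmg_le i : D3 b' i -> 0 <= gr i * gr i * m i <= gr i * gr i * m i.
  by move=> Di; rewrite lexx !mulr_ge0 ?gr0 ?m0.
have tayO j : bO (D3 b') gE (fun i =>
   F j k (x i.2.1.1 + (x i.2.1.2 - x i.2.1.1)) - F j k (x i.2.1.1) -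
     'D_(x i.2.1.2 - x i.2.1.1) (F j k) (x i.2.1.1) -
   (F j k (x' i.2.1.1 + (x' i.2.1.2 - x' i.2.1.1)) - F j k (x' i.2.1.1) -
     'D_(x' i.2.1.2 - x' i.2.1.1) (F j k) (x' i.2.1.1))).
  apply: bO_trans (bO_map Dpsi (ball_taylor KU (sF j k))) _.
  apply: bO_add.
    apply: bO_le gd_le _; apply: bO_mul hdO; exact: bO_add.
  by apply: bO_le ggm_le _; apply: bO_mul mO; exact: bO_mul.
have dxO j l : bO (D3 b') gE (fun i =>
    'D_(delta_mx 0 l) (F j k) (x i.2.1.1) * wl x l i.2.1.1 i.2.1.2 -
    'D_(delta_mx 0 l) (F j k) (x' i.2.1.1) * wl x' l i.2.1.1 i.2.1.2).
  have sD := sm_der (delta_mx 0 l) (sF j k).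
  have E (i : R * (R * R * R)) : ('D_(delta_mx 0 l) (F j k) (x i.2.1.1) - 'D_(delta_mx 0 l) (F j k) (x' i.2.1.1)) *
      wl x l i.2.1.1 i.2.1.2 +
    'D_(delta_mx 0 l) (F j k) (x' i.2.1.1) * (wl x l i.2.1.1 i.2.1.2 - wl x' l i.2.1.1 i.2.1.2) =
    'D_(delta_mx 0 l) (F j k) (x i.2.1.1) * wl x l i.2.1.1 i.2.1.2 -
    'D_(delta_mx 0 l) (F j k) (x' i.2.1.1) * wl x' l i.2.1.1 i.2.1.2 by ring.
  apply: (bO_ext (fun i _ => E i)); apply: bO_add.
    by apply: bO_le (bO_mul (lip _ sD) (wO l)) => i Di; rewrite mulrC ggm_le.
  by apply: bO_bmul => //; exact: (bnd' _ sD).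
have f4O e j : bO (D3 b') (fun i => gd i + m i * gr i) (fun i =>
    F2 e j k (x i.2.1.1 + (x i.2.1.2 - x i.2.1.1)) - F2 e j k (x i.2.1.1) -
    (F2 e j k (x' i.2.1.1 + (x' i.2.1.2 - x' i.2.1.1)) - F2 e j k (x' i.2.1.1))).
  apply: bO_trans (bO_map Dpsi (ball_4pt KU (sF2 e j k))) _.
  apply: bO_add.
    by apply: bO_le hdO => i Di; rewrite gm0//= lerDl mulr_ge0 ?m0 ?gr0.
  apply: bO_le (bO_mul mO h1O) => i Di.
  by rewrite mulr_ge0 ?m0 ?gr0//= lerDr gm0.
pose tm (y : R -> 'rV[R]_n) (i : R * (R * R * R)) j :=
  F j k (y i.2.1.1 + (y i.2.1.2 - y i.2.1.1)) - F j k (y i.2.1.1) -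
     'D_(y i.2.1.2 - y i.2.1.1) (F j k) (y i.2.1.1) +
  \sum_l 'D_(delta_mx 0 l) (F j k) (y i.2.1.1) * wl y l i.2.1.1 i.2.1.2.
pose fm (y : R -> 'rV[R]_n) (i : R * (R * R * R)) e j :=
  F2 e j k (y i.2.1.1 + (y i.2.1.2 - y i.2.1.1)) - F2 e j k (y i.2.1.1).
have E (i : R * (R * R * R)) : D3 b' i -> \sum_j (z i.2.2 j - z i.2.1.2 j) * (tm x i j - tm x' i j) +
  \sum_e \sum_j ZZ i.2.1.2 i.2.2 e j * (fm x i e j - fm x' i e j) =
  J i.2.1.1 i.2.2 0 k - J i.2.1.1 i.2.1.2 0 k - J i.2.1.2 i.2.2 0 k.
  move=> Di; have [_ as_ su_ uv_ vb] := Di.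
  have vb' : i.2.2 <= b by lra.
  have Ex := euler_expand k as_ su_ uv_ vb' (Ks i Di).
  have Ex' := euler_expand k as_ su_ uv_ vb' (Ks' i Di).
  rewrite /J !mxE.
  transitivity ((euler k i.2.1.2 i.2.2 (x i.2.1.2) + euler k i.2.1.1 i.2.1.2 (x i.2.1.1) - euler k i.2.1.1 i.2.2 (x i.2.1.1)) -
    (euler k i.2.1.2 i.2.2 (x' i.2.1.2) + euler k i.2.1.1 i.2.1.2 (x' i.2.1.1) - euler k i.2.1.1 i.2.2 (x' i.2.1.1))); last exact: defect_rearrange.
  rewrite Ex Ex' -/(tm x i) -/(tm x' i) opprD addrACA -!sumrB; congr (_ + _).
    by apply: eq_bigr => j _; rewrite mulrBr.
  apply: eq_bigr => e _; rewrite -sumrB; apply: eq_bigr => j _.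
  by rewrite mulrBr.
apply: (bO_ext E); apply: bO_add.
  apply: bO_sum => j; apply: bO_mul => //.
  have E' (i : R * (R * R * R)) : (F j k (x i.2.1.1 + (x i.2.1.2 - x i.2.1.1)) - F j k (x i.2.1.1) -
     'D_(x i.2.1.2 - x i.2.1.1) (F j k) (x i.2.1.1) -
   (F j k (x' i.2.1.1 + (x' i.2.1.2 - x' i.2.1.1)) - F j k (x' i.2.1.1) -
     'D_(x' i.2.1.2 - x' i.2.1.1) (F j k) (x' i.2.1.1))) +
   \sum_l ('D_(delta_mx 0 l) (F j k) (x i.2.1.1) * wl x l i.2.1.1 i.2.1.2 -
    'D_(delta_mx 0 l) (F j k) (x' i.2.1.1) * wl x' l i.2.1.1 i.2.1.2) = tm x i j - tm x' i j.
    by rewrite sumrB /tm; ring.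
  by apply: (bO_ext (fun i _ => E' i)); apply: bO_add => //; exact: bO_sum.
apply: bO_sum => e; apply: bO_sum => j.
apply: bO_mono (bO_mul (Zuv e j) (f4O e j)); exists 2 => // i Di.
have /andP[g0 g1] := gr01 i Di.
have /andP[h1 h2] := gd_le i Di; have /andP[h3 h4] := ggm_le i Di.
rewrite mulr_ge0 ?mulr_ge0 ?addr_ge0 ?mulr_ge0 ?gm0 ?m0//=.
have -> : gr i * gr i * (gd i + m i * gr i) = gr i * (gr i * gd i + gr i * gr i * m i) by ring.
rewrite mulrCA ler_wpM2l//; lra.
Qed.

(** Suppose |x - x'| <= m and |J| <= Lam m r^3 on [a, b'].  By [J_defect] the defect
    of additivity of J is then O(m r^3), with a constant which does not depend
    on Lam once Lam * r a b' <= 1, so that [young_bound] improves the second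
    bound to Lam (m / 2) r^3.  As x t - x' t = J a t, the first bound improves to
    m / 2 too.  Iterating, x = x' on [a, b']. *)
Lemma local_uniqueness : x a = x' a ->
  exists b', [/\ a < b', b' <= b & forall t, a <= t -> t <= b' -> x t = x' t].
Proof.
move=> xa; have a0' := a0; have bT' := bT; have ab' := ab.
have [Kx solx2] := solx; have [Kx' solx2'] := solx'.
have small e b0 : 0 < e -> a < b0 -> b0 <= b -> exists b1, [/\ a < b1, b1 <= b0 & r a b1 <= e].
  move=> e0 ab0 b0b; have [d d0 H] := rr_unif p2 Hom e0.
  exists (Num.min b0 (a + d)); split.
  - by rewrite lt_min ab0 /=; lra.
  - by rewrite ge_min lexx.
  - have h1 : Num.min b0 (a + d) <= a + d by rewrite ge_min lexx orbT.
    have h2 : Num.min b0 (a + d) <= b0 by rewrite ge_min lexx.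
    have h3 : a <= Num.min b0 (a + d) by rewrite le_min ltW//=; lra.
    by apply: H => //; lra.
have [b1 [ab1 b1b r1]] := small 1 b ltr01 ab' (lexx b).
have [C HCk] : exists C : 'I_n -> R, forall k i, D3 b1 i ->
    `|J i.2.1.1 i.2.2 0 k - J i.2.1.1 i.2.1.2 0 k - J i.2.1.2 i.2.2 0 k| <= C k * (gr i * gE i).
  by exists (fun k => sval (cid (J_defect b1b (ltW ab1) r1 k))) => k; case: cid.
have [C1 C10 CC1] : exists2 C1, 0 <= C1 & forall k, C k <= C1.
  exists (\sum_k `|C k|) => [|k]; first exact: sumr_ge0.
  by rewrite (bigD1 k)//= (le_trans (ler_norm _))// lerDl; exact: sumr_ge0.
have K0 := maxK_gt0 p2 p3.
have [Lam [Lam0 LamE]] : exists Lam, 0 < Lam /\ Lam = 4 * maxK p * (C1 + 1).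
  exists (4 * maxK p * (C1 + 1)); split=> //.
  by apply: mulr_gt0; [exact: mulr_gt0 | lra].
have Li0 : 0 < Lam^-1 by rewrite invr_gt0.
have [b' [ab2 b'b1 rL]] := small _ b1 Li0 ab1 b1b.
have b'b : b' <= b by exact: (le_trans b'b1 b1b).
have rmono s t : a <= s -> s <= t -> t <= b' -> r s t <= r a b'.
  by move=> *; exact: r_mono.
have rb'1 : r a b' <= 1 by apply: le_trans r1; apply: r_mono => //; exact: ltW.
exists b'; split=> //.
pose P m := [/\ 0 <= m, forall t, a <= t -> t <= b' -> `|x t - x' t| <= m &
   forall s t, a <= s -> s <= t -> t <= b' -> `|J s t| <= Lam * m * r s t ^+ 3].
have step m : P m -> P (m / 2).
  move=> [m0 Dm Jm].
  have Jm2 s t : a <= s -> s <= t -> t <= b' -> `|J s t| <= Lam * (m / 2) * r s t ^+ 3.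
    move=> as_ st tb; apply: norm_rV_le => [|i k].
      by rewrite mulr_ge0 ?exprn_ge0 ?rr_ge0// mulr_ge0 ?divr_ge0// ltW.
    rewrite (ord1 i) {i}.
    have C2 : 0 <= 2 * C1 * m by rewrite !mulr_ge0.
    have b'T : b' <= T by exact: le_trans b'b bT'.
    have Jk s1 t1 : a <= s1 -> s1 <= t1 -> t1 <= b' -> `|J s1 t1 0 k| <= Lam * m * r s1 t1 ^+ 3.
      by move=> h1 h2 h3; apply: le_trans (ler_coord_norm _ _ _) (Jm _ _ h1 h2 h3).
    have dJ s1 u v : a <= s1 -> s1 <= u -> u <= v -> v <= b' ->
        `|J s1 v 0 k - J s1 u 0 k - J u v 0 k| <= 2 * C1 * m * r s1 v ^+ 3.
      move=> h1 h2 h3 h4.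
      have Di : D3 b1 (m, (s1, u, v)).
        split=> //=; last exact: le_trans b'b1.
        by split=> //; apply: Dm => //; exact: le_trans (le_trans h2 h3) h4.
      have HC : `|J s1 v 0 k - J s1 u 0 k - J u v 0 k| <=
          C1 * (r s1 v * (m * r s1 v ^+ 2 + `|J s1 u|)).
        have r0 : 0 <= r s1 v * (m * r s1 v ^+ 2 + `|J s1 u|).
          by rewrite mulr_ge0 ?addr_ge0 ?mulr_ge0 ?exprn_ge0 ?rr_ge0.
        apply: le_trans (ler_wpM2r r0 (CC1 k)).
        exact: HCk Di.
      apply: le_trans HC _.
      have -> : 2 * C1 * m * r s1 v ^+ 3 = C1 * (m * (2 * r s1 v ^+ 3)) by ring.
      rewrite ler_wpM2l//.
      have Js := Jm s1 u h1 h2 (le_trans h3 h4).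
      have ru : r s1 u <= r s1 v by apply: r_mono => //; exact: le_trans b'b.
      have rv0 := rr_ge0 p omega s1 v; have ru0 := rr_ge0 p omega s1 u.
      have e1 : `|J s1 u| <= m * r s1 v ^+ 2.
        apply: le_trans Js _; rewrite exprS.
        have -> : Lam * m * (r s1 u * r s1 u ^+ 2) = (Lam * r s1 u) * (m * r s1 u ^+ 2) by ring.
        have L1 : Lam * r s1 u <= 1.
          rewrite -ler_pdivlMl// mulr1; apply: le_trans rL.
          by apply: r_mono => //; exact: le_trans h4.
        apply: (@le_trans _ _ (1 * (m * r s1 v ^+ 2))); last by rewrite mul1r.
        apply: ler_pM => //.
        - by rewrite mulr_ge0// ltW.
        - by rewrite mulr_ge0// exprn_ge0.
        - by rewrite ler_wpM2l// lerXn2r ?nnegrE.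
      have -> : m * (2 * r s1 v ^+ 3) = r s1 v * (m * r s1 v ^+ 2 + m * r s1 v ^+ 2) by ring.
      by rewrite ler_wpM2l// lerD2l.
    have := young_bound p2 p3 Hom a0' b'T C2 Jk dJ as_ st tb.
    move=> H; apply: le_trans H _.
    have r30 : 0 <= r s t ^+ 3 by exact/exprn_ge0/rr_ge0.
    rewrite ler_wpM2r// LamE.
    have -> : maxK p * (2 * C1 * m) = 2 * maxK p * m * C1 by ring.
    have -> : 4 * maxK p * (C1 + 1) * (m / 2) = 2 * maxK p * m * (C1 + 1) by field.
    have m20 : 0 <= 2 * maxK p * m by apply: mulr_ge0 => //; apply: mulr_ge0 => //; exact: ltW K0.
    by apply: (ler_wpM2l m20); rewrite lerDl.
  split=> //; first by rewrite divr_ge0.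
  move=> t at_ tb.
  have eD : x t - x' t = J a t.
    apply/rowP => k; rewrite !mxE xa; ring.
  rewrite eD; apply: le_trans (Jm2 a t (lexx _) at_ tb) _.
  have rt := rmono a t (lexx _) at_ tb; have r0 := rr_ge0 p omega a t.
  have -> : Lam * (m / 2) * r a t ^+ 3 = (m / 2) * ((Lam * r a t) * (r a t * r a t)) by ring.
  rewrite ler_piMr ?divr_ge0//.
  have L1 : Lam * r a t <= 1 by rewrite -ler_pdivlMl// mulr1; exact: le_trans rL.
  have L0 : 0 <= Lam * r a t by rewrite mulr_ge0// ltW.
  have rr1 : r a t <= 1 by exact: le_trans rb'1.
  rewrite -[leRHS]mulr1; apply: ler_pM => //; first by rewrite mulr_ge0.
  by rewrite -[leRHS]mulr1; apply: ler_pM.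
have [m0 Pm0] : exists m, P m.
  have JO k : exists C, forall s t, a <= s -> s <= t -> t <= b -> `|J s t 0 k| <= C * r s t ^+ 3.
    have [Ck0 HCk0] := bO_sub (solx2 k) (solx2' k).
    exists Ck0 => s t h1 h2 h3; rewrite mxE.
    by apply: (HCk0 (s, t)); split.
  pose CJ k := sval (cid (JO k)).
  exists (2 * `|rho| + (\sum_k `|CJ k|) / Lam).
  have S0 : 0 <= \sum_k `|CJ k| by exact: sumr_ge0.
  have SL0 : 0 <= (\sum_k `|CJ k|) / Lam by rewrite divr_ge0// ltW.
  have rh0 : 0 <= `|rho| by [].
  split; first by lra.
    move=> t at_ tb; have -> : x t - x' t = (x t - c) - (x' t - c) by rewrite opprB addrA subrK.
    have tb2 : t <= b by exact: le_trans b'b.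
    apply: le_trans (ler_normB _ _) _.
    have := le_trans (Kx t at_ tb2) (ler_norm rho); have := le_trans (Kx' t at_ tb2) (ler_norm rho).
    by move=> ? ?; lra.
  move=> s t as_ st tb; apply: norm_rV_le => [|i k].
    apply: mulr_ge0; last exact/exprn_ge0/rr_ge0.
    by apply: mulr_ge0; [exact: ltW | apply: addr_ge0 => //; exact: mulr_ge0].
  rewrite (ord1 i) {i}; apply: (@le_trans _ _ (`|CJ k| * r s t ^+ 3)).
    rewrite /CJ; case: cid => /= Ck0 HCk0; apply: le_trans (HCk0 s t as_ st (le_trans tb b'b)) _.
    by rewrite ler_wpM2r ?ler_norm// exprn_ge0// rr_ge0.
  rewrite ler_wpM2r ?exprn_ge0 ?rr_ge0// mulrDr [Lam * (_ / _)]mulrC divfK ?gt_eqF//.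
  have : `|CJ k| <= \sum_k `|CJ k| by rewrite (bigD1 k)//= lerDl; exact: sumr_ge0.
  have : 0 <= Lam * (2 * `|rho|) by rewrite !mulr_ge0// ltW.
  lra.
have Pn l : P (m0 / 2 ^+ l).
  elim: l => [|l IH]; first by rewrite expr0 divr1.
  by have := step _ IH; rewrite -mulrA -invfM -exprSr.
move=> t at_ tb; apply/eqP; rewrite -subr_eq0 -normr_le0.
apply/ler_addgt0Pr => e e0; rewrite add0r.
pose l := Num.truncn (m0 / e).
have [_ Dl _] := Pn l.+1.
apply: le_trans (Dl t at_ tb) _.
rewrite ler_pdivrMr ?exprn_gt0// mulrC -ler_pdivrMr//; apply: ltW.
apply: lt_le_trans (truncnS_gt _) _.
by rewrite -natrX ler_nat ltnW// ltn_expl.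
Qed.

End LocalUniqueness.

(** * Rough paths in coordinates *)
Section MatrixBigO.
Variables (R : realType) (I : Type) (D : I -> Prop).

Definition bOm (g : I -> R) m n (M : I -> 'M[R]_(m, n)) :=
  forall i j, bO D g (fun x => M x i j).

Lemma bOm_ext g m n (M M' : I -> 'M[R]_(m, n)) : (forall x, D x -> M x = M' x) ->
  bOm g M -> bOm g M'.
Proof. by move=> e H i j; apply: bO_ext (H i j) => x Dx; rewrite e. Qed.

Lemma bOm_add g m n (M M' : I -> 'M[R]_(m, n)) : bOm g M -> bOm g M' ->
  bOm g (fun x => M x + M' x).
Proof. by move=> H H' i j; apply: bO_ext (bO_add (H i j) (H' i j)) => x _; rewrite mxE. Qed.

Lemma bOm_opp g m n (M : I -> 'M[R]_(m, n)) : bOm g M -> bOm g (fun x => - M x).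
Proof. by move=> H i j; apply: bO_ext (bO_opp (H i j)) => x _; rewrite mxE. Qed.

Lemma bOm_sub g m n (M M' : I -> 'M[R]_(m, n)) : bOm g M -> bOm g M' ->
  bOm g (fun x => M x - M' x).
Proof. by move=> H H'; apply: bOm_add => //; exact: bOm_opp. Qed.

Lemma bOm_mul g g' m n k (M : I -> 'M[R]_(m, n)) (M' : I -> 'M[R]_(n, k)) :
  bOm g M -> bOm g' M' -> bOm (fun x => g x * g' x) (fun x => M x *m M' x).
Proof.
move=> H H' i j.
apply: bO_ext (bO_sum (index_enum _) (fun l => bO_mul (H i l) (H' l j))) => x _.
by rewrite mxE.
Qed.

Lemma bOm_bmul g m n k (M : I -> 'M[R]_(m, n)) (M' : I -> 'M[R]_(n, k)) :
  bOm (fun=> 1) M -> bOm g M' -> bOm g (fun x => M x *m M' x).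
Proof.
move=> H H' i j; have [C HC] := bOm_mul H H' i j; exists C => x Dx.
by have := HC x Dx; rewrite mul1r.
Qed.

Lemma bOm_bmulr g m n k (M : I -> 'M[R]_(m, n)) (M' : I -> 'M[R]_(n, k)) :
  bOm g M -> bOm (fun=> 1) M' -> bOm g (fun x => M x *m M' x).
Proof.
move=> H H' i j; have [C HC] := bOm_mul H H' i j; exists C => x Dx.
by have := HC x Dx; rewrite mulr1.
Qed.

Lemma bOm_tr g m n (M : I -> 'M[R]_(m, n)) : bOm g M -> bOm g (fun x => (M x)^T).
Proof. by move=> H i j; apply: bO_ext (H j i) => x _; rewrite mxE. Qed.

Lemma bOm_row g m n (M : I -> 'M[R]_(m, n)) l : bOm g M -> bOm g (fun x => row l (M x)).
Proof. by move=> H i j; apply: bO_ext (H l j) => x _; rewrite mxE. Qed.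

Lemma bOm_sum g m n (J : Type) (r : seq J) (M : J -> I -> 'M[R]_(m, n)) :
  (forall l, bOm g (M l)) -> bOm g (fun x => \sum_(l <- r) M l x).
Proof.
move=> H i j; apply: bO_ext (bO_sum r (fun l => H l i j)) => x _.
by rewrite summxE.
Qed.

Lemma bOm_cst m n (M : 'M[R]_(m, n)) : bOm (fun=> 1) (fun=> M).
Proof. by move=> i j; exact: bO_cst. Qed.

Lemma bOm_le g g' m n (M : I -> 'M[R]_(m, n)) : (forall x, D x -> 0 <= g x <= g' x) ->
  bOm g M -> bOm g' M.
Proof. by move=> gg H i j; exact: bO_le gg (H i j). Qed.
End MatrixBigO.

Section Coordinates.
Variable R : realType.
Implicit Types V W : vectType R.

Definition bas V (i : 'I_(dim V)) : V := r2v (delta_mx 0 i).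

Lemma v2r_bas V i j : v2r (bas (V := V) i) 0 j = (i == j)%:R.
Proof. by rewrite r2vK mxE eqxx /= eq_sym. Qed.

Lemma bas_sum V (v : V) : v = \sum_i v2r v 0 i *: bas i.
Proof.
rewrite -{1}(v2rK v) {1}(row_sum_delta (v2r v)) linear_sum.
by apply: eq_bigr => i _; rewrite linearZ.
Qed.

Lemma v2r_lfun V W (f : 'Hom(V, W)) v : v2r (f v) = v2r v *m f2mx f.
Proof. by rewrite unlock /= r2vK. Qed.

Lemma Hom_linear V W : linear (@Hom R V W).
Proof.
move=> a M M'; apply/lfunP => v; apply: v2r_inj.
rewrite add_lfunE scale_lfunE linearP /= !v2r_lfun /=.
by rewrite mulmxDr scalemxAr.
Qed.

Lemma f2mx_linear V W : linear (@f2mx R V W).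
Proof.
by move=> a [M] [M']; rewrite -Hom_linear.
Qed.

Lemma f2mx_entry V W (f : 'Hom(V, W)) j a : f2mx f j a = v2r (f (bas j)) 0 a.
Proof. by rewrite v2r_lfun r2vK -rowE mxE. Qed.

Lemma scalar_mx m n (l : 'M[R]_(m, n) -> R) : scalar l ->
  forall A, l A = \sum_i \sum_j A i j * l (delta_mx i j).
Proof.
move=> ls A.
pose L := HB.pack_for {scalar 'M[R]_(m, n)} l (GRing.isLinear.Build _ _ _ _ l ls).
rewrite -[l]/(L : _ -> _) {1}(matrix_sum_delta A) linear_sum.
by apply: eq_bigr => i _; rewrite linear_sum; apply: eq_bigr => j _; rewrite linearZ.
Qed.

Lemma scalar_entry m n i j : scalar (fun A : 'M[R]_(m, n) => A i j).
Proof. by move=> a u w; rewrite !mxE. Qed.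

Lemma smooth_mx V m n (U : set V) (f : V -> 'M[R]_(m, n)) : vopen U ->
  (forall i j, smf U (fun x => f x i j)) -> smooth_on U f.
Proof.
move=> oU sf; apply/(smooth_onP _ oU) => k.
have ls := @scalar_coord R 'M[R]_(m, n) k.
apply: (@smf_ext _ _ _ (fun x => \sum_i \sum_j f x i j * v2r (delta_mx i j : 'M[R]_(m, n)) 0 k)) => //.
  by move=> x Ux; rewrite [RHS](scalar_mx ls).
apply: smf_sum => // i _; apply: smf_sum => // j _; apply: smf_mul => //.
exact: smf_cst.
Qed.

Lemma smooth_mx_entry V m n (U : set V) (f : V -> 'M[R]_(m, n)) i j : vopen U ->
  smooth_on U f -> smf U (fun x => f x i j).
Proof. by move=> oU sf; exact: (smooth_on_scalar oU (scalar_entry i j) sf). Qed.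

Lemma pder_mx V m n (U : set V) (f : V -> 'M[R]_(m, n)) v x i j : vopen U ->
  smooth_on U f -> U x -> pder v f x i j = ds v (fun x => f x i j) x.
Proof. by move=> oU sf Ux; exact: (pder_scalar v oU (scalar_entry i j) sf Ux). Qed.

Lemma smooth_hom V W W' (U : set V) (al : V -> 'M[R]_(dim W, dim W')) : vopen U ->
  (forall j k, smf U (fun x => al x j k)) -> smooth_on U (fun x => (Hom (al x) : 'Hom(W, W'))).
Proof.
move=> oU sf; apply/(smooth_onP _ oU) => k.
have ls : scalar (fun A : 'M[R]_(dim W, dim W') => v2r (Hom A : 'Hom(W, W')) 0 k).
  by move=> a u w; rewrite Hom_linear linearP !mxE.
apply: (@smf_ext _ _ _ (fun x => \sum_i \sum_j al x i j * v2r (Hom (delta_mx i j) : 'Hom(W, W')) 0 k)) => //.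
  by move=> x Ux; rewrite [RHS](scalar_mx ls).
apply: smf_sum => // i _; apply: smf_sum => // j _; apply: smf_mul => //.
exact: smf_cst.
Qed.

Lemma hom_scalar W W' j a : scalar (fun f : 'Hom(W, W') => f2mx f j a).
Proof. by move=> c f g; rewrite f2mx_linear !mxE. Qed.

(** The second order term of the germ of an integral: the rows of the area are
    contracted with the partial derivatives of the one-form. *)
Lemma at_tensor_pder V W W' (U : set V) (be : V -> 'Hom(V, W)) x (A : tensor V) :
  vopen U -> smooth_on U be -> U x ->
  v2r (at_tensor (fun v w => pder v be x w) A) =
  \sum_i row i A *m f2mx (pder (bas i) be x).
Proof.
move=> oU sb Ux; rewrite /at_tensor linear_sum; apply: eq_bigr => i _.
apply/rowP => a; rewrite linear_sum summxE mxE; apply: eq_bigr => j _.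
by rewrite f2mx_entry linearZ /= !mxE.
Qed.

Lemma f2mx_pder V W (U : set V) (be : V -> 'Hom(V, W)) x v j a :
  vopen U -> smooth_on U be -> U x ->
  f2mx (pder v be x) j a = ds v (fun x => f2mx (be x) j a) x.
Proof. by move=> oU sb Ux; exact: (pder_scalar v oU (@hom_scalar V W j a) sb Ux). Qed.

Lemma at_tensor_tens V W (f : 'Hom(V, W)) (A : tensor V) :
  at_tensor (fun v w => tens (f v) (f w)) A = (f2mx f)^T *m A *m f2mx f.
Proof.
apply/matrixP => k l; rewrite /at_tensor summxE !mxE.
under eq_bigr => i _ do rewrite summxE.
rewrite exchange_big /=; apply: eq_bigr => j _.
rewrite [X in _ = X * _]mxE mulr_suml; apply: eq_bigr => i _.
by rewrite !mxE big_ord1 !mxE -!f2mx_entry; ring.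
Qed.

Lemma at_tensor_tens_gen V W (f : V -> W) (A : tensor V) :
  at_tensor (fun v w => tens (f v) (f w)) A =
  (\matrix_i v2r (f (bas i)))^T *m A *m (\matrix_i v2r (f (bas i))).
Proof.
apply/matrixP => k l; rewrite /at_tensor summxE !mxE.
under eq_bigr => i _ do rewrite summxE.
rewrite exchange_big /=; apply: eq_bigr => j _.
rewrite [X in _ = X * _]mxE mulr_suml; apply: eq_bigr => i _.
by rewrite !mxE big_ord1 !mxE; ring.
Qed.

(** Two smooth extensions differ by a function which vanishes on N, and whose
    tangential derivatives vanish by [tangent_vanish]. *)
Lemma tangent_der_eq V W (N : set V) x xi (O : set V) (g f : V -> W) :
  N x -> tangent N x xi -> vopen O -> O x -> smooth_on O g ->
  (forall y, N y -> O y -> g y = f y) -> tangent_der N xi f x = pder xi g x.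
Proof.
move=> Nx tx oO Ox sg gf; rewrite /tangent_der.
case: xgetP => [v _ [U [h [oU Ux sh hf ->]]]|H].
  apply: v2r_inj; apply/rowP => j.
  rewrite (pder_coord _ _ oU sh Ux) (pder_coord _ _ oO sg Ox).
  have sh' : smf (U `&` O) (fun y => v2r (h y) 0 j).
    by apply: smf_sub ((smooth_onP _ oU).1 sh j) => y [].
  have sg' : smf (U `&` O) (fun y => v2r (g y) 0 j).
    by apply: smf_sub ((smooth_onP _ oO).1 sg j) => y [].
  have oUO := vopen_setI oU oO.
  have sgN := smf_opp oUO sg'.
  have := tangent_vanish Nx tx oUO (conj Ux Ox) (smf_add oUO sh' sgN) _.
  rewrite (dsD _ sh' sgN (conj Ux Ox)) (dsN _ oUO sg' (conj Ux Ox)) => H.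
  apply/eqP; rewrite -subr_eq0; apply/eqP; apply: H => y [Uy Oy] Ny.
  by rewrite hf// gf// subrr.
by case: (H (pder xi g x)); exists O, g.
Qed.
End Coordinates.

Section WeaklyGeometric.
Variables (R : realType) (T p : R) (omega : R -> R -> R).
Hypotheses (T0 : 0 < T) (p2 : 2 <= p) (p3 : p < 3) (Hom : control T omega).
Local Notation r := (rr p omega).
Implicit Types V W : vectType R.

Definition DS (S delta : R) (st : R * R) :=
  [/\ 0 <= st.1, st.1 <= st.2, st.2 <= S & st.2 - st.1 <= delta].
Definition g1 (st : R * R) := r st.1 st.2.
Definition g2 (st : R * R) := r st.1 st.2 ^+ 2.
Definition g3 (st : R * R) := r st.1 st.2 ^+ 3.

Lemma scalar_norm V (l : V -> R) : scalar l -> exists2 C, 0 <= C & forall v, `|l v| <= C * vnorm v.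
Proof.
move=> ls; exists (\sum_i `|l (bas i)|); first exact: sumr_ge0.
move=> v; rewrite (scalar_coordE ls) mulr_suml.
apply: le_trans (ler_norm_sum _ _ _) _; apply: ler_sum => i _.
by rewrite normrM mulrC ler_wpM2l// ler_coord_norm.
Qed.

Lemma om3 s t : omega s t `^ (3 / p) = r s t ^+ 3.
Proof. by rewrite rrX. Qed.

Lemma simeq_scalar V S (g h : R -> R -> V) : simeq p omega S g h ->
  exists2 delta, 0 < delta & forall (l : V -> R), scalar l ->
    bO (DS S delta) g3 (fun st => l (g st.1 st.2 - h st.1 st.2)).
Proof.
move=> [d [C [d0 H]]]; exists d => // l ls.
have [L L0 HL] := scalar_norm ls.
exists (L * C) => -[s t] [/= s0 st tS std].
apply: le_trans (HL _) _; rewrite -mulrA ler_wpM2l//.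
by rewrite /g3 -om3; apply: H => //; rewrite ger0_norm// subr_ge0.
Qed.

Lemma simeqI V S (g h : R -> R -> V) delta : 0 < delta ->
  (forall j, bO (DS S delta) g3 (fun st => v2r (g st.1 st.2 - h st.1 st.2) 0 j)) ->
  simeq p omega S g h.
Proof.
move=> d0 H; pose C j := sval (cid (H j)).
exists delta, (\sum_j `|C j|); split=> // s t s0 st tS std.
rewrite om3 /vnorm; apply: norm_rV_le => [|i j].
  by rewrite mulr_ge0 ?sumr_ge0// exprn_ge0// rr_ge0.
rewrite (ord1 i); apply: (@le_trans _ _ (`|C j| * r s t ^+ 3)).
  rewrite /C; case: cid => /= Cj HCj.
  apply: le_trans (HCj (s, t) _) _ => /=.
    by split=> //=; apply: le_trans std; exact: ler_norm.
  by rewrite ler_wpM2r ?exprn_ge0 ?rr_ge0// ler_norm.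
rewrite ler_wpM2r ?exprn_ge0 ?rr_ge0// (bigD1 j)//= lerDl; exact: sumr_ge0.
Qed.

Lemma simeqP_row V S (g h : R -> R -> V) : simeq p omega S g h ->
  exists2 delta, 0 < delta &
    bOm (DS S delta) g3 (fun st => v2r (g st.1 st.2) - v2r (h st.1 st.2)).
Proof.
move=> /simeq_scalar[d d0 H]; exists d => // i j.
apply: bO_ext (H _ (@scalar_coord R V j)) => st _.
by rewrite (ord1 i) linearB.
Qed.

Lemma simeqI_row V S (g h : R -> R -> V) delta : 0 < delta ->
  bOm (DS S delta) g3 (fun st => v2r (g st.1 st.2) - v2r (h st.1 st.2)) ->
  simeq p omega S g h.
Proof.
move=> d0 H; apply: (simeqI d0) => j.
by apply: bO_ext (H 0 j) => st _; rewrite linearB.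
Qed.

Lemma simeqP_mx m n S (g h : R -> R -> 'M[R]_(m, n)) : simeq p omega S g h ->
  exists2 delta, 0 < delta &
    bOm (DS S delta) g3 (fun st => g st.1 st.2 - h st.1 st.2).
Proof.
move=> /simeq_scalar[d d0 H]; exists d => // i j.
exact: (H _ (@scalar_entry R m n i j)).
Qed.

Lemma simeqI_mx m n S (g h : R -> R -> 'M[R]_(m, n)) delta : 0 < delta ->
  bOm (DS S delta) g3 (fun st => g st.1 st.2 - h st.1 st.2) ->
  simeq p omega S g h.
Proof.
move=> d0 H; apply: (simeqI d0) => k.
have ls := @scalar_coord R 'M[R]_(m, n) k.
apply: (@bO_ext _ _ _ _ (fun st => \sum_i \sum_j (g st.1 st.2 - h st.1 st.2) i j *
   v2r (delta_mx i j : 'M[R]_(m, n)) 0 k)) => [st _|].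
  by rewrite [RHS](scalar_mx ls).
apply: bO_sum => i; apply: bO_sum => j; apply: bO_bmulr; first exact: H.
exact: bO_cst.
Qed.

Lemma simeq_trans V S (g g' h : R -> R -> V) : simeq p omega S g h -> simeq p omega S g' h ->
  simeq p omega S g g'.
Proof.
move=> [d [C [d0 H]]] [d' [C' [d'0 H']]].
exists (Num.min d d'), (C + C'); split; first by rewrite lt_min d0 d'0.
move=> s t s0 st tS; rewrite le_min => /andP[std std'].
have -> : g s t - g' s t = (g s t - h s t) - (g' s t - h s t) by rewrite opprB addrA subrK.
rewrite /vnorm linearB /= mulrDl; apply: le_trans (ler_normB _ _) _.
by apply: lerD; [exact: H | exact: H'].
Qed.

Lemma DS_le S S' d d' st : S <= S' -> d <= d' -> DS S d st -> DS S' d' st.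
Proof.
move=> SS dd [s0 st' tS std]; split=> //; [exact: le_trans SS|exact: le_trans dd].
Qed.

Lemma area_ss V S (X : rpath V) s : WG p omega S X -> 0 <= s -> s <= S -> area X s s = 0.
Proof.
move=> [_ chen _ _ _] s0 sS; have := chen s s s s0 (lexx _) (lexx _) sS.
rewrite /incr subrr /tens linear0 mulmx0 addr0.
by rewrite -{1}[area X s s]addr0 => /addrI.
Qed.

Definition DD (S : R) (st : R * R) := [/\ 0 <= st.1, st.1 <= st.2 & st.2 <= S].

Lemma WG_incrO V S (X : rpath V) : WG p omega S X ->
  bOm (DD S) g1 (fun st => v2r (incr (trace X) st.1 st.2)).
Proof.
move=> [_ _ [C HC] _ _] i j; exists `|C| => -[s t] [/= s0 st tS].
rewrite (ord1 i); apply: le_trans (ler_coord_norm _ _ _) _.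
have [->|nst] := eqVneq s t.
  by rewrite /incr subrr linear0 normr0 mulr_ge0 ?rr_ge0.
apply: le_trans (HC s t s0 _ tS) _; first by rewrite lt_neqAle nst.
by rewrite /g1 /rr /= ler_wpM2r ?powR_ge0// ler_norm.
Qed.

Lemma WG_areaO V S (X : rpath V) : WG p omega S X ->
  bOm (DD S) g2 (fun st => area X st.1 st.2).
Proof.
move=> WX; have [_ _ _ [C HC] _] := WX; move=> i j.
have [L L0 HL] := scalar_norm (@scalar_entry R _ _ i j).
exists (L * `|C|) => -[s t] [/= s0 st tS].
have [e|nst] := eqVneq s t.
  by subst t; rewrite (area_ss WX)// mxE normr0 !mulr_ge0 ?exprn_ge0 ?rr_ge0.
apply: le_trans (HL _) _; rewrite -mulrA ler_wpM2l//.
apply: le_trans (HC s t s0 _ tS) _; first by rewrite lt_neqAle nst.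
by rewrite /g2 rrX ler_wpM2r ?powR_ge0// ler_norm.
Qed.

Lemma WG_sym V S (X : rpath V) s t : WG p omega S X -> 0 <= s -> s <= t -> t <= S ->
  area X s t + (area X s t)^T = tens (incr (trace X) s t) (incr (trace X) s t).
Proof.
move=> [_ _ _ _ H] s0 st tS; have := H s t s0 st tS.
by move/(congr1 (fun A => 2 *: A)); rewrite !scalerA divff ?scale1r// pnatr_eq0.
Qed.

Lemma WG_restrict V S S' (X : rpath V) : S <= S' -> WG p omega S' X -> WG p omega S X.
Proof.
move=> SS [[c1 c2] chen [C HC] [C' HC'] sym]; split.
- split.
    apply: continuous_subspaceW c1 => t /=; rewrite !in_itv /= => /andP[-> tS].
    exact: le_trans SS.
  by apply: continuous_subspaceW c2 => -[s t] [/= s0 [st tS]]; split=> //=; split=> //; exact: le_trans SS.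
- by move=> s u t s0 su ut tS; apply: chen => //; exact: le_trans SS.
- by exists C => s t s0 st tS; apply: HC => //; exact: le_trans SS.
- by exists C' => s t s0 st tS; apply: HC' => //; exact: le_trans SS.
- by move=> s t s0 st tS; apply: sym => //; exact: le_trans SS.
Qed.

Lemma incr_add V (x : R -> V) s u t : incr x s t = incr x s u + incr x u t.
Proof. by rewrite /incr [RHS]addrC addrA subrK. Qed.

Lemma trace_bounded V S (X : rpath V) (U : set V) (f : V -> R) : 0 <= S -> WG p omega S X ->
  smf U f -> (forall t, 0 <= t -> t <= S -> U (trace X t)) ->
  exists C, forall t, 0 <= t -> t <= S -> `|f (trace X t)| <= C.
Proof.
move=> S0 [[cx _] _ _ _ _] sf UX.
have cf : {within `[0, S], continuous (fun t => `|f (trace X t)|)}.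
  apply/subspace_continuousP => t /= tS.
  have /subspace_continuousP/(_ t tS) ct := cx.
  have Ut : U (trace X t) by move: tS; rewrite in_itv /= => /andP[]; exact: UX.
  have cft := differentiable_continuous (smf_diff sf Ut).
  apply: cvg_norm; rewrite (_ : (fun t => f (trace X t)) = (f \o r2v) \o (fun t => v2r (trace X t))).
    apply: (cvg_comp (fun t => v2r (trace X t)) (f \o r2v) ct).
    by move: cft; rewrite /prop_for /continuous_at /= v2rK.
  by apply/funext => s; rewrite /= v2rK.
have [c _ cmax] := EVT_max S0 cf.
by exists `|f (trace X c)| => t t0 tS; apply: cmax; rewrite in_itv /= t0.
Qed.

(** The difference of the traces is additive; once the traces agree, so is the
    difference of the areas.  Both vanish by [additive_small]. *)
Lemma simeq_eq_rpath V S (Y1 Y2 : rpath V) : S <= T -> 0 <= S ->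
  WG p omega S Y1 -> WG p omega S Y2 -> trace Y1 0 = trace Y2 0 ->
  simeq p omega S (incr (trace Y1)) (incr (trace Y2)) ->
  simeq p omega S (area Y1) (area Y2) -> eq_rpath S Y1 Y2.
Proof.
move=> ST S0 W1 W2 e0 /simeq_scalar[d d0 H] /simeqP_mx[d' d'0 H'].
have tr t : 0 <= t -> t <= S -> trace Y1 t = trace Y2 t.
  move=> t0 tS; apply: v2r_inj; apply/rowP => j.
  have [C HC] := H _ (@scalar_coord R V j).
  pose g s u := v2r (incr (trace Y1) s u - incr (trace Y2) s u) 0 j.
  have : g 0 t = 0.
    apply: (additive_small p2 p3 Hom (g := g) (delta := d) (C := C)) => //.
    - exact: le_trans ST.
    - move=> s u v _ _ _ _; rewrite /g (incr_add (trace Y1) s u v) (incr_add (trace Y2) s u v).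
      by rewrite opprD addrACA linearD mxE.
    - move=> s u s0 su uS sud; apply: (HC (s, u)); split=> //=; exact: le_trans tS.
  rewrite /g /incr e0 opprB addrA subrK linearB !mxE => /eqP.
  by rewrite subr_eq0 => /eqP.
split=> // s t s0 st tS.
apply/matrixP => i j; have [C HC] := H' i j.
pose g u v := (area Y1 u v - area Y2 u v) i j.
have : g s t = 0.
  apply: (additive_small p2 p3 Hom (g := g) (delta := d') (C := C)) => //.
  - exact: le_trans ST.
  - move=> u v w su uv vw wt.
    have u0 : 0 <= u by exact: le_trans su.
    have wS : w <= S by exact: le_trans tS.
    have v0 : 0 <= v by exact: le_trans uv. have w0 : 0 <= w by exact: le_trans vw.
    have vS : v <= S by exact: le_trans wS. have uS : u <= S by exact: le_trans vS.
    have [_ c1 _ _ _] := W1; have [_ c2 _ _ _] := W2.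
    rewrite /g (c1 u v w)// (c2 u v w)// /incr !tr// !mxE; ring.
  - move=> u v su uv vt uvd; apply: (HC (u, v)); split=> //=.
      exact: le_trans su.
    exact: le_trans tS.
by rewrite /g !mxE => /eqP; rewrite subr_eq0 => /eqP.
Qed.

End WeaklyGeometric.

(** * Parallelisms *)

(** All that the argument uses of the frame bundle: the fields [Y b] trivialize the
    tangent bundle of [N], with inverse the one-form [theta], and they have local
    smooth extensions. *)
Record parallelism (R : realType) (E V : vectType R) (N : set E) (Y : V -> E -> E)
    (theta : E -> E -> V) : Prop := Parallelism {
  par_tangent : forall u b, N u -> tangent N u (Y b u) ;
  par_Y_theta : forall u v, N u -> tangent N u v -> Y (theta u v) u = v ;
  par_theta_Y : forall u b, N u -> theta u (Y b u) = b ;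
  par_ext : forall u, N u -> exists (Oo : set E) (Yt : V -> E -> E),
    [/\ vopen Oo, Oo u, forall b, smooth_on Oo (Yt b),
        forall x, linear (fun b => Yt b x) &
        forall b x, Oo x -> N x -> Yt b x = Y b x] }.

Section Parallelism.
Variables (R : realType) (E V : vectType R) (N : set E) (Y : V -> E -> E) (theta : E -> E -> V).
Hypothesis par : parallelism N Y theta.
Local Notation n := (dim E).
Local Notation q := (dim V).

Definition Ym u : 'M[R]_(q, n) := \matrix_a v2r (Y (bas a) u).
Definition Bm (be : E -> 'Hom(E, V)) u : 'M[R]_(n, q) := f2mx (be u).
Definition DB (be : E -> 'Hom(E, V)) u i : 'M[R]_(n, q) := f2mx (pder (bas i) be u).
Definition TD u a b : 'rV[R]_n := v2r (tangent_der N (Y (bas a) u) (Y (bas b)) u).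
Definition Phi u (A : 'M[R]_q) : 'rV[R]_n := \sum_a \sum_b A a b *: TD u a b.

Lemma v2r_Y u c : N u -> v2r (Y c u) = v2r c *m Ym u.
Proof.
move=> Nu; have [Oo [Yt [_ Ou _ Yl YE]]] := par_ext par Nu.
pose L := HB.pack_for {linear V -> E} (fun b => Yt b u) (GRing.isLinear.Build _ _ _ _ _ (Yl u)).
rewrite -YE// -[Yt c u]/(L c) {1}(bas_sum c) !linear_sum mulmx_sum_row.
apply: eq_bigr => a _; rewrite !linearZ /= rowK; congr (_ *: v2r _).
exact: YE.
Qed.

Lemma YmBm (U : set E) be u : extends_form N theta U be -> N u -> Ym u *m Bm be u = 1%:M.
Proof.
move=> [_ _ _ beE] Nu; apply/row_matrixP => a.
rewrite row_mul rowK /Bm -v2r_lfun beE//; last exact: (par_tangent par).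
by rewrite (par_theta_Y par)// row1 r2vK.
Qed.

(** The derivative of the constant theta (Y_b) = b along Y_a.  The sum over the
    base directions i is the derivative of [be] along Y_a. *)
Lemma dual_derivative (U : set E) be u a b : extends_form N theta U be -> N u ->
  TD u a b *m Bm be u + \sum_i Ym u a i *: (row b (Ym u) *m DB be u i) = 0.
Proof.
move=> [oU NU sbe beE] Nu; have Uu := NU u Nu.
have [Oo [Yt [oO Ou sYt Yl YE]]] := par_ext par Nu.
have oW := vopen_setI oU oO; have Wu : (U `&` Oo) u by [].
have tY := par_tangent par (bas a) Nu.
have sB j c : smf (U `&` Oo) (fun x => f2mx (be x) j c).
  by apply: smf_sub (smooth_on_scalar oU (@hom_scalar R E V j c) sbe) => ? [].
have sY j : smf (U `&` Oo) (fun x => v2r (Yt (bas b) x) 0 j).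
  by apply: smf_sub ((smooth_onP _ oO).1 (sYt (bas b)) j) => ? [].
apply/rowP => c; rewrite [RHS]mxE.
pose f x := \sum_j v2r (Yt (bas b) x) 0 j * f2mx (be x) j c + - (v2r (bas b : V) 0 c).
have sf1 j := smf_mul oW (sY j) (sB j c).
have s1 : smf (U `&` Oo) (fun x => \sum_j v2r (Yt (bas b) x) 0 j * f2mx (be x) j c) by exact: smf_sum.
have sf : smf (U `&` Oo) f by apply: smf_add => //; exact: smf_cst.
have f0 x : (U `&` Oo) x -> N x -> f x = 0.
  move=> [Ux Ox] Nx; rewrite /f YE//.
  have := beE x (Y (bas b) x) Nx (par_tangent par _ Nx).
  rewrite (par_theta_Y par)// => e.
  by rewrite -{2}e v2r_lfun mxE subrr.
have := tangent_vanish Nu tY oW Wu sf f0.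
rewrite (dsD _ s1 (smf_cst _ oW) Wu) ds_cst addr0 (ds_sum _ _ oW sf1 Wu) => <-.
have dB j : ds (Y (bas a) u) (fun x => f2mx (be x) j c) u = \sum_i Ym u a i * DB be u i j c.
  rewrite {1}(bas_sum (Y (bas a) u)) (ds_dir_sum _ _ _ (sB j c) Wu).
  by apply: eq_bigr => i _; rewrite !mxE /DB (f2mx_pder _ _ _ oU sbe Uu).
have dY j : ds (Y (bas a) u) (fun x => v2r (Yt (bas b) x) 0 j) u = TD u a b 0 j.
  rewrite /TD (tangent_der_eq (O := Oo) (g := Yt (bas b)) Nu tY oO Ou)//.
    by rewrite (pder_coord _ _ oO (sYt _) Ou).
  by move=> y Ny Oy; exact: YE.
rewrite !mxE summxE.
transitivity (\sum_j TD u a b 0 j * Bm be u j c + \sum_j \sum_i Ym u b j * (Ym u a i * DB be u i j c)).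
  congr (_ + _); rewrite exchange_big /=; apply: eq_bigr => i _.
  rewrite !mxE mulr_sumr; apply: eq_bigr => j _; rewrite !mxE; ring.
rewrite -big_split /=; apply: eq_bigr => j _.
rewrite (dsM _ (sY j) (sB j c) Wu) dY dB YE// addrC mulr_sumr /Bm mxE.
by [].
Qed.

(** The right-hand side of the equation, inserted into the germ of the integral of
    theta, gives back the driver: the first order terms do because
    theta (Y_b) = b, and the second order terms cancel by [dual_derivative]. *)
Lemma rde_integrand (U : set E) be u (Z1 : 'rV[R]_q) (Z2 : 'M[R]_q) :
  extends_form N theta U be -> N u ->
  (Z1 *m Ym u + Phi u Z2) *m Bm be u +
  \sum_i row i ((Ym u)^T *m Z2 *m Ym u) *m DB be u i = Z1.
Proof.
move=> ebe Nu; rewrite mulmxDl -mulmxA (YmBm ebe Nu) mulmx1 -addrA.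
rewrite -[RHS]addr0; congr (_ + _).
have -> : \sum_i row i ((Ym u)^T *m Z2 *m Ym u) *m DB be u i =
   \sum_a \sum_b Z2 a b *: \sum_i Ym u a i *: (row b (Ym u) *m DB be u i).
  transitivity (\sum_i \sum_a \sum_b Z2 a b *: (Ym u a i *: (row b (Ym u) *m DB be u i))).
    apply: eq_bigr => i _.
    have -> : row i ((Ym u)^T *m Z2 *m Ym u) = \sum_a \sum_b (Z2 a b * Ym u a i) *: row b (Ym u).
      rewrite -mulmxA row_mul mulmx_sum_row; apply: eq_bigr => a _.
      rewrite row_mul mulmx_sum_row scaler_sumr; apply: eq_bigr => b _.
      by rewrite !mxE scalerA mulrC.
    rewrite mulmx_suml; apply: eq_bigr => a _; rewrite mulmx_suml; apply: eq_bigr => b _.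
    by rewrite -scalemxAl scalerA.
  rewrite exchange_big /=; apply: eq_bigr => a _.
  by rewrite exchange_big /=; apply: eq_bigr => b _; rewrite scaler_sumr.
rewrite /Phi mulmx_suml -big_split big1// => a _ /=.
rewrite mulmx_suml -big_split big1// => b _ /=.
by rewrite -scalemxAl -scalerDr (dual_derivative _ _ ebe Nu) scaler0.
Qed.

End Parallelism.

Lemma bOm_dom (R : realType) (I : Type) (D D' : I -> Prop) (g : I -> R) m n
    (M : I -> 'M[R]_(m, n)) : (forall x, D' x -> D x) -> bOm D g M -> bOm D' g M.
Proof. by move=> DD H i j; exact: bO_dom DD (H i j). Qed.

Section Integral.
Variables (R : realType) (T p : R) (omega : R -> R -> R).
Hypotheses (T0 : 0 < T) (p2 : 2 <= p) (p3 : p < 3) (Hom : control T omega).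
Local Notation r := (rr p omega).
Variables (E V : vectType R) (N : set E) (Y : V -> E -> E) (theta : E -> E -> V).
Hypothesis par : parallelism N Y theta.
Local Notation n := (dim E).
Local Notation q := (dim V).
Local Notation g1 := (g1 p omega).
Local Notation g2 := (g2 p omega).
Local Notation g3 := (g3 p omega).

Lemma bounded_along S (X : rpath E) (U : set E) (f : E -> R) d : 0 <= S -> S <= T -> WG p omega S X ->
  smf U f -> (forall t, 0 <= t -> t <= S -> U (trace X t)) ->
  bO (DS S d) (fun=> 1) (fun st => f (trace X st.1)).
Proof.
move=> S0 ST WX sf UX; have [C HC] := trace_bounded S0 WX sf UX.
exists C => -[s t] [/= s0 st tS _]; rewrite mulr1; apply: HC => //; exact: le_trans tS.
Qed.

Section Along.
Variables (S : R) (U : set E) (be : E -> 'Hom(E, V)) (X : rpath E).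
Hypotheses (S0 : 0 <= S) (ST : S <= T) (WX : WG p omega S X).
Hypotheses (oU : vopen U) (sbe : smooth_on U be).
Hypothesis UX : forall t, 0 <= t -> t <= S -> U (trace X t).

Lemma Bm_bounded d : bOm (DS S d) (fun=> 1) (fun st => Bm be (trace X st.1)).
Proof.
move=> j c; apply: (@bounded_along S X U (fun x => f2mx (be x) j c)) => //.
exact: (smooth_on_scalar oU (@hom_scalar R E V j c) sbe).
Qed.

Lemma DB_bounded d i : bOm (DS S d) (fun=> 1) (fun st => DB be (trace X st.1) i).
Proof.
move=> j c.
have sB := smooth_on_scalar oU (@hom_scalar R E V j c) sbe.
have := @bounded_along S X U _ d S0 ST WX (smf_ds (bas i) sB) UX.
apply: bO_ext => -[s t] [/= s0 st tS _]; rewrite /DB (f2mx_pder _ _ _ oU sbe)//.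
by apply: UX => //; exact: le_trans tS.
Qed.
End Along.

Lemma integrand_coord (U : set E) (be : E -> 'Hom(E, V)) x (v : E) (A : tensor E) :
  vopen U -> smooth_on U be -> U x ->
  v2r (be x v + at_tensor (fun v w => pder v be x w) A) =
  v2r v *m Bm be x + \sum_i row i A *m DB be x i.
Proof.
by move=> oU sbe Ux; rewrite linearD /= v2r_lfun (at_tensor_pder V _ oU sbe Ux).
Qed.

(** Hence the driver of an equation is an integral of theta along its solutions.
    At the second level theta (Y_a) (x) theta (Y_b) = a (x) b. *)
Lemma rde_theta S (Z : rpath V) (X : rpath E) (U : set E) be : 0 <= S -> S <= T ->
  extends_form N theta U be -> rde_solution p omega S N Y Z X ->
  simeq p omega S (incr (trace Z))
    (fun s t => be (trace X s) (incr (trace X) s t) +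
       at_tensor (fun v w => pder v be (trace X s) w) (area X s t)) /\
  simeq p omega S (area Z)
    (fun s t => at_tensor (fun v w => tens (be (trace X s) v) (be (trace X s) w)) (area X s t)).
Proof.
move=> S0 ST ebe [[WX NX _] /simeqP_row[d d0 H1] /simeqP_mx[d' d'0 H2]].
have [oU NU sbe beE] := ebe.
have UX t : 0 <= t -> t <= S -> U (trace X t) by move=> t0 tS; apply: NU; exact: NX.
have Nst st : DS S (Num.min d d') st -> N (trace X st.1).
  by case: st => s t [/= s0 st tS _]; apply: NX => //; exact: le_trans tS.
have Ust st : DS S (Num.min d d') st -> U (trace X st.1) by move=> /Nst; exact: NU.
have dd0 : 0 < Num.min d d' by rewrite lt_min d0 d'0.
pose xs (st : R * R) := trace X st.1.
pose Z1 (st : R * R) := v2r (incr (trace Z) st.1 st.2).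
pose Z2 (st : R * R) := area Z st.1 st.2.
pose rho1 st := v2r (incr (trace X) st.1 st.2) - (Z1 st *m Ym Y (xs st) + Phi N Y (xs st) (Z2 st)).
pose rho2 st := area X st.1 st.2 - (Ym Y (xs st))^T *m Z2 st *m Ym Y (xs st).
have rho1O : bOm (DS S (Num.min d d')) g3 rho1.
  apply: (@bOm_ext _ _ _ _ _ _ _ rho1 _ (bOm_dom _ H1)) => [st Dst|st]; last first.
    by apply: DS_le => //; rewrite ge_min lexx.
  rewrite /rho1 [v2r (Y _ _ + _)]linearD /= (v2r_Y par _ (Nst st Dst)); congr (_ - (_ + _)).
  rewrite /at_tensor linear_sum; apply: eq_bigr => a _; rewrite linear_sum.
  by apply: eq_bigr => b _; rewrite linearZ.
have rho2O : bOm (DS S (Num.min d d')) g3 rho2.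
  apply: (@bOm_ext _ _ _ _ _ _ _ rho2 _ (bOm_dom _ H2)) => [st Dst|st]; last first.
    by apply: DS_le => //; rewrite ge_min lexx orbT.
  by rewrite /rho2 at_tensor_tens_gen.
have BB := Bm_bounded S0 ST WX oU sbe UX (Num.min d d').
have DBB i := DB_bounded S0 ST WX oU sbe UX (Num.min d d') i.
split.
  apply: (simeqI_row dd0); apply: bOm_ext (bOm_opp (bOm_add (bOm_bmulr rho1O BB)
    (bOm_sum (index_enum _) (fun i => bOm_bmulr (bOm_row i rho2O) (DBB i))))) => st Dst.
  rewrite (integrand_coord _ _ oU sbe (Ust st Dst)).
  rewrite -/(Z1 st) -[X in _ = X - _](rde_integrand par (Z1 st) (Z2 st) ebe (Nst st Dst)).
  rewrite /rho1 /rho2 mulmxBl.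
  under eq_bigr => i _ do rewrite linearB /= mulmxBl.
  by rewrite sumrB opprD !opprB addrACA -opprD.
apply: (simeqI_mx dd0); apply: bOm_ext (bOm_opp (bOm_bmulr (bOm_bmul (bOm_tr BB) rho2O) BB)) => st Dst.
rewrite at_tensor_tens -/(Bm be (trace X st.1)) /rho2 mulmxBr mulmxBl opprB; congr (_ - _).
rewrite !mulmxA -trmx_mul -mulmxA (YmBm par ebe (Nst st Dst)).
by rewrite trmx1 mul1mx mulmx1.
Qed.
End Integral.

(** * Integrals of one-forms which depend linearly on the point *)
Section LinearForm.
Variables (R : realType) (E V : vectType R) (be : E -> 'Hom(E, V)).
Hypothesis bel : linear be.

Lemma linear_scalar_coord j : scalar (fun x => v2r (be x) 0 j).
Proof. by move=> a u w; rewrite bel linearP !mxE. Qed.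

Lemma linear_smooth : smooth_on setT be.
Proof.
apply/(smooth_onP _ (@vopen_setT R E)) => j.
by apply: smf_lin; [exact: vopen_setT | exact: linear_scalar_coord].
Qed.

Lemma linear_pder v x : pder v be x = be v.
Proof.
apply: v2r_inj; apply/rowP => j.
rewrite (pder_coord _ _ (@vopen_setT R E) linear_smooth)//.
exact: (ds_lin v x (linear_scalar_coord j)).
Qed.

Lemma Bm_linear : linear (Bm be).
Proof. by move=> a u w; rewrite /Bm bel f2mx_linear. Qed.

Lemma Bm_sum (x : E) : Bm be x = \sum_i v2r x 0 i *: Bm be (bas i).
Proof.
pose L := HB.pack_for {linear E -> 'M[R]_(dim E, dim V)} (Bm be) (GRing.isLinear.Build _ _ _ _ _ Bm_linear).
rewrite -[Bm be]/(L : _ -> _) {1}(bas_sum x) linear_sum.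
by apply: eq_bigr => i _; rewrite linearZ.
Qed.

Lemma BmD x y : Bm be (x + y) = Bm be x + Bm be y.
Proof. by have := Bm_linear 1 x y; rewrite !scale1r. Qed.
End LinearForm.

Section Continuity.
Variable R : realType.

Lemma within_continuous_mx (X : topologicalType) (A : set X) m n (M : X -> 'M[R]_(m, n)) :
  (forall i j, {within A, continuous (fun x => M x i j)}) -> {within A, continuous M}.
Proof.
move=> H.
have -> : M = fun x => \sum_i \sum_j M x i j *: (delta_mx i j : 'M[R]_(m, n)).
  by apply/funext => x; rewrite {1}(matrix_sum_delta (M x)).
have HS (J : Type) (s : seq J) (F : J -> X -> 'M[R]_(m, n)) :
   (forall j, {within A, continuous (F j)}) -> {within A, continuous (fun x => \sum_(j <- s) F j x)}.
  move=> HF; elim: s => [|j s IH].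
    have -> : (fun x => \sum_(j <- [::]) F j x) = fun=> 0 by apply/funext => x; rewrite big_nil.
    by move=> x; exact: cst_continuous.
  have -> : (fun x => \sum_(j <- j :: s) F j x) = fun x => F j x + \sum_(j <- s) F j x.
    by apply/funext => x; rewrite big_cons.
  by move=> x; apply: continuousD; [exact: HF | exact: IH].
apply: (HS _ _ (fun i x => _)) => i; apply: (HS _ _ (fun j x => _)) => j x.
by apply: continuousZl; exact: H.
Qed.

Lemma within_mono (X : topologicalType) (A : set X) (Z : topologicalType) (B : set Z)
    (pi : X -> Z) (f : Z -> R) : continuous pi -> (forall x, A x -> B (pi x)) ->
  {within B, continuous f} -> {within A, continuous (fun x => f (pi x))}.
Proof.
move=> cpi AB /subspace_continuousP cf; apply/subspace_continuousP => x Ax.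
apply: (cvg_comp pi f); last exact: cf (AB x Ax).
move=> P /= HP; have HP' : nbhs (pi x) [set z | B z -> P z] := HP.
have := cpi x _ HP'; rewrite /within /= nbhs_simpl => HQ.
change (nbhs x (fun y => A y -> P (pi y))).
by apply: (@filterS _ (nbhs x) _ (fun y => B (pi y) -> P (pi y))) HQ => y Hy Ay; apply: Hy; exact: AB.
Qed.
End Continuity.

Lemma trmxD (R : realType) m n (A B : 'M[R]_(m, n)) : (A + B)^T = A^T + B^T.
Proof. by apply/matrixP => i j; rewrite !mxE. Qed.

Lemma trmxN (R : realType) m n (A : 'M[R]_(m, n)) : (- A)^T = - A^T.
Proof. by apply/matrixP => i j; rewrite !mxE. Qed.

(* expands products of matrices, then compares entries with the products taken as
   atoms *)
Ltac zmod := rewrite ?(trmx_mul, mulmxDl, mulmxDr, mulmxBl, mulmxBr, trmxD, trmxN, mulNmx, mulmxN, mulmxA) /=;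
  repeat match goal with |- context [@mulmx ?S ?m ?n ?k ?A ?B] => move: (@mulmx S m n k A B) => ? end;
  apply/matrixP => ? ?; rewrite !mxE; ring.

Lemma chen_identity (R : realType) n q (a b : 'rV[R]_n) (B dB : 'M[R]_(n, q)) (Q Q' : 'rV[R]_q) :
  a *m B + b *m B + (Q + Q' + b *m dB) = a *m B + Q + (b *m B + b *m dB + Q').
Proof. zmod. Qed.

Lemma germ_identity (R : realType) n q (a b : 'rV[R]_n) (X X' : 'M[R]_n) (B dB : 'M[R]_(n, q))
    (Q Q' y z z' : 'rV[R]_q) : z = a *m B + Q -> z' = b *m (B + dB) + Q' ->
  B^T *m (X + X' + a^T *m b) *m B + y^T *m (z + z') - (B^T *m X *m B + y^T *m z) -
  ((B + dB)^T *m X' *m (B + dB) + (y + z)^T *m z') =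
  - (dB^T *m X' *m (B + dB) + B^T *m X' *m dB) - z^T *m (Q' + b *m dB) - Q^T *m (b *m B).
Proof. by move=> -> ->; zmod. Qed.

Lemma chen_lift (R : realType) q (I J K : 'M[R]_q) (x y z : 'rV[R]_q) :
  K - I - x^T *m (z - x) =
  (J - I - x^T *m (y - x)) + (K - J - y^T *m (z - y)) + (y - x)^T *m (z - y).
Proof. zmod. Qed.

Lemma sym_identity (R : realType) n q (a : 'rV[R]_n) (X : 'M[R]_n) (B : 'M[R]_(n, q))
    (Q y : 'rV[R]_q) (Y : 'M[R]_q) : X + X^T = a^T *m a -> y = a *m B + Q ->
  Y + Y^T - y^T *m y = (Y - B^T *m X *m B) + (Y - B^T *m X *m B)^T
    - Q^T *m y - y^T *m Q + Q^T *m Q.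
Proof.
move=> /(congr1 (fun A => B^T *m A *m B)) e ->.
have -> : Y + Y^T = (Y - B^T *m X *m B) + (Y - B^T *m X *m B)^T + B^T *m (X + X^T) *m B.
  by rewrite !trmxD !trmxN !trmx_mul trmxK; zmod.
by rewrite e; zmod.
Qed.

Lemma sym_additive (R : realType) q (X Y : 'M[R]_q) (v w : 'rV[R]_q) :
  X + Y + v^T *m w + (X + Y + v^T *m w)^T - (v + w)^T *m (v + w) =
  (X + X^T - v^T *m v) + (Y + Y^T - w^T *m w).
Proof. by rewrite !trmxD !trmx_mul trmxK; zmod. Qed.

Section Existence.
Variables (R : realType) (T p : R) (omega : R -> R -> R).
Hypotheses (T0 : 0 < T) (p2 : 2 <= p) (p3 : p < 3) (Hom : control T omega).
Local Notation r := (rr p omega).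
Local Notation g1 := (g1 p omega).
Local Notation g2 := (g2 p omega).
Local Notation g3 := (g3 p omega).

Lemma vnorm_mx m n : exists2 L, 0 <= L & forall (M : 'M[R]_(m, n)) c, 0 <= c ->
  (forall i j, `|M i j| <= c) -> vnorm M <= L * c.
Proof.
pose S k := \sum_i \sum_j `|v2r (delta_mx i j : 'M[R]_(m, n)) 0 k|.
have S0 k : 0 <= S k by apply: sumr_ge0 => i _; apply: sumr_ge0.
exists (\sum_k S k); first exact: sumr_ge0.
move=> M c c0 Mc; rewrite /vnorm; apply: norm_rV_le => [|i k].
  by rewrite mulr_ge0// sumr_ge0.
rewrite (ord1 i) {i} (scalar_mx (@scalar_coord R 'M[R]_(m, n) k)).
apply: (@le_trans _ _ (S k * c)).
  rewrite /S mulr_suml; apply: le_trans (ler_norm_sum _ _ _) _; apply: ler_sum => i _.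
  rewrite mulr_suml; apply: le_trans (ler_norm_sum _ _ _) _; apply: ler_sum => j _.
  by rewrite normrM mulrC ler_wpM2l.
rewrite ler_wpM2r// (bigD1 k)//= lerDl; exact: sumr_ge0.
Qed.

Lemma bOm_unif (I : Type) (D : I -> Prop) (g : I -> R) m n (M : I -> 'M[R]_(m, n)) :
  (forall x, D x -> 0 <= g x) -> bOm D g M ->
  exists2 C, 0 <= C & forall x, D x -> forall i j, `|M x i j| <= C * g x.
Proof.
move=> g0 H; pose C i j := sval (cid (H i j)).
exists (\sum_i \sum_j `|C i j|) => [|x Dx i j]; first by apply: sumr_ge0 => i _; apply: sumr_ge0.
apply: (@le_trans _ _ (`|C i j| * g x)).
  rewrite /C; case: cid => /= Cij HC; apply: le_trans (HC x Dx) _.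
  by rewrite ler_wpM2r ?g0// ler_norm.
rewrite ler_wpM2r ?g0// (bigD1 i)//= (bigD1 j)//= -addrA lerDl.
by apply: addr_ge0; apply: sumr_ge0 => // k _; apply: sumr_ge0.
Qed.

Lemma DD_DS st : DD T st -> DS T T st.
Proof. by move=> [s0 st' tT]; split=> //; lra. Qed.

Lemma g0 st : 0 <= g1 st. Proof. exact: rr_ge0. Qed.

Lemma bOm_lower (D : R * R -> Prop) j k m l (M : R * R -> 'M[R]_(m, l)) :
  (forall st, D st -> DD T st) -> (j <= k)%N ->
  bOm D (fun st => g1 st ^+ k) M -> bOm D (fun st => g1 st ^+ j) M.
Proof.
move=> DT jk H a b; apply: bO_mono (H a b).
exists (r 0 T ^+ (k - j)) => [|[s t] /DT[/= s0 st tT]]; first by rewrite exprn_ge0 ?rr_ge0.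
rewrite exprn_ge0 ?rr_ge0//= -{1}(subnK jk) exprD ler_wpM2r ?exprn_ge0 ?rr_ge0//.
by rewrite lerXn2r ?nnegrE ?rr_ge0//; exact: (rr_le p2 Hom).
Qed.

Variables (E V : vectType R) (be : E -> 'Hom(E, V)).
Hypothesis bel : linear be.
Variable X : rpath E.
Hypothesis WX : WG p omega T X.
Local Notation q := (dim V).
Local Notation n := (dim E).
Let x := trace X.
Let X1 s t : 'rV[R]_n := v2r (incr x s t).
Let X2 s t : 'M[R]_n := area X s t.
Let B := Bm be.

Lemma X1_add s u v : X1 s v = X1 s u + X1 u v.
Proof. by rewrite /X1 (incr_add x s u v) linearD. Qed.

Lemma X2_chen s u v : 0 <= s -> s <= u -> u <= v -> v <= T ->
  X2 s v = X2 s u + X2 u v + (X1 s u)^T *m X1 u v.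
Proof. by move=> s0 su uv vT; have [_ c _ _ _] := WX; exact: c. Qed.

(* For a form which is linear in the point the germ y1 of the first level is
   exactly additive, by Chen's relation; sewing is only needed for the second. *)
Let Q s t : 'rV[R]_q := \sum_i row i (X2 s t) *m B (bas i).
Let y1 s t : 'rV[R]_q := X1 s t *m B (x s) + Q s t.

Lemma B_incr s u : B (x u) = B (x s) + B (incr x s u).
Proof. by rewrite /B -BmD// /incr subrKC. Qed.

Lemma y1_add s u v : 0 <= s -> s <= u -> u <= v -> v <= T -> y1 s v = y1 s u + y1 u v.
Proof.
move=> s0 su uv vT; rewrite /y1 /Q (X2_chen s0 su uv vT) (X1_add s u v) (B_incr s u).
under eq_bigr => i _ do rewrite !linearD /= !mulmxDl.
rewrite !big_split /= mulmxDr mulmxDl.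
have -> : \sum_i row i ((X1 s u)^T *m X1 u v) *m B (bas i) = X1 u v *m B (incr x s u).
  rewrite {2}/B (Bm_sum bel) mulmx_sumr; apply: eq_bigr => i _.
  rewrite -scalemxAr scalemxAl; congr (_ *m _).
  by apply/rowP => j; rewrite !mxE big_ord1 !mxE.
exact: chen_identity.
Qed.

Lemma bOm_mulk (I : Type) (D : I -> Prop) (g : I -> R) a b m k l
   (M : I -> 'M[R]_(m, k)) (M' : I -> 'M[R]_(k, l)) :
  bOm D (fun x => g x ^+ a) M -> bOm D (fun x => g x ^+ b) M' ->
  bOm D (fun x => g x ^+ (a + b)) (fun x => M x *m M' x).
Proof.
move=> H H' i j; have [C HC] := bOm_mul H H' i j; exists C => y Dy.
by have := HC y Dy; rewrite exprD.
Qed.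

Lemma bOm_comp (I J : Type) (h : J -> I) (D : I -> Prop) (D' : J -> Prop) (g : I -> R) m k
   (M : I -> 'M[R]_(m, k)) : (forall y, D' y -> D (h y)) -> bOm D g M ->
  bOm D' (fun y => g (h y)) (fun y => M (h y)).
Proof. by move=> DD' H i j; have [C HC] := H i j; exists C => y /DD'; exact: HC. Qed.

Let X1O : bOm (DD T) g1 (fun st => X1 st.1 st.2) := WG_incrO WX.
Let X2O : bOm (DD T) g2 (fun st => X2 st.1 st.2) := WG_areaO WX.

Lemma BO : bOm (DD T) (fun=> 1) (fun st => B (x st.1)).
Proof.
apply: (bOm_dom (@DD_DS)).
exact: (Bm_bounded (ltW T0) (lexx T) WX (@vopen_setT R E) (linear_smooth bel)).
Qed.

Lemma QO : bOm (DD T) g2 (fun st => Q st.1 st.2).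
Proof.
by apply: bOm_sum => i; apply: bOm_bmulr; [exact: bOm_row X2O | exact: bOm_cst].
Qed.

Lemma g2_g1 m k (M : R * R -> 'M[R]_(m, k)) : bOm (DD T) g2 M -> bOm (DD T) g1 M.
Proof.
move=> H; apply: bOm_le (bOm_lower (fun _ h => h) (isT : (1 <= 2)%N) H) => st _.
by rewrite expr1 lexx andbT; exact: g0.
Qed.

Lemma y1O : bOm (DD T) g1 (fun st => y1 st.1 st.2).
Proof. by apply: bOm_add; [exact: bOm_bmulr X1O BO | exact: g2_g1 QO]. Qed.

Lemma dBO : bOm (DD T) g1 (fun st => B (incr x st.1 st.2)).
Proof.
apply: (@bOm_ext _ _ _ _ _ _ (fun st => \sum_i X1 st.1 st.2 0 i *: B (bas i))) => [st _|].
  by rewrite [RHS](Bm_sum bel).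
apply: bOm_sum => i a b.
by apply: bO_ext (bO_bmulr (X1O 0 i) (@bO_cst _ _ (DD T) (B (bas i) a b))) => st _; rewrite mxE.
Qed.

Let y t := y1 0 t.

Lemma y1E s t : 0 <= s -> s <= t -> t <= T -> y1 s t = y t - y s.
Proof. by move=> s0 st tT; rewrite /y (@y1_add 0 s t)// addrC addKr. Qed.

(* the germ of the integral of y (x) dy, whose sewing gives the second level *)
Let A s t : 'M[R]_q := (B (x s))^T *m X2 s t *m B (x s) + (y s)^T *m y1 s t.

Let D3 (i : R * (R * R)) := [/\ 0 <= i.1, i.1 <= i.2.1, i.2.1 <= i.2.2 & i.2.2 <= T].
Let g (i : R * (R * R)) := r i.1 i.2.2.

Lemma D3_su m k (j : nat) (M : R * R -> 'M[R]_(m, k)) : bOm (DD T) (fun st => g1 st ^+ j) M ->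
  bOm D3 (fun i => g i ^+ j) (fun i => M (i.1, i.2.1)).
Proof.
move=> H; have D' i : D3 i -> DD T (i.1, i.2.1).
  by move=> [? ? ? ?]; split=> //=; lra.
apply: bOm_le (bOm_comp D' H) => -[s [u v]] [/= s0 su uv vT].
rewrite exprn_ge0 ?rr_ge0//= lerXn2r ?nnegrE ?rr_ge0//.
by apply: (rr_mono p2 Hom) => //; lra.
Qed.

Lemma D3_uv m k (j : nat) (M : R * R -> 'M[R]_(m, k)) : bOm (DD T) (fun st => g1 st ^+ j) M ->
  bOm D3 (fun i => g i ^+ j) (fun i => M i.2).
Proof.
move=> H; have D' i : D3 i -> DD T i.2.
  by move=> [? ? ? ?]; split=> //=; lra.
apply: bOm_le (bOm_comp D' H) => -[s [u v]] [/= s0 su uv vT].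
rewrite exprn_ge0 ?rr_ge0//= lerXn2r ?nnegrE ?rr_ge0//.
by apply: (rr_mono p2 Hom) => //; lra.
Qed.

Lemma germ_defect s u v : 0 <= s -> s <= u -> u <= v -> v <= T ->
  A s v - A s u - A u v =
  - ((B (incr x s u))^T *m X2 u v *m (B (x s) + B (incr x s u)) + (B (x s))^T *m X2 u v *m B (incr x s u))
  - (y1 s u)^T *m (Q u v + X1 u v *m B (incr x s u))
  - (Q s u)^T *m (X1 u v *m B (x s)).
Proof.
move=> s0 su uv vT.
have v0 : 0 <= v by lra. have u0 : 0 <= u by lra.
have sv : s <= v by lra. have uT : u <= T by lra. have sT : s <= T by lra.
rewrite /A (X2_chen s0 su uv vT) (y1_add s0 su uv vT).
have -> : y u = y s + y1 s u by rewrite (y1E s0 su uT) addrC subrK.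
rewrite [B (x u)](B_incr s u); apply: germ_identity => //.
by rewrite /y1 (B_incr s u).
Qed.

Let g1X : bOm (DD T) (fun st => g1 st ^+ 1) (fun st => X1 st.1 st.2).
Proof. by apply: bOm_le X1O => st Dst; rewrite expr1 g0 lexx. Qed.
Let g1y : bOm (DD T) (fun st => g1 st ^+ 1) (fun st => y1 st.1 st.2).
Proof. by apply: bOm_le y1O => st Dst; rewrite expr1 g0 lexx. Qed.
Let g1B : bOm (DD T) (fun st => g1 st ^+ 1) (fun st => B (incr x st.1 st.2)).
Proof. by apply: bOm_le dBO => st Dst; rewrite expr1 g0 lexx. Qed.
Let g0B : bOm (DD T) (fun st => g1 st ^+ 0) (fun st => B (x st.1)) := BO.

Lemma germ_defectO :
  bOm D3 (fun i => g i ^+ 3) (fun i => A i.1 i.2.2 - A i.1 i.2.1 - A i.2.1 i.2.2).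
Proof.
have Bs : bOm D3 (fun i => g i ^+ 0) (fun i => B (x i.1)) := D3_su g0B.
have Bu : bOm D3 (fun i => g i ^+ 0) (fun i => B (x i.2.1)) := D3_uv g0B.
have dB : bOm D3 (fun i => g i ^+ 1) (fun i => B (incr x i.1 i.2.1)) := D3_su g1B.
have X2uv : bOm D3 (fun i => g i ^+ 2) (fun i => X2 i.2.1 i.2.2) := D3_uv X2O.
have X1uv : bOm D3 (fun i => g i ^+ 1) (fun i => X1 i.2.1 i.2.2) := D3_uv g1X.
have y1su : bOm D3 (fun i => g i ^+ 1) (fun i => y1 i.1 i.2.1) := D3_su g1y.
have Qsu : bOm D3 (fun i => g i ^+ 2) (fun i => Q i.1 i.2.1) := D3_su QO.
have Quv : bOm D3 (fun i => g i ^+ 2) (fun i => Q i.2.1 i.2.2) := D3_uv QO.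
have H1 := bOm_mulk (bOm_mulk (bOm_tr dB) X2uv) Bu.
have H2 := bOm_mulk (bOm_mulk (bOm_tr Bs) X2uv) dB.
have H3 := bOm_mulk (bOm_tr y1su) (bOm_add Quv (bOm_mulk X1uv dB)).
have H4 := bOm_mulk (bOm_tr Qsu) (bOm_mulk X1uv Bs).
apply: bOm_ext (bOm_sub (bOm_sub (bOm_opp (bOm_add H1 H2)) H3) H4) => -[s [u v]] [/= s0 su uv vT].
by rewrite germ_defect// -B_incr.
Qed.

(** The second level is the increment of the sewn path minus y_s (x) y_st, which
    satisfies Chen's relation by construction.  Its symmetric part differs from
    that of y_st (x) y_st / 2 by an additive function which is O(r^3), hence by 0. *)
Lemma linear_integral_exists : exists Y, is_integral p omega T be X Y.
Proof.
have HI k l : exists (I : R -> R) (C : R), 0 <= C /\ forall s t, 0 <= s -> s <= t -> t <= T ->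
    `|I t - I s - A s t k l| <= C * r s t ^+ 3.
  have [C HC] := germ_defectO k l.
  have [I HI] : exists I : R -> R, forall s t, 0 <= s -> s <= t -> t <= T ->
     `|I t - I s - A s t k l| <= maxK p * `|C| * r s t ^+ 3.
    apply: (sewing T0 p2 p3 Hom (A := fun s t => A s t k l)) => // s u v s0 su uv vT.
    have := HC (s, (u, v)) (And4 s0 su uv vT); rewrite !mxE /= => h.
    apply: le_trans h _; rewrite ler_wpM2r ?exprn_ge0 ?rr_ge0// ler_norm //.
  by exists I, (maxK p * `|C|); split => //; rewrite mulr_ge0// ltW// maxK_gt0.
pose I t : 'M[R]_q := \matrix_(k, l) (sval (cid (HI k l)) t).
have IO : bOm (DD T) (fun st => g1 st ^+ 3) (fun st => I st.2 - I st.1 - A st.1 st.2).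
  move=> k l; rewrite /I; have [C [C0 HC]] := svalP (cid (HI k l)).
  exists C => -[s t] [/= s0 st tT]; have := HC s t s0 st tT.
  by rewrite !mxE.
pose a2 s t : 'M[R]_q := I t - I s - (y s)^T *m (y t - y s).
pose Yp : rpath V := RPath (fun t => r2v (y t)) a2.
have iE s t : 0 <= s -> s <= t -> t <= T -> v2r (incr (trace Yp) s t) = y1 s t.
  by move=> s0 st tT; rewrite (y1E s0 st tT) /incr linearB /= !r2vK.
have aO : bOm (DD T) (fun st => g1 st ^+ 3)
    (fun st => a2 st.1 st.2 - (B (x st.1))^T *m X2 st.1 st.2 *m B (x st.1)).
  apply: bOm_ext IO => -[s t] [/= s0 st tT].
  by rewrite /a2 /A (y1E s0 st tT) opprD [- _ - _ in LHS]addrC addrA.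
have chen s u t : 0 <= s -> s <= u -> u <= t -> t <= T ->
    a2 s t = a2 s u + a2 u t + (y1 s u)^T *m y1 u t.
  move=> s0 su ut tT.
  have u0 : 0 <= u by exact: le_trans su.
  have uT : u <= T by exact: le_trans tT.
  by rewrite (y1E s0 su uT) (y1E u0 ut tT); exact: chen_lift.
have AO : bOm (DD T) g2 (fun st => (B (x st.1))^T *m X2 st.1 st.2 *m B (x st.1)).
  exact: bOm_mulk (bOm_mulk (bOm_tr g0B) X2O) g0B.
have a2O : bOm (DD T) g2 (fun st => a2 st.1 st.2).
  apply: bOm_ext (bOm_add (bOm_lower (fun _ h => h) (leqnSn 2) aO) AO) => st Dst.
  by rewrite subrK.
have symO : bOm (DD T) (fun st => g1 st ^+ 3) (fun st => a2 st.1 st.2 + (a2 st.1 st.2)^T -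
    (y1 st.1 st.2)^T *m y1 st.1 st.2).
  have H1 := bOm_add aO (bOm_tr aO).
  have H2 := bOm_mulk (bOm_tr QO) g1y.
  have H3 := bOm_mulk (bOm_tr g1y) QO.
  have H4 := bOm_lower (fun _ h => h) (leqnSn 3) (bOm_mulk (bOm_tr QO) QO).
  apply: bOm_ext (bOm_add (bOm_sub (bOm_sub H1 H2) H3) H4) => -[s t] [/= s0 st tT].
  by rewrite -(@sym_identity _ _ _ (X1 s t) (X2 s t) (B (x s)) (Q s t))// (WG_sym WX).
have WYp : WG p omega T Yp.
  split.
  - have cy j : {within `[0, T], continuous (fun t => y t 0 j)}.
      have [C HC] := y1O 0 j.
      apply: (rr_continuous p2 Hom (C := C)) => // s t s0 st tT.
      by have := HC (s, t) (And3 s0 st tT); rewrite /= (y1E s0 st tT) !mxE.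
    have cI k l : {within `[0, T], continuous (fun t => I t k l)}.
      have AO1 : bOm (DD T) g1 (fun st => A st.1 st.2).
        apply: bOm_add; first exact: g2_g1 AO.
        apply: bOm_bmul y1O => k' l'; have [K HK] := y1O 0 k'.
        exists (`|K| * r 0 T) => -[s t] [/= s0 st tT]; rewrite mulr1 mxE (ord1 l').
        have sT : s <= T by exact: le_trans tT.
        apply: le_trans (HK (0, s) (And3 (lexx 0) s0 sT)) _ => /=.
        apply: le_trans (ler_wpM2r (rr_ge0 _ _ _ _) (ler_norm K)) _.
        by rewrite ler_wpM2l//; exact: (rr_le p2 Hom).
      have IO1 := bOm_add (bOm_lower (fun _ h => h) (isT : (1 <= 3)%N) IO) AO1.
      have [C HC] := IO1 k l.
      apply: (rr_continuous p2 Hom (C := C)) => // s t s0 st tT.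
      by have := HC (s, t) (And3 s0 st tT); rewrite subrK /= !mxE expr1.
    split.
      apply: within_continuous_mx => i j; rewrite (ord1 i).
      have -> : (fun t => v2r (trace Yp t) 0 j) = fun t => y t 0 j.
        by apply/funext => t; rewrite /= r2vK.
      exact: cy.
    apply: within_continuous_mx => k l.
    have -> : (fun st => area Yp st.1 st.2 k l) = (fun st : R * R =>
       I st.2 k l - I st.1 k l - y st.1 0 k * (y st.2 0 l - y st.1 0 l)).
      by apply/funext => st; rewrite /= /a2 !mxE big_ord1 !mxE.
    have cfst f : {within `[0, T], continuous f} ->
        {within triangle T, continuous (fun st => f st.1 : R)}.
      move=> cf; apply: (within_mono (B := `[0, T]%classic) (pi := fst) (f := f)) => //; last first.
        by move=> st [? [? ?]]; rewrite /= in_itv /=; lra.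
      by move=> st; exact: cvg_fst.
    have csnd f : {within `[0, T], continuous f} ->
        {within triangle T, continuous (fun st => f st.2 : R)}.
      move=> cf; apply: (within_mono (B := `[0, T]%classic) (pi := snd) (f := f)) => //; last first.
        by move=> st [? [? ?]]; rewrite /= in_itv /=; lra.
      by move=> st; exact: cvg_snd.
    move=> st; apply: cvgB; first by apply: cvgB; [exact: csnd (cI k l) st|exact: cfst (cI k l) st].
    apply: cvgM; first exact: cfst (cy k) st.
    by apply: cvgB; [exact: csnd (cy l) st|exact: cfst (cy l) st].
  - move=> s u t s0 su ut tT; rewrite /= (chen s u t)// /tens !iE//; first exact: le_trans su.
    exact: le_trans tT.
  - have [C C0 HC] := bOm_unif (fun st _ => g0 st) y1O.
    exists C => s t s0 st tT; rewrite /vnorm (iE s t s0 (ltW st) tT).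
    apply: norm_rV_le => [|i j]; first by rewrite mulr_ge0// powR_ge0.
    by apply: (HC (s, t)); split=> //=; exact: ltW.
  - have [C C0 HC] := bOm_unif (fun st _ => exprn_ge0 2 (g0 st)) a2O.
    have [L L0 HL] := vnorm_mx q q.
    exists (L * C) => s t s0 st tT; rewrite -rrX -mulrA; apply: HL.
      by rewrite mulr_ge0// exprn_ge0// rr_ge0.
    by apply: (HC (s, t)); split=> //=; exact: ltW.
  - move=> s t s0 st tT; congr (_ *: _); rewrite /= /tens iE//.
    apply/eqP; rewrite -subr_eq0; apply/eqP/matrixP => k l; rewrite [RHS]mxE.
    have [C HC] := symO k l.
    apply: (additive_small p2 p3 Hom (g := fun s t => (a2 s t + (a2 s t)^T - (y1 s t)^T *m y1 s t) k l)
      (C := C) s0 st tT (ltr01)) => [a u b sa au ub bt|a b sa ab bt _]; last first.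
      by apply: (HC (a, b)); split=> //=; [exact: le_trans sa|exact: le_trans tT].
    have a0 : 0 <= a by exact: le_trans sa.
    have bT : b <= T by exact: le_trans tT.
    rewrite (chen a u b)// (y1_add a0 au ub bT).
    by rewrite sym_additive mxE.
exists Yp; split.
- split => //=; rewrite /y /y1 /X1 /Q /X2 (area_ss WX)// ?ltW// /incr subrr linear0 mul0mx add0r.
  by rewrite big1 ?linear0// => i _; rewrite row0 mul0mx.
- apply: (simeqI_row T0) => k l; exists 0 => -[s t] [/= s0 st tT _].
  rewrite mul0r (integrand_coord _ _ (@vopen_setT R E) (linear_smooth bel))//.
  rewrite iE// /y1 /Q /B /DB.
  under [X in _ - (_ + X)]eq_bigr => i _ do rewrite (linear_pder bel).
  by rewrite subrr mxE normr0.
- apply: (simeqI_mx T0); apply: bOm_ext (bOm_dom _ aO) => [[s t] _|st [? ? ? _]] //=.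
  by rewrite at_tensor_tens.
Qed.
End Existence.

(** * Rough paths on N as solutions of the equation *)
Section MixedOrders.
Variables (R : realType) (T p : R) (omega : R -> R -> R).
Hypotheses (T0 : 0 < T) (p2 : 2 <= p) (p3 : p < 3) (Hct : control T omega).
Local Notation r := (rr p omega).
Local Notation g1 := (g1 p omega).
Local Notation g2 := (g2 p omega).
Local Notation g3 := (g3 p omega).

Lemma bOm_g1 (D : R * R -> Prop) m l (M : R * R -> 'M[R]_(m, l)) :
  bOm D g1 M -> bOm D (fun st => g1 st ^+ 1) M.
Proof. by apply: bOm_le => st _; rewrite expr1 lexx andbT; exact: rr_ge0. Qed.

Section Conormal.
Variables (E : vectType R) (N : set E) (X : rpath E) (al : E -> 'Hom(E, E)).
Variable S : R.
Hypotheses (S0 : 0 <= S) (ST : S <= T).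
Hypothesis WX : WGM p omega S N X.
Hypothesis sal : smooth_on setT al.
Hypothesis al0 : forall m v, N m -> tangent N m v -> al m v = 0.
Local Notation n := (dim E).
Let x := trace X.
Let X1 st : 'rV[R]_n := v2r (incr x st.1 st.2).
Let X2 st : 'M[R]_n := area X st.1 st.2.

Lemma conormal_first (be : E -> 'Hom(E, E)) : smooth_on setT be ->
  (forall m v, N m -> tangent N m v -> be m v = 0) ->
  exists2 d, 0 < d & bOm (DS S d) g3 (fun st => X1 st *m Bm be (x st.1) +
    \sum_i row i (X2 st) *m DB be (x st.1) i).
Proof.
move=> sbe be0; have [_ _ H] := WX; have [_ /simeqP_row[d d0 H1] _] := H _ _ sbe be0.
exists d => //; apply: bOm_ext (bOm_opp H1) => st _.
by rewrite (integrand_coord _ _ (@vopen_setT R E) sbe)// /incr subrr linear0 sub0r opprK.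
Qed.

(** Integrating x^i * al as well isolates the i-th row of the area: the
    derivative of the factor x^i contributes row i X2 * al. *)
Lemma conormal_shift i : let be u := v2r u 0 i *: al u in
  [/\ smooth_on setT be, (forall m v, N m -> tangent N m v -> be m v = 0),
   (forall u, Bm be u = v2r u 0 i *: Bm al u) &
   (forall u j, DB be u j = (i == j)%:R *: Bm al u + v2r u 0 i *: DB al u j)].
Proof.
move=> be; have oT := @vopen_setT R E.
have sl := smf_lin oT (@scalar_coord R E i).
have sb : smooth_on setT be.
  apply/(smooth_onP _ oT) => j.
  apply: (smf_ext oT _ (smf_mul oT sl ((smooth_onP _ oT).1 sal j))) => u _.
  by rewrite linearZ mxE.
have eB u : Bm be u = v2r u 0 i *: Bm al u 
  by apply/matrixP => k l; rewrite mxE /Bm !f2mx_entry scale_lfunE linearZ mxE.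
split => // [m v Nm tv|u j]; first by rewrite scale_lfunE al0// scaler0.
apply/matrixP => k l; rewrite /DB (f2mx_pder _ _ _ oT sb)// !mxE (f2mx_pder _ _ _ oT sal)//.
have sa := smooth_on_scalar oT (@hom_scalar R E E k l) sal.
have -> : (fun y => f2mx (be y) k l) = fun y => v2r y 0 i * f2mx (al y) k l.
  by apply/funext => y; have := eB y; rewrite /Bm => ->; rewrite mxE.
rewrite (dsM _ sl sa)// (ds_lin _ _ (@scalar_coord R E i)) v2r_bas addrC.
by rewrite eq_sym.
Qed.

(** What the vanishing of the integrals of all forms that vanish on TN says about
    one such form al.  The second relation comes from [conormal_shift]; the third
    is its transpose, up to the symmetric part x (x) x of the area, on which al
    is small by the first relation. *)
Lemma conormal : exists2 d, 0 < d &
  [/\ bOm (DS S d) g3 (fun st => X1 st *m Bm al (x st.1) + \sum_i row i (X2 st) *m DB al (x st.1) i),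
      bOm (DS S d) g3 (fun st => X2 st *m Bm al (x st.1)) &
      bOm (DS S d) g3 (fun st => (Bm al (x st.1))^T *m X2 st)].
Proof.
have [WGX NX _] := WX.
have [d0 d00 H0] := conormal_first sal al0.
have Hi i : {d | 0 < d & bOm (DS S d) g3 (fun st => row i (X2 st) *m Bm al (x st.1))}.
  apply: cid2; have [sb b0 eB eD] := conormal_shift i.
  have [d dp H] := conormal_first sb b0; exists (Num.min d d0); first by rewrite lt_min dp.
  have DL st : DS S (Num.min d d0) st -> DS S d st by apply: DS_le => //; rewrite ge_min lexx.
  have DR st : DS S (Num.min d d0) st -> DS S d0 st by apply: DS_le => //; rewrite ge_min lexx orbT.
  have xb : bOm (DS S (Num.min d d0)) (fun=> 1) (fun st => (v2r (x st.1) 0 i)%:M : 'M[R]_1).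
    move=> k l; rewrite (ord1 k) (ord1 l).
    apply: bO_ext (@bounded_along R T p omega E S X setT _ _ S0 ST WGX
      (smf_lin (@vopen_setT R E) (@scalar_coord R E i)) _) => // st _.
    by rewrite mxE.
  apply: bOm_ext (bOm_sub (bOm_dom DL H) (bOm_bmul xb (bOm_dom DR H0))) => st _.
  rewrite eB mul_scalar_mx.
  under eq_bigr => j _ do rewrite eD mulmxDr -!scalemxAr.
  rewrite big_split /= -scaler_sumr -scalemxAr scalerDr opprD addrACA subrr add0r.
  rewrite -addrA subrr addr0 (bigD1 i)//= eqxx scale1r big1 ?addr0// => j /negPf ji.
  by rewrite eq_sym ji scale0r.
have [d1 d10 Hd] : exists2 d, 0 < d & forall i, d <= s2val (Hi i).
  exists (\big[Num.min/1]_i s2val (Hi i)) => [|i].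
    apply: (big_ind (fun c : R => 0 < c)) => // [c c' c0 c'0|i _]; last by case: (Hi i).
    by rewrite lt_min c0.
  exact: bigmin_le.
have H1 : bOm (DS S d1) g3 (fun st => X2 st *m Bm al (x st.1)).
  move=> k l; have H := s2valP' (Hi k) 0 l.
  have DL st : DS S d1 st -> DS S (s2val (Hi k)) st by apply: DS_le.
  apply: bO_ext (bO_dom DL H) => st _; rewrite !mxE; apply: eq_bigr => j _.
  by rewrite mxE.
exists (Num.min d0 d1); first by rewrite lt_min d00.
have DL st : DS S (Num.min d0 d1) st -> DS S d0 st by apply: DS_le => //; rewrite ge_min lexx.
have DR st : DS S (Num.min d0 d1) st -> DS S d1 st by apply: DS_le => //; rewrite ge_min lexx orbT.
have {}H0 := bOm_dom DL H0; have {}H1 := bOm_dom DR H1.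
split=> //.
set D := DS S (Num.min d0 d1) in H0 H1 *.
have DT st : D st -> DD T st by move=> [s0 st' tS _]; split=> //; exact: le_trans ST.
have DD' st : D st -> DD S st by move=> [].
have X1O : bOm D (fun st => g1 st ^+ 1) X1 := bOm_g1 (bOm_dom DD' (WG_incrO WGX)).
have X2O : bOm D (fun st => g1 st ^+ 2) X2 := bOm_dom DD' (WG_areaO WGX).
have DBO i : bOm D (fun=> 1) (fun st => DB al (x st.1) i).
  exact: (DB_bounded S0 ST WGX (@vopen_setT R E) sal).
have HA : bOm D (fun st => g1 st ^+ 2) (fun st => X1 st *m Bm al (x st.1)).
  have h := bOm_sum (index_enum _) (fun i => bOm_bmulr (bOm_row i X2O) (DBO i)).
  apply: bOm_ext (bOm_sub (bOm_lower p2 Hct DT (leqnSn 2) H0) h) => st _.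
  by rewrite addrK.
apply: bOm_ext (bOm_sub (bOm_mulk (bOm_tr HA) X1O) (bOm_tr H1)) => -[s t] [s0 st tS _].
have e : X2 (s, t) + (X2 (s, t))^T = (X1 (s, t))^T *m X1 (s, t) := WG_sym WGX s0 st tS.
by rewrite !trmx_mul -mulmxA -mulmxBr -e addrK.
Qed.
End Conormal.
End MixedOrders.

Section Contraction.
Variable R : realType.

(** The pairing of an area with the partial derivatives of a matrix-valued function. *)
Definition con m n k (A : 'M[R]_(n, m)) (G : 'I_n -> 'M[R]_(m, k)) : 'rV[R]_k :=
  \sum_i row i A *m G i.

Lemma conD m n k (A A' : 'M[R]_(n, m)) (G : 'I_n -> 'M[R]_(m, k)) :
  con (A + A') G = con A G + con A' G.
Proof. by rewrite /con -big_split; apply: eq_bigr => i _; rewrite linearD mulmxDl. Qed.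

Lemma conN m n k (A : 'M[R]_(n, m)) (G : 'I_n -> 'M[R]_(m, k)) : con (- A) G = - con A G.
Proof. by rewrite /con -sumrN; apply: eq_bigr => i _; rewrite linearN mulNmx. Qed.

Lemma conMl m m' n k (A : 'M[R]_(n, m)) (C : 'M[R]_(m, m')) (G : 'I_n -> 'M[R]_(m', k)) :
  con (A *m C) G = con A (fun i => C *m G i).
Proof. by apply: eq_bigr => i _; rewrite row_mul mulmxA. Qed.

Lemma conMr m n k k' (A : 'M[R]_(n, m)) (G : 'I_n -> 'M[R]_(m, k)) (C : 'M[R]_(k, k')) :
  con A (fun i => G i *m C) = con A G *m C.
Proof. by rewrite /con mulmx_suml; apply: eq_bigr => i _; rewrite mulmxA. Qed.

Lemma con_derN m n k (A : 'M[R]_(n, m)) (G G' : 'I_n -> 'M[R]_(m, k)) :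
  con A (fun i => - (G i + G' i)) = - con A G - con A G'.
Proof.
rewrite /con -opprD -big_split -sumrN; apply: eq_bigr => i _.
by rewrite mulmxN mulmxDr.
Qed.

Lemma bOm_con (I : Type) (D : I -> Prop) (g : I -> R) m n k (A : I -> 'M[R]_(n, m))
    (G : I -> 'I_n -> 'M[R]_(m, k)) : bOm D g A -> (forall i, bOm D (fun=> 1) (fun x => G x i)) ->
  bOm D g (fun x => con (A x) (G x)).
Proof. by move=> HA HG; apply: bOm_sum => i; apply: bOm_bmulr (HG i); exact: bOm_row. Qed.

(** With B the matrix of theta and Y that of the fields, 1 - B Y is the projection
    which kills the tangent space.  The remainder of the equation is a
    combination of the relations of [conormal] for this projection and of the
    remainders of the driver, seen as the integral of theta. *)
Lemma frame_equation n q (x1 : 'rV[R]_n) (x2 : 'M[R]_n) (z1 : 'rV[R]_q) (z2 : 'M[R]_q)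
    (B : 'M[R]_(n, q)) (Y : 'M[R]_(q, n)) (DB : 'I_n -> 'M[R]_(n, q)) (DY : 'I_n -> 'M[R]_(q, n)) :
  x1 - (z1 *m Y + con (Y^T *m z2) DY) =
  x1 *m (1%:M - B *m Y) + con x2 (fun i => - (DB i *m Y + B *m DY i))
  - (z1 - (x1 *m B + con x2 DB)) *m Y - con (Y^T *m (z2 - B^T *m x2 *m B)) DY
  + con ((1%:M - B *m Y)^T *m x2 *m B) DY.
Proof.
rewrite con_derN conMr -(conMl x2).
rewrite !mulmxBr !mulmxBl trmxD trmxN trmx1 !mulmxDl !mulNmx mul1mx !mulmx1 !conD !conN.
rewrite trmx_mul !mulmxA.
move: (con _ _) (con _ _) (con _ _) (con _ _) => c1 c2 c3 c4.
move: (x1 *m B *m Y) (c3 *m Y) (z1 *m Y) => a b c.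
by apply/rowP => j; rewrite !mxE; ring.
Qed.
Lemma frame_area n q (x2 : 'M[R]_n) (z2 : 'M[R]_q) (B : 'M[R]_(n, q)) (Y : 'M[R]_(q, n)) :
  (1%:M - B *m Y)^T *m x2 + Y^T *m B^T *m (x2 *m (1%:M - B *m Y)) -
  Y^T *m (z2 - B^T *m x2 *m B) *m Y = x2 - Y^T *m z2 *m Y.
Proof.
rewrite trmxD trmxN trmx1 !mulmxBr !mulmxBl ?mulmxDl ?mulNmx mul1mx !mulmx1 trmx_mul !mulmxA.
move: (Y^T *m B^T *m x2 *m B *m Y) (Y^T *m B^T *m x2) (Y^T *m z2 *m Y) => c1 c2 c3.
by apply/matrixP => i j; rewrite !mxE; ring.
Qed.
End Contraction.

Section Chart.
Variables (R : realType) (T p : R) (omega : R -> R -> R).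
Hypotheses (T0 : 0 < T) (p2 : 2 <= p) (p3 : p < 3) (Hct : control T omega).
Local Notation r := (rr p omega).
Local Notation g1 := (g1 p omega).
Local Notation g2 := (g2 p omega).
Local Notation g3 := (g3 p omega).
Variables (E V : vectType R) (N : set E) (Y : V -> E -> E) (theta : E -> E -> V).
Hypothesis par : parallelism N Y theta.
Local Notation n := (dim E).
Local Notation q := (dim V).

Variables (Oo : set E) (Yt : V -> E -> E).
Hypotheses (oO : vopen Oo) (sYt : forall b, smooth_on Oo (Yt b)).
Hypothesis YtE : forall b x, Oo x -> N x -> Yt b x = Y b x.

Let Ytm u : 'M[R]_(q, n) := \matrix_a v2r (Yt (bas a) u).
Let DY u i : 'M[R]_(q, n) := \matrix_(a, k) ds (bas i) (fun u => v2r (Yt (bas a) u) 0 k) u.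

Let sY a k : smf Oo (fun u => v2r (Yt (bas a) u) 0 k).
Proof. exact: (smooth_onP _ oO).1. Qed.

Lemma YtmE u : Oo u -> N u -> Ym Y u = Ytm u.
Proof. by move=> Ou Nu; apply/row_matrixP => a; rewrite !rowK YtE. Qed.

Lemma PhiE u A : Oo u -> N u -> Phi N Y u A = con ((Ytm u)^T *m A) (DY u).
Proof.
move=> Ou Nu.
have TDE a b : TD N Y u a b = \sum_i Ytm u a i *: row b (DY u i).
  rewrite /TD (tangent_der_eq (O := Oo) (g := Yt (bas b)) Nu (par_tangent par _ Nu) oO Ou)//; last first.
    by move=> y Ny Oy; exact: YtE.
  apply/rowP => k; rewrite (pder_coord _ _ oO (sYt _) Ou) -YtE//.
  rewrite {1}(bas_sum (Yt (bas a) u)) (ds_dir_sum _ _ _ (sY b k) Ou) summxE.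
  by apply: eq_bigr => i _; rewrite !mxE.
rewrite /Phi /con.
transitivity (\sum_a \sum_b \sum_i (A a b * Ytm u a i) *: row b (DY u i)).
  apply: eq_bigr => a _; apply: eq_bigr => b _; rewrite TDE scaler_sumr.
  by apply: eq_bigr => i _; rewrite scalerA.
under eq_bigr => a _ do rewrite exchange_big.
rewrite exchange_big; apply: eq_bigr => i _ /=.
rewrite mulmx_sum_row exchange_big; apply: eq_bigr => b _ /=.
rewrite -scaler_suml !mxE; congr (_ *: _); apply: eq_bigr => a _.
by rewrite mulrC; congr (_ * _); rewrite [RHS]mxE.
Qed.


Let D a b (st : R * R) := [/\ a <= st.1, st.1 <= st.2 & st.2 <= b].
Variable Z : rpath V.
Let Z1 (st : R * R) : 'rV[R]_q := v2r (incr (trace Z) st.1 st.2).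
Let Z2 (st : R * R) : 'M[R]_q := area Z st.1 st.2.

(** The equation at both levels, with the fields replaced by a local extension. *)
Definition chart_sol a b (X : rpath E) :=
  bOm (D a b) g3 (fun st => v2r (incr (trace X) st.1 st.2) -
    (Z1 st *m Ytm (trace X st.1) + con ((Ytm (trace X st.1))^T *m Z2 st) (DY (trace X st.1)))) /\
  bOm (D a b) g3 (fun st => area X st.1 st.2 -
    (Ytm (trace X st.1))^T *m Z2 st *m Ytm (trace X st.1)).

Lemma D_DS S a b d st : 0 <= a -> b <= S -> b - a <= d -> D a b st -> DS S d st.
Proof. by move=> a0 bS bad [h1 h2 h3]; split=> //; lra. Qed.

Lemma rde_chart_sol S X : rde_solution p omega S N Y Z X ->
  exists2 d, 0 < d & forall a b, 0 <= a -> b <= S -> b - a <= d ->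
    (forall t, a <= t -> t <= b -> Oo (trace X t)) -> chart_sol a b X.
Proof.
move=> [[WX NX _] /simeqP_row[d d0 H1] /simeqP_mx[d' d'0 H2]].
exists (Num.min d d'); first by rewrite lt_min d0 d'0.
move=> a b a0 bS; rewrite le_min => /andP[bad bad'] OX.
have Nst st : D a b st -> N (trace X st.1).
  by case: st => s t [/= as_ st tb]; apply: NX => //; lra.
have Ost st : D a b st -> Oo (trace X st.1).
  by case: st => s t [/= as_ st tb]; apply: OX => //; lra.
split.
  apply: bOm_ext (bOm_dom (fun st => @D_DS S a b d st a0 bS bad) H1) => st Dst.
  rewrite [v2r (Y _ _ + _)]linearD /= (v2r_Y par _ (Nst st Dst)) (YtmE (Ost st Dst) (Nst st Dst)).
  congr (_ - (_ + _)); rewrite -(PhiE _ (Ost st Dst) (Nst st Dst)).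
  rewrite /at_tensor linear_sum; apply: eq_bigr => i _; rewrite linear_sum.
  by apply: eq_bigr => j _; rewrite linearZ.
apply: bOm_ext (bOm_dom (fun st => @D_DS S a b d' st a0 bS bad') H2) => st Dst.
by rewrite at_tensor_tens_gen -(YtmE (Ost st Dst) (Nst st Dst)).
Qed.

Local Notation ball c rho := [set y : 'rV[R]_n | `|y - c| <= rho].

Lemma ball_boundedf (U : set E) (f : E -> R) c rho a b X : vopen U -> smf U f ->
  ball c rho `<=` v2r @` U -> (forall t, a <= t -> t <= b -> ball c rho (v2r (trace X t))) ->
  bO (D a b) (fun=> 1) (fun st => f (trace X st.1)).
Proof.
move=> oU sf KU KX; have [C HC] := ball_bounded KU sf.
exists C => -[s t] [/= as_ st tb]; have := HC _ (KX s as_ (le_trans st tb)).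
by rewrite /= v2rK.
Qed.

Lemma Ytm_bounded c rho a b X : ball c rho `<=` v2r @` Oo ->
  (forall t, a <= t -> t <= b -> ball c rho (v2r (trace X t))) ->
  bOm (D a b) (fun=> 1) (fun st => Ytm (trace X st.1)) /\
  (forall i, bOm (D a b) (fun=> 1) (fun st => DY (trace X st.1) i)).
Proof.
move=> KU KX; split=> [|i] k l.
  by apply: bO_ext (ball_boundedf oO (sY k l) KU KX) => st _; rewrite mxE.
by apply: bO_ext (ball_boundedf oO (smf_ds (bas i) (sY k l)) KU KX) => st _; rewrite mxE.
Qed.

(** A rough path on N solves the equation driven by its own integral of theta: the
    relations of [conormal] are used for al = chi * (1 - B Y), where the cut-off
    chi makes al a globally defined form.  It vanishes on tangent vectors since
    Y (theta v) = v. *)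
Lemma wgm_chart_sol S X (U : set E) be u : 0 <= S -> S <= T -> WGM p omega S N X ->
  extends_form N theta U be -> is_integral p omega S be X Z -> N u -> Oo u ->
  exists (U1 : set E) d, [/\ vopen U1, U1 u, U1 `<=` Oo & 0 < d] /\
    forall a b c rho, 0 <= a -> b <= S -> b - a <= d -> ball c rho `<=` v2r @` U1 ->
    (forall t, a <= t -> t <= b -> ball c rho (v2r (trace X t))) -> chart_sol a b X.
Proof.
move=> S0 ST WX ebe [_ /simeqP_row[d d0 H1] /simeqP_mx[d' d'0 H2]] Nu Ou.
have [oU NU sbe beE] := ebe; have [WGX NX _] := WX.
have oW := vopen_setI oO oU; have Wu : (Oo `&` U) u by split=> //; exact: NU.
have [chi [U1 [oU1 U1u U1W [chi1 chi0] sm_chi]]] := cutoff oW Wu.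
have sYW k l : smf (Oo `&` U) (fun x => Ytm x k l).
  apply: smf_sub (fun x (h : (Oo `&` U) x) => h.1) _.
  by apply: smf_ext (sY k l) => // x _; rewrite mxE.
have sBW k l : smf (Oo `&` U) (fun x => Bm be x k l).
  exact: smf_sub (fun x (h : (Oo `&` U) x) => h.2) (smooth_on_scalar oU (@hom_scalar R E V k l) sbe).
have sBY k l : smf (Oo `&` U) (fun x => \sum_j Bm be x k j * Ytm x j l).
  by apply: smf_sum => // j _; exact: smf_mul.
pose A x : 'M[R]_n := 1%:M - Bm be x *m Ytm x.
pose al x : 'Hom(E, E) := Hom (chi x *: A x).
have sA k l : smf (Oo `&` U) (fun x => A x k l).
  apply: smf_ext (smf_add oW (smf_cst ((k == l)%:R) oW) (smf_opp oW (sBY k l))) => // x _.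
  by rewrite !mxE.
have sal : smooth_on setT al.
  apply: smooth_hom; first exact: vopen_setT.
  move=> k l; apply: smf_ext (sm_chi _ (sA k l)) => [|x _]; first exact: vopen_setT.
  by rewrite [RHS]mxE.
have al0 m v : N m -> tangent N m v -> al m v = 0.
  move=> Nm tv; apply: v2r_inj; rewrite linear0 v2r_lfun /= -scalemxAr.
  have [Om|/chi0->] := pselect ((Oo `&` U) m); last by rewrite scale0r.
  rewrite mulmxBr mulmx1 mulmxA /Bm -v2r_lfun beE// -YtmE//; last by case: Om.
  by rewrite -(v2r_Y par _ Nm) (par_Y_theta par)// subrr scaler0.
have [d1 d10 [C1 C2 C3]] := conormal p2 Hct S0 ST WX sal al0.
have U1O : U1 `<=` Oo by move=> x /U1W[].
have alE x : U1 x -> Bm al x = A x by move=> Ux; rewrite /Bm /= chi1// scale1r.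
have DalE x i : U1 x -> DB al x i = - (DB be x i *m Ytm x + Bm be x *m DY x i).
  move=> Ux; apply/matrixP => k l; rewrite /DB (f2mx_pder _ _ _ (@vopen_setT R E) sal)//.
  rewrite (ds_ext (g := fun x => A x k l) _ oU1 Ux); last first.
    by move=> y Uy; have := alE y Uy; rewrite /Bm => ->.
  rewrite (ds_ext (g := fun x => (k == l)%:R + - (\sum_j Bm be x k j * Ytm x j l)) _ oU1 Ux); last first.
    by move=> y Uy; rewrite !mxE.
  have Wx := U1W x Ux.
  rewrite (dsD _ (smf_cst _ oW) (smf_opp oW (sBY k l)) Wx) ds_cst add0r (dsN _ oW (sBY k l) Wx).
  rewrite !mxE -big_split (ds_sum _ _ oW (fun j => smf_mul oW (sBW k j) (sYW j l)) Wx).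
  congr (- _); apply: eq_bigr => j _ /=; rewrite (dsM _ (sBW k j) (sYW j l) Wx) addrC.
  rewrite (f2mx_pder _ _ _ oU sbe)//; last by case: Wx.
  congr (_ + _ * _); rewrite mxE.
  by congr (_ * _); apply: (ds_ext _ oU1 Ux) => y _; rewrite mxE.
exists U1, (Num.min d1 (Num.min d d')); split; first by split=> //; rewrite !lt_min d10 d0 d'0.
move=> a b c rho a0 bS; rewrite !le_min => /and3P[bd1 bd bd'] KU KX.
have KO : ball c rho `<=` v2r @` Oo by move=> y /KU; rewrite !imv2r; exact: U1O.
have [YO DYO] := Ytm_bounded KO KX.
have U1X st : D a b st -> U1 (trace X st.1).
  case: st => s t [/= as_ st tb]; have := KU _ (KX s as_ (le_trans st tb)).
  by rewrite imv2r_in.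
have DD1 st (h : D a b st) := D_DS a0 bS bd1 h.
have DDd st (h : D a b st) := D_DS a0 bS bd h.
have DDd' st (h : D a b st) := D_DS a0 bS bd' h.
have {}C1 := bOm_dom DD1 C1; have {}C2 := bOm_dom DD1 C2; have {}C3 := bOm_dom DD1 C3.
have {}H1 := bOm_dom DDd H1; have {}H2 := bOm_dom DDd' H2.
have UX t : 0 <= t -> t <= S -> U (trace X t) by move=> t0 tS; apply: NU; exact: NX.
have BO : bOm (D a b) (fun=> 1) (fun st => Bm be (trace X st.1)).
  exact: bOm_dom DD1 (Bm_bounded S0 ST WGX oU sbe UX d1).
have {}C1 : bOm (D a b) g3 (fun st => v2r (incr (trace X) st.1 st.2) *m
    (1%:M - Bm be (trace X st.1) *m Ytm (trace X st.1)) +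
    con (area X st.1 st.2) (fun i => - (DB be (trace X st.1) i *m Ytm (trace X st.1) +
      Bm be (trace X st.1) *m DY (trace X st.1) i))).
  apply: bOm_ext C1 => st /U1X Ux; rewrite alE// /con; congr (_ + _).
  by apply: eq_bigr => i _; rewrite DalE.
have {}C2 : bOm (D a b) g3 (fun st => area X st.1 st.2 *m
    (1%:M - Bm be (trace X st.1) *m Ytm (trace X st.1))).
  by apply: bOm_ext C2 => st /U1X Ux; rewrite alE.
have {}C3 : bOm (D a b) g3 (fun st =>
    (1%:M - Bm be (trace X st.1) *m Ytm (trace X st.1))^T *m area X st.1 st.2).
  by apply: bOm_ext C3 => st /U1X Ux; rewrite alE.
have {}H1 : bOm (D a b) g3 (fun st => Z1 st -
    (v2r (incr (trace X) st.1 st.2) *m Bm be (trace X st.1) +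
     con (area X st.1 st.2) (DB be (trace X st.1)))).
  apply: bOm_ext H1 => st /U1X/U1W[_ Ux]; congr (_ - _).
  exact: (integrand_coord _ _ oU sbe Ux).
have {}H2 : bOm (D a b) g3 (fun st => Z2 st -
    (Bm be (trace X st.1))^T *m area X st.1 st.2 *m Bm be (trace X st.1)).
  by apply: bOm_ext H2 => st _; rewrite at_tensor_tens.
split.
  have K1 := bOm_bmulr H1 YO.
  have K2 := bOm_con (bOm_bmul (bOm_tr YO) H2) DYO.
  have K3 := bOm_con (bOm_bmulr C3 BO) DYO.
  apply: bOm_ext (bOm_add (bOm_sub (bOm_sub C1 K1) K2) K3) => st _.
  by rewrite [RHS](frame_equation _ (area X st.1 st.2) _ _ (Bm be (trace X st.1)) _ (DB be (trace X st.1))).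
have K1 := bOm_bmulr (bOm_bmul (bOm_tr YO) H2) YO.
have K2 := bOm_bmul (bOm_bmul (bOm_tr YO) (bOm_tr BO)) C2.
apply: bOm_ext (bOm_sub (bOm_add C3 K2) K1) => st _.
exact: frame_area.
Qed.

Lemma Ytm_euler u z1 (z2 : 'M[R]_q) k : Oo u ->
  (z1 *m Ytm u + con ((Ytm u)^T *m z2) (DY u)) 0 k =
  \sum_i z1 0 i * v2r (Yt (bas i) u) 0 k +
  \sum_i \sum_j z2 i j * F2 (fun i k y => v2r (Yt (bas i) (r2v y)) 0 k) i j k (v2r u).
Proof.
move=> Ou; rewrite mxE; congr (_ + _).
  by rewrite mxE; apply: eq_bigr => i _; rewrite !mxE.
rewrite /con summxE /F2 v2rK.
transitivity (\sum_l \sum_i \sum_j z2 i j * (Ytm u i l * DY u l j k)).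
  apply: eq_bigr => l _; rewrite mxE exchange_big /=; apply: eq_bigr => j _.
  rewrite mxE [X in X * _]mxE mulr_suml; apply: eq_bigr => i _.
  by rewrite [X in X * _ * _]mxE; ring.
rewrite exchange_big; apply: eq_bigr => i _ /=.
rewrite exchange_big; apply: eq_bigr => j _ /=.
rewrite mulr_sumr; apply: eq_bigr => l _; rewrite !mxE; congr (_ * (_ * _)).
by rewrite /ds r2vK.
Qed.

(** The traces agree by [local_uniqueness].  Then the areas have the same germ, and
    their difference is additive. *)
Lemma chart_unique a b c rho X X' : WG p omega T Z -> WG p omega b X -> WG p omega b X' ->
  0 <= a -> a < b -> b <= T ->
  ball c rho `<=` v2r @` Oo -> chart_sol a b X -> chart_sol a b X' ->
  (forall t, a <= t -> t <= b -> ball c rho (v2r (trace X t))) ->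
  (forall t, a <= t -> t <= b -> ball c rho (v2r (trace X' t))) ->
  trace X a = trace X' a ->
  exists b', [/\ a < b', b' <= b, forall t, a <= t -> t <= b' -> trace X t = trace X' t &
    forall s t, a <= s -> s <= t -> t <= b' -> area X s t = area X' s t].
Proof.
move=> WZ WX WX' a0 ab bT KO [s1 s2] [s1' s2'] KX KX' e.
have DT st : D a b st -> DD T st by move=> [h1 h2 h3]; split=> //; lra.
have OX Y' st : (forall t, a <= t -> t <= b -> ball c rho (v2r (trace Y' t))) -> D a b st ->
    Oo (trace Y' st.1).
  move=> KY; case: st => s t [/= as_ st tb]; have := KO _ (KY s as_ (le_trans st tb)).
  by rewrite imv2r_in.
pose F i k y := v2r (Yt (bas i) (r2v y)) 0 k.
have sF i k : sm (v2r @` Oo) (F i k) by exact: sY.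
pose z t i := v2r (trace Z t) 0 i.
have zO i : bO (D a b) (fun st => r st.1 st.2) (fun st => z st.2 i - z st.1 i).
  apply: bO_ext (bO_dom DT (WG_incrO WZ 0 i)) => st _.
  by rewrite /incr linearB !mxE.
have ZO i j : bO (D a b) (fun st => r st.1 st.2 * r st.1 st.2) (fun st => area Z st.1 st.2 i j).
  exact: bO_dom DT (WG_areaO WZ i j).
have Zchen s u v i j : a <= s -> s <= u -> u <= v -> v <= b ->
    area Z s v i j = area Z s u i j + area Z u v i j + (z u i - z s i) * (z v j - z u j).
  move=> as_ su uv vb; have [_ ch _ _ _] := WZ.
  rewrite (ch s u v) ?(le_trans a0)// ?(le_trans vb)// !mxE big_ord1 /incr !mxE.
  by rewrite !linearB !mxE.
have subE (A B : 'rV[R]_n) k : (A - B) 0 k = A 0 k - B 0 k by rewrite !mxE.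
have sol Y' : (forall t, a <= t -> t <= b -> ball c rho (v2r (trace Y' t))) ->
    bOm (D a b) g3 (fun st => v2r (incr (trace Y') st.1 st.2) -
    (Z1 st *m Ytm (trace Y' st.1) + con ((Ytm (trace Y' st.1))^T *m Z2 st) (DY (trace Y' st.1)))) ->
    forall k, bO (D a b) (fun st => r st.1 st.2 ^+ 3) (fun st => v2r (trace Y' st.2) 0 k -
      v2r (trace Y' st.1) 0 k - euler F z (fun s t i j => area Z s t i j) k st.1 st.2 (v2r (trace Y' st.1))).
  move=> KY H k; apply: bO_ext (H 0 k) => st Dst.
  rewrite subE (Ytm_euler _ _ _ (OX _ _ KY Dst)) /incr linearB subE.
  congr (_ - (_ + _)); apply: eq_bigr => i _; rewrite /F v2rK; congr (_ * _).
  by rewrite /Z1 /incr linearB !mxE.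
have xa : v2r (trace X a) = v2r (trace X' a) by rewrite e.
have [b' [ab' b'b H]] := local_uniqueness p2 p3 Hct oO KO sF a0 ab bT zO ZO Zchen
  (conj KX (sol X KX s1)) (conj KX' (sol X' KX' s1')) xa.
exists b'; split=> // [t at_ tb|s t as_ st tb]; first by apply: v2r_inj; exact: H.
have eX t' : a <= t' -> t' <= b' -> trace X t' = trace X' t'.
  by move=> *; apply: v2r_inj; exact: H.
apply/matrixP => i j; apply/eqP; rewrite -subr_eq0; apply/eqP.
have [C HC] := bOm_sub s2 s2' i j.
apply: (additive_small p2 p3 Hct (g := fun s t => area X s t i j - area X' s t i j) (C := C)
    _ st _ ltr01) => [||s' u v as' su' uv vt|s' u su' vt' uv _].
- lra.
- lra.
- have [_ c1 _ _ _] := WX; have [_ c2 _ _ _] := WX'.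
  have sa : a <= s' := le_trans as_ as'.
  have vb' : v <= b' := le_trans vt tb.
  have ub' : u <= b' := le_trans uv vb'; have sb' : s' <= b' := le_trans su' ub'.
  have ua : a <= u := le_trans sa su'; have va : a <= v := le_trans ua uv.
  have s0 : 0 <= s' := le_trans a0 sa; have vb : v <= b := le_trans vb' b'b.
  rewrite (c1 s' u v s0 su' uv vb) (c2 s' u v s0 su' uv vb) /incr (eX s' sa sb') (eX u ua ub').
  by rewrite (eX v va vb') !mxE; ring.
- have D' : D a b (s', u).
    by split=> //=; [exact: le_trans as_ su'|exact: le_trans (le_trans uv tb) b'b].
  have := HC (s', u) D'; rewrite /= (eX s' (le_trans as_ su')); last first.
    exact: le_trans vt' (le_trans uv tb).
  set Q := _ *m Ytm _; rewrite !mxE.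
  by move: (area X s' u i j) (area X' s' u i j) (Q i j) => x y w; rewrite opprB addrA subrK.
Qed.
End Chart.

(** * The two maps are inverse to each other *)
Section Inverse.
Variables (R : realType) (T p : R) (omega : R -> R -> R).
Hypotheses (T0 : 0 < T) (p2 : 2 <= p) (p3 : p < 3) (Hct : control T omega).
Local Notation r := (rr p omega).
Variables (E V : vectType R) (N : set E) (Y : V -> E -> E) (theta : E -> E -> V).
Hypothesis par : parallelism N Y theta.

Lemma integral_formP S (X : rpath E) Z : is_integral_form p omega S N theta X Z ->
  is_integral_form p omega S N theta X (integral_form p omega S N theta X).
Proof. by move=> H; rewrite /integral_form; case: xgetP => // /(_ Z). Qed.


Lemma simeq_restrict (W : vectType R) S S' (g h : R -> R -> W) : S <= S' ->
  simeq p omega S' g h -> simeq p omega S g h.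
Proof.
move=> SS [d [C [d0 H]]]; exists d, C; split=> // s t s0 st tS.
by apply: H => //; exact: le_trans SS.
Qed.

Lemma is_integral_restrict (F W : vectType R) S S' (al : F -> 'Hom(F, W)) X X' : S <= S' ->
  is_integral p omega S' al X X' -> is_integral p omega S al X X'.
Proof.
move=> SS [[WX X0] h1 h2]; split; first by split=> //; exact: WG_restrict WX.
- exact: simeq_restrict h1.
- exact: simeq_restrict h2.
Qed.

Lemma WGM_restrict S S' (X : rpath E) : S <= S' -> WGM p omega S' N X -> WGM p omega S N X.
Proof.
move=> SS [WX NX H]; split=> [|t t0 tS|W al sal al0]; first exact: WG_restrict WX.
- by apply: NX => //; exact: le_trans SS.
- by apply: is_integral_restrict (H W al sal al0).
Qed.

(** By [rde_theta] the driver and the integral have the same germ, for whichever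
    extension of theta the integral is computed with. *)
Lemma rde_integral S (Z : rpath V) X be : 0 <= S -> S <= T -> extends_form N theta setT be ->
  WG_from p omega T 0 Z -> rde_solution p omega S N Y Z X ->
  eq_rpath S (integral_form p omega S N theta X) Z.
Proof.
move=> S0 ST ebe [WZ Z0] sX.
have WZS : WG p omega S Z := WG_restrict ST WZ.
have [h1 h2] := rde_theta par S0 ST ebe sX.
have [U [be' [ebe' [[WI I0] i1 i2]]]] : is_integral_form p omega S N theta X
    (integral_form p omega S N theta X).
  by apply: (@integral_formP S X Z); exists setT, be.
have [h1' h2'] := rde_theta par S0 ST ebe' sX.
apply: (simeq_eq_rpath p2 p3 Hct ST S0 WI WZS); first by rewrite I0 Z0.
- exact: simeq_trans i1 h1'.
- exact: simeq_trans i2 h2'.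
Qed.

Lemma eq_rpath_le S S' (X X' : rpath E) : S <= S' -> eq_rpath S' X X' -> eq_rpath S X X'.
Proof.
move=> SS [h1 h2]; split=> [t t0 tS|s t s0 st tS]; first by apply: h1 => //; exact: le_trans SS.
by apply: h2 => //; exact: le_trans SS.
Qed.

(** r t' t tends to 0 when t' increases to t. *)
Lemma small_left (s t v C : R) : 0 <= s -> s < t -> t <= T ->
  (forall t', s <= t' -> t' < t -> `|v| <= C * r t' t) -> v = 0.
Proof.
move=> s0 st tT H; apply/eqP; rewrite -normr_le0; apply/ler_addgt0Pr => e e0; rewrite add0r.
have C0 : 0 < `|C| + 1 by rewrite ltr_wpDl.
have [d d0 Hd] := rr_unif p2 Hct (divr_gt0 e0 C0).
pose t' := Num.max s (t - d).
have st' : s <= t' by rewrite le_max lexx.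
have t't : t' < t by rewrite gt_max st /=; lra.
have dt : t - d <= t' by rewrite le_max lexx orbT.
apply: le_trans (H t' st' t't) _.
have t'0 : 0 <= t' := le_trans s0 st'.
have h : r t' t <= e / (`|C| + 1) by apply: Hd => //; [exact: ltW|lra].
apply: (@le_trans _ _ ((`|C| + 1) * r t' t)).
  by rewrite ler_wpM2r ?rr_ge0// (le_trans (ler_norm C))// lerDl.
by rewrite mulrC -ler_pdivlMr.
Qed.

Lemma eq_rpath_left t (X X' : rpath E) : 0 < t -> t <= T -> WG p omega t X -> WG p omega t X' ->
  (forall t', 0 <= t' -> t' < t -> eq_rpath t' X X') -> eq_rpath t X X'.
Proof.
move=> t0 tT WX WX' H.
have D' : forall st, DD t st -> DD T st by move=> st [h1 h2 h3]; split=> //; exact: le_trans tT.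
have et : trace X t = trace X' t.
  apply: v2r_inj; apply/rowP => j; apply/eqP; rewrite -subr_eq0; apply/eqP.
  have [C HC] := WG_incrO WX 0 j; have [C' HC'] := WG_incrO WX' 0 j.
  apply: (small_left (lexx 0) t0 tT (C := C + C')) => t' t'0 t't.
  have D1 : DD t (t', t) by split=> //=; exact: ltW.
  have [e _] := H t' t'0 t't.
  have := lerD (HC _ D1) (HC' _ D1); rewrite -mulrDl /g1 /=; apply: le_trans.
  apply: le_trans (ler_normB _ _).
  by rewrite /incr (e t' t'0 (lexx _)) !linearB !mxE opprB addrA subrK.
have etr s : 0 <= s -> s <= t -> trace X s = trace X' s.
  rewrite [s <= t]le_eqVlt => s0 /orP[/eqP->//|st]; have [e _] := H s s0 st; exact: e.
split=> // s u s0 su; rewrite le_eqVlt => /orP[/eqP eu|ut]; last first.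
  by have [_ e] := H u (le_trans s0 su) ut; exact: e.
subst u; move: su; rewrite le_eqVlt => /orP[/eqP eu|st].
  by subst s; rewrite (area_ss WX (ltW t0) (lexx _)) (area_ss WX' (ltW t0) (lexx _)).
apply/matrixP => i j; apply/eqP; rewrite -subr_eq0; apply/eqP.
have [C HC] := bOm_lower p2 Hct D' (isT : (1 <= 2)%N) (WG_areaO WX) i j.
have [C' HC'] := bOm_lower p2 Hct D' (isT : (1 <= 2)%N) (WG_areaO WX') i j.
apply: (small_left s0 st tT (C := C + C')) => t' st' t't.
have t'0 : 0 <= t' := le_trans s0 st'.
have D1 : DD t (t', t) by split=> //=; exact: ltW.
have := lerD (HC _ D1) (HC' _ D1); rewrite -mulrDl expr1 /g1 /=; apply: le_trans.
apply: le_trans (ler_normB _ _).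
have [_ c1 _ _ _] := WX; have [_ c2 _ _ _] := WX'; have [_ e] := H t' t'0 t't.
rewrite (c1 s t' t s0 st' (ltW t't) (lexx t)) (c2 s t' t s0 st' (ltW t't) (lexx t)).
rewrite (e s t' s0 st' (lexx _)) /incr et !etr//; [|exact: ltW|exact: ltW].
rewrite !mxE; set y := (X in `|X|); set y' := (X in _ <= `|X|).
by have -> : y = y' by rewrite /y /y'; ring.
Qed.

Lemma stay_close S t (X : rpath E) rho : 0 <= t -> t <= S -> S <= T -> WG p omega S X -> 0 < rho ->
  exists2 d, 0 < d & forall t', t <= t' -> t' <= S -> t' - t <= d ->
    `|v2r (trace X t') - v2r (trace X t)| <= rho.
Proof.
move=> t0 tS ST WX rho0; have [C C0 HC] := bOm_unif (fun st _ => rr_ge0 p omega st.1 st.2) (WG_incrO WX).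
have C1 : 0 < C + 1 by rewrite ltr_wpDl.
have [d d0 Hd] := rr_unif p2 Hct (divr_gt0 rho0 C1).
exists d => // t' tt' t'S t'd.
rewrite -linearB; apply: norm_rV_le => [|i j]; first exact: ltW.
apply: le_trans (HC (t, t') (And3 t0 tt' t'S) i j) _.
have h : r t t' <= rho / (C + 1) by apply: Hd => //; exact: le_trans ST.
apply: (@le_trans _ _ ((C + 1) * r t t')); first by rewrite ler_wpM2r ?rr_ge0// lerDl.
by rewrite mulrC -ler_pdivlMr.
Qed.

(** Past t both paths stay for a while in a ball around their common position, and
    solve there the same equation. *)
Lemma eq_rpath_extend S t (X X' : rpath E) Z (U : set E) be : 0 <= t -> t < S -> S <= T ->
  WGM p omega S N X -> WG p omega T Z -> extends_form N theta U be ->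
  is_integral p omega S be X Z -> rde_solution p omega S N Y Z X' -> eq_rpath t X X' ->
  exists b, [/\ t < b, b <= S & eq_rpath b X X'].
Proof.
move=> t0 tS ST WMX WZ ebe iX sX' [e1 e2].
have S0 : 0 <= S := le_trans t0 (ltW tS).
have [WX NX _] := WMX; have [[WX' NX' _] _ _] := sX'.
pose u := trace X t; have Nu : N u by apply: NX => //; exact: ltW.
have [Oo [Yt [oO Ou sYt Yl YtE]]] := par_ext par Nu.
have [U1 [d1 [[oU1 U1u U1O d10] H1]]] :=
  wgm_chart_sol p2 Hct par oO sYt YtE S0 ST WMX ebe iX Nu Ou.
have [d2 d20 H2] := rde_chart_sol par oO sYt YtE sX'.
have [rho rho0 Hrho] : exists2 rho, 0 < rho & [set y : 'rV[R]_(dim E) | `|y - v2r u| <= rho] `<=` v2r @` U1.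
  have Uu : (v2r @` U1) (v2r u) by rewrite imv2r_in.
  have /nbhs_normP[e e0 He] := open_nbhs_nbhs (conj oU1 Uu).
  exists (e / 2) => [|y /= ye]; first by rewrite divr_gt0.
  have yr : `|v2r u - y| < e.
    by rewrite distrC; apply: (le_lt_trans ye); rewrite ltr_pdivrMr// mulr_natr mulr2n ltrDl.
  exact: He y yr.
have [d3 d30 H3] := stay_close t0 (ltW tS) ST WX rho0.
have [d4 d40 H4] := stay_close t0 (ltW tS) ST WX' rho0.
pose d := Num.min (Num.min d1 d2) (Num.min d3 d4).
have d0 : 0 < d by rewrite !lt_min d10 d20 d30.
have [dd1 dd2 dd3 dd4] : [/\ d <= d1, d <= d2, d <= d3 & d <= d4].
  by rewrite /d !ge_min !lexx !orbT.
pose b := Num.min S (t + d).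
have tb : t < b by rewrite lt_min tS /= ltrDl.
have bS : b <= S by rewrite ge_min lexx.
have bt : b - t <= d by rewrite lerBlDl ge_min lexx orbT.
have K3 t' : t <= t' -> t' <= b -> `|v2r (trace X t') - v2r u| <= rho.
  move=> tt' t'b; apply: H3 => //; first exact: le_trans bS.
  by apply: le_trans dd3; apply: le_trans bt; rewrite lerD2r.
have K4 t' : t <= t' -> t' <= b -> `|v2r (trace X' t') - v2r u| <= rho.
  move=> tt' t'b; rewrite /u (e1 t t0 (lexx t)); apply: H4 => //; first exact: le_trans bS.
  by apply: le_trans dd4; apply: le_trans bt; rewrite lerD2r.
have KO : [set y : 'rV[R]_(dim E) | `|y - v2r u| <= rho] `<=` v2r @` Oo.
  by move=> y /Hrho; rewrite !imv2r; exact: U1O.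
have C1 := H1 t b _ _ t0 bS (le_trans bt dd1) Hrho K3.
have C2 : chart_sol p omega Yt Z t b X'.
  apply: H2 => // [|t' tt' t'b]; first exact: le_trans dd2.
  by have := KO _ (K4 t' tt' t'b); rewrite imv2r_in.
have [b' [tb' b'b h1 h2]] := chart_unique p2 p3 Hct oO sYt WZ (WG_restrict bS WX) (WG_restrict bS WX')
  t0 tb (le_trans bS ST) KO C1 C2 K3 K4 (e1 t t0 (lexx t)).
exists b'; split=> //; first exact: le_trans bS.
have et s : 0 <= s -> s <= b' -> trace X s = trace X' s.
  by move=> s0 sb; have [st|ts] := leP s t; [exact: e1 | apply: h1 => //; exact: ltW].
split=> // s v s0 sv vb.
have [vt|tv] := leP v t; first exact: e2.
have [ts|st] := leP t s; first exact: h2.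
have [_ c1 _ _ _] := WX; have [_ c2 _ _ _] := WX'.
have vS : v <= S := le_trans (le_trans vb b'b) bS.
rewrite (c1 s t v s0 (ltW st) (ltW tv) vS) (c2 s t v s0 (ltW st) (ltW tv) vS).
rewrite (e2 s t s0 (ltW st) (lexx t)) (h2 t v (lexx t) (ltW tv) vb).
by rewrite /incr (e1 s s0 (ltW st)) (e1 t t0 (lexx t)) (et v (le_trans s0 sv) vb).
Qed.

(** The times up to which the two paths agree form an interval, closed by
    [eq_rpath_left] and open by [eq_rpath_extend]. *)
Lemma integral_rde S (X X' : rpath E) Z (U : set E) be : 0 <= S -> S <= T ->
  WGM p omega S N X -> WG p omega T Z -> extends_form N theta U be ->
  is_integral p omega S be X Z -> rde_solution p omega S N Y Z X' -> trace X 0 = trace X' 0 ->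
  eq_rpath S X X'.
Proof.
move=> S0 ST WMX WZ ebe iX sX' e0.
have [WX NX _] := WMX; have [[WX' NX' _] _ _] := sX'.
pose G : set R := [set t | [/\ 0 <= t, t <= S & eq_rpath t X X']].
have G0 : G 0.
  split=> //; split=> [t t0 t0'|s t s0 st t0].
    by have -> : t = 0 by apply/eqP; rewrite eq_le t0 t0'.
  have t0' : 0 <= t := le_trans s0 st.
  have et : t = 0 by apply/eqP; rewrite eq_le t0 t0'.
  have es : s = 0 by apply/eqP; rewrite eq_le s0 (le_trans st).
  by subst t s; rewrite (area_ss WX (lexx _) S0) (area_ss WX' (lexx _) S0).
have Gs : has_sup G by split; [exists 0 | exists S => t []].
have G1 := sup_upper_bound Gs.
have t0 : 0 <= sup G := G1 0 G0.
have tS : sup G <= S by apply: ge_sup; [exists 0 | move=> t []].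
have eG : eq_rpath (sup G) X X'.
  have [t00|nt0] := eqVneq (sup G) 0; first by rewrite t00; case: G0.
  apply: eq_rpath_left.
  - by rewrite lt_neqAle eq_sym nt0.
  - exact: le_trans ST.
  - exact: WG_restrict WX.
  - exact: WG_restrict WX'.
  - move=> t' t'0 t't; have [|g [_ _ Gg]] := @sup_adherent R G (sup G - t') _ Gs; first by rewrite subr_gt0.
    rewrite opprB addrC subrK => /ltW tg.
    exact: eq_rpath_le Gg.
move: tS; rewrite le_eqVlt => /orP[/eqP<-//|tS].
have [b [tb bS eb]] := eq_rpath_extend t0 tS ST WMX WZ ebe iX sX' eG.
have : b <= sup G by apply: G1; split=> //; exact: le_trans (ltW tb).
by rewrite leNgt tb.
Qed.

Lemma integral_formE (X : rpath E) be : linear be -> extends_form N theta setT be ->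
  WGM p omega T N X ->
  is_integral_form p omega T N theta X (integral_form p omega T N theta X) /\
  WG_from p omega T 0 (integral_form p omega T N theta X).
Proof.
move=> bel ebe [WX NX _].
have [Z HZ] := linear_integral_exists T0 p2 p3 Hct bel WX.
have H : is_integral_form p omega T N theta X (integral_form p omega T N theta X).
  by apply: (@integral_formP T X Z); exists setT, be.
by split=> //; have [U [be' [_ []]]] := H.
Qed.

(** The theorem for an arbitrary parallelism.  The one-form [be], linear in the
    point, provides the existence of the integral. *)
Theorem parallelism_inverse (uo : E) be : linear be -> extends_form N theta setT be ->
  [/\ (forall U, WGM_from p omega T N uo U ->
         is_integral_form p omega T N theta U (integral_form p omega T N theta U) /\
         WG_from p omega T 0 (integral_form p omega T N theta U)),
      (forall (Z : rpath V) U (tau : \bar R),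
         WG_from p omega T 0 Z ->
         rde_solution_until p omega T N Y Z uo U tau ->
         forall S : R, 0 <= S -> S <= T -> (S%:E < tau)%E ->
           eq_rpath S (integral_form p omega S N theta U) Z) &
      (forall U W (tau : \bar R), WGM_from p omega T N uo U ->
         rde_solution_until p omega T N Y (integral_form p omega T N theta U) uo W tau ->
         forall S : R, 0 <= S -> S <= T -> (S%:E < tau)%E ->
           eq_rpath S U W)].
Proof.
move=> bel ebe; split=> [U [WU _]|Z U tau WZ [_ _ H _] S S0 ST Stau|U W tau [WU U0] [_ W0 H _] S S0 ST Stau].
- exact: (integral_formE bel ebe).
- exact: (rde_integral S0 ST ebe WZ (H S S0 ST Stau)).
have [[U' [be' [ebe' iZ]]] [WZ _]] := integral_formE bel ebe WU.
have sW := H S S0 ST Stau.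
apply: (integral_rde S0 ST (WGM_restrict ST WU) WZ ebe' (is_integral_restrict ST iZ) sW).
by rewrite U0 W0.
Qed.
End Inverse.

(** * Gram matrices, matrix-valued functions and zero sets *)
Section Gram.
Variable R : realType.

Lemma row_sq0 n (w : 'rV[R]_n) : w *m w^T = 0 -> w = 0.
Proof.
move=> /matrixP/(_ 0 0); rewrite !mxE => H.
apply/rowP => j; rewrite mxE; apply/eqP; rewrite -sqrf_eq0 expr2.
have /psumr_eq0P : \sum_j w 0 j * w 0 j = 0.
  by rewrite -[RHS]H; apply: eq_bigr => i _; rewrite [w^T _ _]mxE.
by move=> /(_ (fun i _ => sqr_ge0 (w 0 i)))/(_ j isT) ->.
Qed.

(** A^T is injective when A is onto, and u A A^T = 0 implies |u A|^2 = 0. *)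
Lemma gram_unit k n (A : 'M[R]_(k, n)) : (forall w : 'cV_k, exists v, A *m v = w) ->
  A *m A^T \in unitmx.
Proof.
move=> sA; rewrite -row_free_unit -kermx_eq0; apply/eqP/row_matrixP => i; rewrite row0.
have /(congr1 (row i)) := mulmx_ker (A *m A^T).
rewrite row_mul row0; move: (row i _) => u uA.
have uA0 : u *m A = 0.
  by apply: row_sq0; rewrite trmx_mul mulmxA -(mulmxA u) uA mul0mx.
have [v Av] := sA u^T.
by apply: row_sq0; rewrite -Av mulmxA uA0 mul0mx.
Qed.

Lemma gram_surj k n (A : 'M[R]_(k, n)) (w : 'cV_k) : A *m A^T \in unitmx -> exists v, A *m v = w.
Proof.
by move=> uA; exists (A^T *m (invmx (A *m A^T) *m w)); rewrite !mulmxA mulmxV// mul1mx.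
Qed.

(** The columns of g and of J^T are orthogonal to each other and N in number, hence
    they span; the two sides agree on both. *)
Lemma frame_complement N d k (J : 'M[R]_(k, N)) (g : 'M[R]_(N, d)) : N = (d + k)%N ->
  J *m J^T \in unitmx -> J *m g = 0 -> g^T *m g = 1%:M ->
  g *m g^T = 1%:M - J^T *m invmx (J *m J^T) *m J.
Proof.
move=> eN uJ Jg gg.
pose A := 1%:M - J^T *m invmx (J *m J^T) *m J - g *m g^T.
have gJ : g^T *m J^T = 0 by rewrite -trmx_mul Jg trmx0.
have A0 : A *m row_mx g J^T = 0.
  rewrite mul_mx_row /A !mulmxBl !mul1mx -!mulmxA Jg gg gJ mulVmx// !mulmx0 !mulmx1.
  by rewrite !subr0 !subrr row_mx0.
have fS : row_free (row_mx g J^T).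
  rewrite /row_free eqn_leq rank_leq_row /= [X in (X <= _)%N]eN.
  have /mulmx1_min_rank : (block_mx 1%:M 0 0 (invmx (J *m J^T)) *m (row_mx g J^T)^T) *m row_mx g J^T = 1%:M.
    rewrite tr_row_mx trmxK -mulmxA mul_col_row gg gJ Jg mulmx_block.
    by rewrite !mul0mx !mulmx0 !addr0 !add0r mul1mx mulVmx// -scalar_mx_block.
  by rewrite mxrank_tr.
have : A = 0 by apply: (row_free_inj fS); rewrite A0 mul0mx.
by move/eqP; rewrite /A subr_eq0 => /eqP.
Qed.
End Gram.

Section SmoothMatrices.
Variables (R : realType) (V : vectType R) (U : set V).
Hypothesis oU : vopen U.

Definition smm m n (A : V -> 'M[R]_(m, n)) := forall i j, smf U (fun x => A x i j).
Definition dm m n (v : V) (A : V -> 'M[R]_(m, n)) x : 'M[R]_(m, n) :=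
  \matrix_(i, j) ds v (fun x => A x i j) x.

Lemma smm_cst m n (A : 'M[R]_(m, n)) : smm (fun=> A).
Proof. by move=> i j; exact: smf_cst. Qed.

Lemma smm_add m n (A B : V -> 'M[R]_(m, n)) : smm A -> smm B -> smm (fun x => A x + B x).
Proof. by move=> sA sB i j; apply: smf_ext (smf_add oU (sA i j) (sB i j)) => // x _; rewrite mxE. Qed.

Lemma smm_opp m n (A : V -> 'M[R]_(m, n)) : smm A -> smm (fun x => - A x).
Proof. by move=> sA i j; apply: smf_ext (smf_opp oU (sA i j)) => // x _; rewrite mxE. Qed.

Lemma smm_mul m n k (A : V -> 'M[R]_(m, n)) (B : V -> 'M[R]_(n, k)) : smm A -> smm B ->
  smm (fun x => A x *m B x).
Proof.
move=> sA sB i j; apply: smf_ext (smf_sum (index_enum _) oU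
  (fun l (_ : true) => smf_mul oU (sA i l) (sB l j))) => // x _.
by rewrite mxE.
Qed.

Lemma smm_tr m n (A : V -> 'M[R]_(m, n)) : smm A -> smm (fun x => (A x)^T).
Proof. by move=> sA i j; apply: smf_ext (sA j i) => // x _; rewrite mxE. Qed.

Lemma smf_det n (A : V -> 'M[R]_n) : smm A -> smf U (fun x => \det (A x)).
Proof.
move=> sA; apply: smf_sum => // s _; apply: smf_mul => //; first exact: smf_cst.
by apply: smf_prod => // i _; exact: sA.
Qed.

Lemma smm_inv n (A : V -> 'M[R]_n) : (forall x, U x -> A x \in unitmx) -> smm A ->
  smm (fun x => invmx (A x)).
Proof.
move=> uA sA i j.
have sd : smf U (fun x => (\det (A x))^-1).
  apply: smf_inv => // [x /uA|]; last exact: smf_det.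
  by rewrite unitmxE unitfE.
have sc : smf U (fun x => cofactor (A x) j i).
  apply: smf_mul => //; first exact: smf_cst.
  apply: smf_det => k l.
  by apply: smf_ext (sA (lift j k) (lift i l)) => // x _; rewrite !mxE.
apply: smf_ext (smf_mul oU sd sc) => // x Ux.
by rewrite /invmx (uA x Ux) !mxE.
Qed.

Lemma dm_ext m n v (A A' : V -> 'M[R]_(m, n)) x : U x -> (forall y, U y -> A y = A' y) ->
  dm v A x = dm v A' x.
Proof.
by move=> Ux e; apply/matrixP => i j; rewrite !mxE; apply: (ds_ext _ oU Ux) => y Uy; rewrite e.
Qed.

Lemma dm_add m n v (A B : V -> 'M[R]_(m, n)) x : smm A -> smm B -> U x ->
  dm v (fun x => A x + B x) x = dm v A x + dm v B x.
Proof.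
move=> sA sB Ux; apply/matrixP => i j; rewrite !mxE -(dsD _ (sA i j) (sB i j) Ux).
by apply: (ds_ext _ oU Ux) => y _; rewrite mxE.
Qed.

Lemma dm_cst m n v (A : 'M[R]_(m, n)) x : dm v (fun=> A) x = 0.
Proof. by apply/matrixP => i j; rewrite !mxE ds_cst. Qed.

Lemma dm_tr m n v (A : V -> 'M[R]_(m, n)) x : dm v (fun x => (A x)^T) x = (dm v A x)^T.
Proof.
apply/matrixP => i j; rewrite !mxE; congr (ds _ _ _).
by apply/funext => y; rewrite mxE.
Qed.

Lemma dm_mul m n k v (A : V -> 'M[R]_(m, n)) (B : V -> 'M[R]_(n, k)) x : smm A -> smm B -> U x ->
  dm v (fun x => A x *m B x) x = dm v A x *m B x + A x *m dm v B x.
Proof.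
move=> sA sB Ux; apply/matrixP => i j; rewrite [LHS]mxE.
have sAB l := smf_mul oU (sA i l) (sB l j).
rewrite (ds_ext (g := fun x => \sum_l A x i l * B x l j) _ oU Ux) => [|y _]; last by rewrite mxE.
rewrite (ds_sum _ _ oU sAB Ux) !mxE -big_split; apply: eq_bigr => l _ /=.
by rewrite (dsM _ (sA i l) (sB l j) Ux) !mxE addrC.
Qed.

Lemma smm_dm m n v (A : V -> 'M[R]_(m, n)) : smm A -> smm (dm v A).
Proof. by move=> sA i j; apply: smf_ext (smf_ds v (sA i j)) => // x _; rewrite mxE. Qed.
End SmoothMatrices.

Section ZeroSet.
Variables (R : realType) (V : vectType R) (N : set V) (m : V) (U : set V).
Variables (I : finType) (f : I -> V -> R).
Hypotheses (oU : vopen U) (Um : U m) (sf : forall i, smf U (f i)).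
Hypothesis Nf : forall x, U x -> (N x <-> forall i, f i x = 0).
Hypothesis surj : forall w : I -> R, exists v, forall i, ds v (f i) m = w i.

(** Independence of the differentials at m amounts to the Gram matrix of the
    Jacobian being invertible, which persists on a neighbourhood of m; there the
    functions form a local equation. *)
Lemma zero_set_tangent v : N m -> (tangent N m v <-> forall i, ds v (f i) m = 0).
Proof.
move=> Nm; split=> [tv i|v0].
  by apply: (tangent_vanish Nm tv oU Um (sf i)) => x Ux /(Nf Ux).
pose G x : 'rV[R]_#|I| := \row_a f (enum_val a) x.
pose A x : 'M[R]_(#|I|, dim V) := \matrix_(a, l) ds (bas l) (f (enum_val a)) x.
have sA : smm U A.
  by move=> a l; apply: smf_ext (smf_ds (bas l) (sf (enum_val a))) => // x _; rewrite mxE.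
have dA w x a : U x -> ds w (f (enum_val a)) x = (A x *m (v2r w)^T) a 0.
  move=> Ux; rewrite {1}(bas_sum w) (ds_dir_sum _ _ _ (sf _) Ux) mxE.
  by apply: eq_bigr => l _; rewrite !mxE mulrC.
pose delta x := \det (A x *m (A x)^T).
have sd : smf U delta by apply: smf_det => //; apply: smm_mul => //; exact: smm_tr.
have oU' := vopen_gt (c := 0) oU (smf_mul oU sd sd).
have um : A m *m (A m)^T \in unitmx.
  apply: gram_unit => w; have [w' H] := surj (fun i => w (enum_rank i) 0).
  exists (v2r w')^T; apply/colP => a; rewrite -dA// H enum_valK //.
have sG : smooth_on U G.
  apply: smooth_mx => // i a; rewrite (ord1 i).
  by apply: smf_ext (sf (enum_val a)) => // x _; rewrite mxE.
have dG w x : U x -> pder w G x = (A x *m (v2r w)^T)^T.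
  move=> Ux; apply/rowP => a; rewrite (pder_mx _ _ _ oU sG Ux) [RHS]mxE -dA//.
  by apply: (ds_ext _ oU Ux) => y _; rewrite mxE.
have sub : [set x | U x /\ 0 < delta x * delta x] `<=` U by move=> x [].
exists #|I|, [set x | U x /\ 0 < delta x * delta x], G; split; last first.
  by rewrite dG//; apply/rowP => a; rewrite mxE -dA// v0 mxE.
split=> //.
- split=> //; rewrite -expr2 exprn_even_gt0//= -unitfE -unitmxE //.
- apply: smooth_mx => // i a; rewrite (ord1 i).
  apply: smf_sub sub _; apply: smf_ext (sf (enum_val a)) => // x _.
  by rewrite mxE.
- move=> x [Ux _]; rewrite (Nf Ux); split=> [H|/rowP H i].
    by apply/rowP => a; rewrite !mxE H.
  by have := H (enum_rank i); rewrite !mxE enum_rankK.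
- move=> x [Ux dx] w.
  have ux : A x *m (A x)^T \in unitmx.
    by rewrite unitmxE unitfE; apply: contraTneq dx => h; rewrite /delta h mul0r ltxx.
  have [y Hy] := gram_surj w^T ux; exists (r2v y^T).
  by rewrite dG// r2vK trmxK Hy trmxK.
Qed.
End ZeroSet.

(** * The local equation of the frame bundle *)
Section Columns.
Variables (R : realType) (N : nat).
Local Notation E := 'cV[R]_N.

Lemma col_sum (v : E) : v = \sum_i v i 0 *: delta_mx i 0.
Proof.
by rewrite {1}(matrix_sum_delta v); apply: eq_bigr => i _; rewrite big_ord1.
Qed.
End Columns.

Section Normal.
Variables (R : realType) (N d : nat) (M : set 'cV[R]_N) (k : nat) (m : 'cV[R]_N).
Local Notation E := 'cV[R]_N.
Variables (U : set E) (F : E -> 'rV[R]_k).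
Hypothesis LE : local_equation M m U F.

Let oU : vopen U. Proof. by case: LE. Qed.
Let sF : smooth_on U F. Proof. by case: LE. Qed.
Let MF x : U x -> (M x <-> F x = 0). Proof. by case: LE => _ _ _ + _; exact. Qed.

Definition Fa a (x : E) : R := F x 0 a.
Lemma sFa a : smf U (Fa a).
Proof. exact: (smooth_mx_entry 0 a oU sF). Qed.

Definition Jac x : 'M[R]_(k, N) := \matrix_(a, i) ds (delta_mx i 0) (Fa a) x.

Lemma sJac : smm U Jac.
Proof. by move=> a i; apply: smf_ext (smf_ds (delta_mx i 0) (sFa a)) => // x _; rewrite mxE. Qed.

Lemma JacE v x a : U x -> ds v (Fa a) x = (Jac x *m v) a 0.
Proof.
move=> Ux; rewrite {1}(col_sum v) (ds_dir_sum _ _ _ (sFa a) Ux) mxE.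
by apply: eq_bigr => i _; rewrite mxE mulrC.
Qed.

Lemma Jac_unit x : U x -> Jac x *m (Jac x)^T \in unitmx.
Proof.
move=> Ux; apply: gram_unit => w.
have [_ _ _ _ surj] := LE; have [v Hv] := surj x Ux w^T.
exists v; apply/colP => a; rewrite -(JacE v a Ux).
have := congr1 (fun z : 'rV[R]_k => z 0 a) Hv; rewrite mxE => <-.
by rewrite (pder_mx _ _ _ oU sF Ux).
Qed.

Lemma tangentE x v : U x -> M x -> tangent M x v <-> Jac x *m v = 0.
Proof.
move=> Ux Mx; split=> [tv|Jv].
  apply/colP => a; rewrite -(JacE v a Ux) mxE.
  apply: (tangent_vanish Mx tv oU Ux (sFa a)) => y Uy /(MF Uy) Fy.
  by rewrite /Fa Fy mxE.
exists k, U, F; split; first by have [? ? ? ? ?] := LE.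
apply/rowP => a; rewrite (pder_mx _ _ _ oU sF Ux).
by rewrite -[ds _ _ _]/(ds v (Fa a) x) (JacE v a Ux) Jv !mxE.
Qed.

(** The orthogonal projection onto the range of J^T, that is onto the normal space;
    unlike [nproj] it makes sense, and is smooth, off M. *)
Definition Qx x : 'M[R]_N := (Jac x)^T *m invmx (Jac x *m (Jac x)^T) *m Jac x.

Lemma sQx : smm U Qx.
Proof.
have sJ := sJac; have sJt := smm_tr oU sJ.
apply: smm_mul => //; apply: smm_mul => //; apply: smm_inv => //; last exact: smm_mul.
exact: Jac_unit.
Qed.

Lemma QJ x n (v : 'M[R]_(N, n)) : Jac x *m v = 0 -> Qx x *m v = 0.
Proof. by move=> Jv; rewrite /Qx -mulmxA Jv mulmx0. Qed.

Lemma JQ x : U x -> Jac x *m Qx x = Jac x.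
Proof. by move=> Ux; rewrite /Qx !mulmxA mulmxV ?mul1mx// Jac_unit. Qed.

Lemma QQ x : U x -> Qx x *m Qx x = Qx x.
Proof. by move=> Ux; rewrite {1}/Qx -mulmxA JQ. Qed.

Lemma Q_sym x : (Qx x)^T = Qx x.
Proof.
by rewrite /Qx !trmx_mul trmxK trmx_inv trmx_mul trmxK mulmxA.
Qed.

(** [Qx] has the defining property of the projection, and that property determines
    it: the difference of two solutions maps into the tangent space and is
    orthogonal to it. *)
Lemma nprojE x : U x -> M x -> nproj M x = Qx x.
Proof.
move=> Ux Mx; rewrite /nproj.
have PQ : forall v, tangent M x ((1%:M - Qx x) *m v) /\
    forall w, tangent M x w -> w^T *m (v - (1%:M - Qx x) *m v) = 0.
  move=> v; split=> [|w /(tangentE w Ux Mx) Jw].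
    by apply/(tangentE _ Ux Mx); rewrite mulmxA mulmxBr mulmx1 JQ// subrr mul0mx.
  rewrite mulmxBl mul1mx opprB addrCA subrr addr0 -[w]trmxK -Q_sym mulmxA -trmx_mul trmxK.
  by rewrite QJ// trmx0 mul0mx.
rewrite /tproj; case: xgetP => [P _ PP|/(_ _ PQ)//].
suff -> : P = 1%:M - Qx x by rewrite opprB addrCA subrr addr0.
apply/eqP; rewrite -subr_eq0; apply/eqP; set A := P - _.
have Av (v : E) : A *m v = 0.
  have [t1 o1] := PP v; have [t2 o2] := PQ v.
  have tA : tangent M x (A *m v).
    apply/(tangentE _ Ux Mx); rewrite mulmxBl mulmxBr.
    by move/(tangentE _ Ux Mx): t1 => ->; move/(tangentE _ Ux Mx): t2 => ->; rewrite subrr.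
  have : (A *m v)^T *m (A *m v) = 0.
    have e : A *m v = (v - (1%:M - Qx x) *m v) - (v - P *m v).
      rewrite mulmxBl; move: (P *m v) ((1%:M - Qx x) *m v) => y z.
      by rewrite opprB [RHS]addrC addrA subrK.
    by rewrite {2}e mulmxBr (o1 _ tA) (o2 _ tA) subrr.
  rewrite -{2}[A *m v]trmxK => /row_sq0 /(congr1 trmx); by rewrite trmxK trmx0.
apply/matrixP => i j; have /colP/(_ i) := Av (delta_mx j 0).
by rewrite -colE !mxE.
Qed.

Definition DQ (x v : E) : 'M[R]_N := \sum_l v l 0 *: dm (delta_mx l 0) Qx x.

Lemma DQ_linear x : linear (DQ x).
Proof.
move=> a u w; rewrite /DQ scaler_sumr -big_split; apply: eq_bigr => l _ /=.
by rewrite !mxE scalerDl scalerA.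
Qed.

Lemma DQE x v : U x -> DQ x v = dm v Qx x.
Proof.
move=> Ux; apply/matrixP => i j; rewrite /DQ summxE mxE {2}(col_sum v).
rewrite (ds_dir_sum _ _ _ (sQx i j) Ux); apply: eq_bigr => l _.
by rewrite !mxE.
Qed.

Lemma dQE x v : U x -> M x -> Jac x *m v = 0 -> dQ M x v = DQ x v.
Proof.
move=> Ux Mx Jv.
have sQ : smooth_on U Qx by apply: smooth_mx => // i j; exact: sQx.
rewrite /dQ (tangent_der_eq (O := U) (g := Qx) Mx _ oU Ux sQ) ?DQE//.
- by apply/matrixP => i j; rewrite (pder_mx _ _ _ oU sQ Ux) mxE.
- exact/tangentE.
- by move=> y My Uy; rewrite nprojE.
Qed.

(** The derivative of Q Q = Q. *)
Lemma DQ_idem x v : U x -> DQ x v = DQ x v *m Qx x + Qx x *m DQ x v.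
Proof.
move=> Ux; rewrite !DQE// -(dm_mul oU _ sQx sQx Ux).
by apply: (dm_ext oU) => // y Uy; rewrite QQ.
Qed.

(** The derivative of J Q = J. *)
Lemma DJE x v : U x -> dm v Jac x = dm v Jac x *m Qx x + Jac x *m DQ x v.
Proof.
move=> Ux; rewrite !DQE// -(dm_mul oU _ sJac sQx Ux).
by apply: (dm_ext oU) => // y Uy; rewrite JQ.
Qed.
End Normal.

Section FrameBundleEquation.
Variables (R : realType) (N d : nat) (M : set 'cV[R]_N) (k : nat) (m : 'cV[R]_N).
Local Notation E := 'cV[R]_N.
Local Notation frameE := ('cV[R]_N * 'M[R]_(N, d))%type.
Variables (U : set E) (F : E -> 'rV[R]_k).
Hypothesis LE : local_equation M m U F.
Local Notation OM := (frame_bundle (d := d) M).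
Local Notation J := (Jac F).
Local Notation Q := (Qx F).

Let oU : vopen U. Proof. by case: LE. Qed.
Let MF x : U x -> (M x <-> F x = 0). Proof. by case: LE => _ _ _ + _; exact. Qed.

Lemma fst_linear (V W : vectType R) : linear (fst : V * W -> V).
Proof. by []. Qed.

Definition UO : set frameE := fst @^-1` U.

Lemma oUO : vopen UO. Proof. by apply: (vopen_lin (L := fst)). Qed.

Lemma smm_fst p q (A : E -> 'M[R]_(p, q)) : smm U A -> smm UO (fun u => A u.1).
Proof.
move=> sA i j.
exact: (@smf_complin R frameE E fst U (fun x => A x i j) (@fst_linear E _) oU (sA i j)).
Qed.

Lemma dm_fst p q (A : E -> 'M[R]_(p, q)) (v u : frameE) : smm U A -> UO u ->
  dm v (fun u : frameE => A u.1) u = dm v.1 A u.1.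
Proof.
move=> sA Uu; apply/matrixP => i j; rewrite !mxE.
exact: (@ds_complin R frameE E fst U (fun x => A x i j) v u (@fst_linear E _) (sA i j) Uu).
Qed.

Lemma snd_entry i j : scalar (fun u : frameE => u.2 i j).
Proof. by move=> a u w; rewrite !mxE. Qed.

Lemma smm_snd : smm UO (fun u : frameE => u.2).
Proof. by move=> i j; apply: (smf_lin oUO (snd_entry i j)). Qed.

Lemma dm_snd (v u : frameE) : dm v (fun u : frameE => u.2) u = v.2.
Proof. by apply/matrixP => i j; rewrite mxE (ds_lin v u (snd_entry i j)). Qed.

Lemma frame_bundleE u : UO u -> OM u <-> [/\ M u.1, J u.1 *m u.2 = 0 & u.2^T *m u.2 = 1%:M].
Proof.
move=> Uu; split=> [[Mu tu iu]|[Mu Ju gu]]; split=> //.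
- apply/matrixP => a j; have /(tangentE LE _ Uu Mu)/colP/(_ a) := tu (delta_mx j 0).
  by rewrite mulmxA -colE !mxE.
- apply/matrixP => i j; have /matrixP/(_ 0 0) := iu (delta_mx i 0) (delta_mx j 0).
  rewrite !trmx_mul !trmx_delta -mulmxA (mulmxA u.2^T).
  move: (u.2^T *m u.2) => G.
  rewrite -rowE -rowE -colE [LHS]mxE [LHS]mxE => ->.
  by rewrite !mxE eqxx andbT.
- by move=> a; apply/(tangentE LE _ Uu Mu); rewrite mulmxA Ju mul0mx.
- by move=> a b; rewrite trmx_mul -mulmxA (mulmxA u.2^T) gu mul1mx.
Qed.

(** The frame bundle is cut out by F (m) = 0, J (m) g = 0 and g^T g = 1.  As the last
    equation is symmetric, only its entries on and above the diagonal count. *)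
Definition sym_index := {ij : 'I_d * 'I_d | (ij.1 <= ij.2)%N}.
Definition OM_index := ('I_k + ('I_k * 'I_d + sym_index))%type.
Definition OM_eq (i : OM_index) (u : frameE) : R :=
  match i with
  | inl a => Fa F a u.1
  | inr (inl aj) => (J u.1 *m u.2) aj.1 aj.2
  | inr (inr ij) => (u.2^T *m u.2 - 1%:M) (val ij).1 (val ij).2
  end.

Let sJg : smm UO (fun u : frameE => J u.1 *m u.2).
Proof. by apply: smm_mul; [exact: oUO|apply: smm_fst; exact: (sJac LE)|exact: smm_snd]. Qed.

Let sgg : smm UO (fun u : frameE => u.2^T *m u.2 - 1%:M).
Proof.
apply: smm_add; [exact: oUO| |exact: (smm_cst oUO (- 1%:M))].
by apply: smm_mul; [exact: oUO|apply: smm_tr smm_snd; exact: oUO|exact: smm_snd].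
Qed.

Lemma OM_eq_smooth i : smf UO (OM_eq i).
Proof.
case: i => [a|[[a j]|[[i j] ij]]] /=; last exact: sgg.
- exact: (@smf_complin R frameE E fst U (Fa F a) (@fst_linear E _) oU (sFa LE a)).
- exact: sJg.
Qed.

Lemma OM_eq_ds (v u : frameE) : UO u ->
  (forall a, ds v (OM_eq (inl a)) u = (J u.1 *m v.1) a 0) /\
  (forall a j, ds v (OM_eq (inr (inl (a, j)))) u =
     (dm v.1 J u.1 *m u.2 + J u.1 *m v.2) a j) /\
  (forall i j ij, ds v (OM_eq (inr (inr (exist _ (i, j) ij)))) u =
     (v.2^T *m u.2 + u.2^T *m v.2) i j).
Proof.
move=> Uu; split=> [a|]; last split=> [a j|i j ij].
- rewrite -(JacE LE v.1 a Uu).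
  exact: (@ds_complin R frameE E fst U (Fa F a) v u (@fst_linear E _) (sFa LE a) Uu).
- have sJ := smm_fst (sJac LE).
  have e : dm v (fun u : frameE => J u.1 *m u.2) u = dm v.1 J u.1 *m u.2 + J u.1 *m v.2.
    by rewrite (dm_mul oUO _ sJ smm_snd Uu) (dm_fst v (sJac LE) Uu) dm_snd.
  by rewrite -e mxE.
- have sg := smm_snd; have sgt := smm_tr oUO sg.
  have e : dm v (fun u : frameE => u.2^T *m u.2 + - 1%:M) u = v.2^T *m u.2 + u.2^T *m v.2.
    rewrite (dm_add oUO _ (smm_mul oUO sgt sg) (smm_cst oUO (- 1%:M)) Uu) dm_cst addr0.
    by rewrite (dm_mul oUO _ sgt sg Uu) dm_tr dm_snd.
  by rewrite -e mxE.
Qed.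

Lemma OM_zero u : UO u -> (OM u <-> forall i, OM_eq i u = 0).
Proof.
move=> Uu; split=> [/(frame_bundleE Uu)[Mu Ju gu] [a|[[a j]|[[i j] ij]]] /=|H].
- by move/(MF Uu): Mu; rewrite /Fa => ->; rewrite mxE.
- by rewrite Ju mxE.
- by rewrite gu subrr mxE.
apply/(frame_bundleE Uu); split.
- apply/(MF Uu)/rowP => a; rewrite mxE; exact: (H (inl a)).
- apply/matrixP => a j; rewrite [RHS]mxE; exact: (H (inr (inl (a, j)))).
apply/eqP; rewrite -subr_eq0; apply/eqP/matrixP => i j; rewrite [RHS]mxE.
have [ij|/ltnW ji] := leqP i j; first exact: (H (inr (inr (exist _ (i, j) ij)))).
rewrite -(H (inr (inr (exist _ (j, i) ji)))) /=.
rewrite -[u.2^T *m u.2 in LHS]trmxK -[1%:M in LHS]trmx1 trmx_mul trmxK.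
by rewrite -linearB mxE.
Qed.

(** At a frame the three blocks of the differential are hit one after the other:
    xi = L w1 in the base, then h = L (..) + g w3 / 2, where L is the right
    inverse of J.  The two parts of h do not interfere, because J g = 0. *)
Lemma OM_surj (u : frameE) : UO u -> OM u -> forall w : OM_index -> R,
  exists v : frameE, forall i, ds v (OM_eq i) u = w i.
Proof.
move=> Uu /(frame_bundleE Uu)[Mu Ju gu] w.
have uJ := Jac_unit LE Uu.
pose w1 : 'cV[R]_k := \col_a w (inl a).
pose w2 : 'M[R]_(k, d) := \matrix_(a, j) w (inr (inl (a, j))).
pose w3 : 'M[R]_d := \matrix_(i, j)
  oapp (fun x : sym_index => w (inr (inr x))) 0 (insub (if (i <= j)%N then (i, j) else (j, i))).
have w3T : w3^T = w3.
  apply/matrixP => i j; rewrite !mxE; case: (ltngtP i j) => // ij.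
  by have -> : i = j by exact: val_inj.
pose L n (A : 'M[R]_(k, n)) := (J u.1)^T *m (invmx (J u.1 *m (J u.1)^T) *m A).
have JL n (A : 'M[R]_(k, n)) : J u.1 *m L n A = A by rewrite !mulmxA mulmxV// mul1mx.
have gL n (A : 'M[R]_(k, n)) : u.2^T *m L n A = 0.
  by rewrite mulmxA -trmx_mul Ju trmx0 mul0mx.
pose xi := L 1%N w1.
pose h := L d (w2 - dm xi J u.1 *m u.2) + u.2 *m (2^-1 *: w3).
exists (xi, h); have [d1 [d2 d3]] := OM_eq_ds (xi, h) Uu.
case=> [a|[[a j]|[[i j] ij]]].
- by rewrite d1 JL mxE.
- by rewrite d2 /= mulmxDr JL mulmxA Ju mul0mx addr0 addrC subrK mxE.
rewrite d3 /=.
have gh : u.2^T *m h = 2^-1 *: w3 by rewrite mulmxDr gL add0r mulmxA gu mul1mx.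
have -> : h^T *m u.2 + u.2^T *m h = w3.
  rewrite gh -[h^T *m u.2]trmxK trmx_mul trmxK gh linearZ /= w3T -scalerDl.
  by rewrite -[RHS]scale1r; congr (_ *: _); field.
have ij' : (i <= j)%N := ij.
by rewrite mxE ij' -[(i, j)]/(val (exist (fun ij : 'I_d * 'I_d => (ij.1 <= ij.2)%N) (i, j) ij)) valK.
Qed.

(** Differentiating J g = 0 gives a condition on dJ (xi) g, which equals
    J dQ (xi) g by [DJE] as Q g = 0. *)
Lemma OM_tangent (u v : frameE) : UO u -> OM u ->
  tangent OM u v <-> [/\ J u.1 *m v.1 = 0, J u.1 *m (v.2 + DQ F u.1 v.1 *m u.2) = 0 &
    v.2^T *m u.2 + u.2^T *m v.2 = 0].
Proof.
move=> Uu Ou; have /(frame_bundleE Uu)[Mu Ju gu] := Ou.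
have [d1 [d2 d3]] := OM_eq_ds v Uu.
have e : dm v.1 J u.1 *m u.2 + J u.1 *m v.2 = J u.1 *m (v.2 + DQ F u.1 v.1 *m u.2).
  rewrite (DJE LE _ Uu) mulmxDl -[dm _ _ _ *m Q _ *m _]mulmxA (QJ Ju) mulmx0 add0r.
    by rewrite mulmxDr addrC mulmxA.
apply: (iff_trans (zero_set_tangent oUO Uu OM_eq_smooth OM_zero (OM_surj Uu Ou) v Ou)).
split=> [H|[H1 H2 H3] [a|[[a j]|[[i j] ij]]]].
- split.
  + by apply/colP => a; rewrite -d1 H mxE.
  + by rewrite -e; apply/matrixP => a j; rewrite -d2 H mxE.
  + apply/matrixP => i j; have [ij|/ltnW ji] := leqP i j.
      by rewrite -(d3 i j ij) H mxE.
    rewrite [RHS]mxE -(H (inr (inr (exist _ (j, i) ji)))) d3.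
    rewrite -[v.2^T *m u.2 + _ in RHS]trmxK [in RHS]mxE.
    by rewrite trmxD !trmx_mul !trmxK addrC.
- by rewrite d1 H1 mxE.
- by rewrite d2 e H2 mxE.
- by rewrite d3 H3 mxE.
Qed.
End FrameBundleEquation.

(** * The parallelism of the frame bundle *)
Section SoLemmas.
Variables (R : realType) (d : nat).

Lemma so_linear : linear (fun A : 'M[R]_d => A + A^T).
Proof. by move=> a A B; rewrite linearP /= scalerDr addrACA. Qed.

Lemma soE (A : 'M[R]_d) : (A \in so R d) = (A + A^T == 0).
Proof.
pose L := HB.pack_for {linear 'M[R]_d -> 'M[R]_d} (fun A : 'M[R]_d => A + A^T)
  (GRing.isLinear.Build _ _ _ _ _ so_linear).
by rewrite memv_ker (lfunE L).
Qed.
End SoLemmas.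

(** The derivative of a projection maps its kernel to its range; here dQ maps
    tangent vectors to normal vectors. *)
Lemma second_form (R : realType) (N d : nat) (g : 'M[R]_(N, d)) (Q D : 'M[R]_N) :
  Q *m g = 0 -> g^T *m Q = 0 -> D = D *m Q + Q *m D ->
  D *m g = Q *m (D *m g) /\ g^T *m D *m g = 0.
Proof.
move=> Qg gQ e.
have Dg : D *m g = Q *m (D *m g) by rewrite {1}e mulmxDl -mulmxA Qg mulmx0 add0r mulmxA.
by split=> //; rewrite -mulmxA Dg mulmxA gQ mul0mx.
Qed.

Section FrameParallelism.
Variables (R : realType) (N d : nat) (M : set 'cV[R]_N).
Local Notation E := 'cV[R]_N.
Local Notation frameE := ('cV[R]_N * 'M[R]_(N, d))%type.
Local Notation rd_so := ('cV[R]_d * subvs_of (so R d))%type.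
Local Notation OM := (frame_bundle (d := d) M).
Hypothesis sM : submanifold d M.

Lemma local_data (u : frameE) : OM u -> exists k U (F : E -> 'rV[R]_k),
  [/\ N = (d + k)%N, local_equation M u.1 U F & U u.1].
Proof.
case=> Mu _ _; have [k eN H] := sM; have [U [F LE]] := H u.1 Mu.
exists k, U, F; split=> //; last by case: LE.
by rewrite -eN /dim /= muln1.
Qed.

Lemma frame_inv_mul (g : 'M[R]_(N, d)) : g^T *m g = 1%:M -> frame_inv g *m g = 1%:M.
Proof.
move=> gg; have rg : row_free g^T by apply/row_freeP; exists g.
by rewrite /frame_inv -[g in _ *m g]trmxK -trmx_mul mulmxVp// trmx1.
Qed.

(** As g g^T = P, both xi and the covariant derivative h + dQ (xi) g, which is
    tangent, are recovered from their images under g^T; and g^T dQ (xi) g = 0 by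
    [second_form].  So the connection form is simply g^T h. *)
Lemma tangent_frame (u v : frameE) : OM u -> tangent OM u v ->
  [/\ u.2 *m (u.2^T *m v.1) = v.1,
      v.2 + dQ M u.1 v.1 *m u.2 = u.2 *m (u.2^T *m v.2),
      connection_form M u v = u.2^T *m v.2 & u.2^T *m v.2 \in so R d].
Proof.
move=> Ou; have [k [U [F [eN LE Uu]]]] := local_data Ou.
have Uu' : UO U u by [].
move=> /(OM_tangent LE v Uu' Ou)[Jx Jh sh].
have /(frame_bundleE LE Uu')[Mu Ju gu] := Ou.
have gg := frame_complement eN (Jac_unit LE Uu) Ju gu.
rewrite -/(Qx F u.1) in gg.
have e1 : u.2 *m (u.2^T *m v.1) = v.1.
  by rewrite mulmxA gg mulmxBl mul1mx (QJ Jx) subr0.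
have gQ : u.2^T *m Qx F u.1 = 0 by rewrite -(Q_sym F u.1) -trmx_mul (QJ Ju) trmx0.
have e2 : v.2 + dQ M u.1 v.1 *m u.2 = u.2 *m (u.2^T *m v.2).
  rewrite (dQE LE Uu Mu Jx).
  have [Dg] := second_form (QJ Ju) gQ (DQ_idem LE v.1 Uu); rewrite -mulmxA => gDg.
  transitivity (u.2 *m u.2^T *m (v.2 + DQ F u.1 v.1 *m u.2)).
    by rewrite gg mulmxBl mul1mx (QJ Jh) subr0.
  by rewrite -mulmxA mulmxDr gDg addr0.
split=> //.
- by rewrite /connection_form e2 mulmxA (frame_inv_mul gu) mul1mx.
- by rewrite soE trmx_mul trmxK addrC sh.
Qed.

(** By [tangent_frame] the form theta^Y is, on tangent vectors, the restriction of
    this form, which is defined everywhere and linear in the point; this spares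
    a tubular neighbourhood. *)
Definition beta0_fun (u v : frameE) : rd_so := (u.2^T *m v.1, vsproj (so R d) (u.2^T *m v.2)).

Lemma beta0_linear u : linear (beta0_fun u).
Proof.
move=> a v w; rewrite /beta0_fun /=.
by rewrite !mulmxDr -!scalemxAr linearP.
Qed.

Definition beta0 (u : frameE) : 'Hom(frameE, rd_so) := linfun (beta0_fun u).

Lemma beta0E u v : beta0 u v = beta0_fun u v.
Proof.
pose L := HB.pack_for {linear frameE -> rd_so} (beta0_fun u)
  (GRing.isLinear.Build _ _ _ _ _ (beta0_linear u)).
exact: (lfunE L v).
Qed.

Lemma beta0_lin : linear beta0.
Proof.
move=> a u w; apply/lfunP => v; rewrite add_lfunE scale_lfunE !beta0E /beta0_fun /=.
by rewrite trmxD linearZ /= !mulmxDl -!scalemxAl linearP.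
Qed.

Lemma beta0_extends : extends_form OM (thetaY_form M) setT beta0.
Proof.
split=> //; first exact: vopen_setT; first exact: (linear_smooth beta0_lin).
move=> u v Ou tv; have [_ _ ec _] := tangent_frame Ou tv.
by rewrite beta0E /beta0_fun /thetaY_form ec.
Qed.

Lemma smooth_pair (V : vectType R) (U : set V) m n m' n' (A : V -> 'M[R]_(m, n)) (B : V -> 'M[R]_(m', n')) :
  vopen U -> smm U A -> smm U B -> smooth_on U (fun x => (A x, B x)).
Proof.
move=> oU sA sB; apply/(smooth_onP _ oU) => j.
have ls := @scalar_coord R ('M[R]_(m, n) * 'M[R]_(m', n'))%type j.
pose l1 (X : 'M[R]_(m, n)) := v2r (X, 0 : 'M[R]_(m', n')) 0 j.
pose l2 (X : 'M[R]_(m', n')) := v2r (0 : 'M[R]_(m, n), X) 0 j.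
have s1 : scalar l1.
  move=> a X X'; rewrite /l1 -ls; congr (v2r _ 0 j); congr (_, _).
  by rewrite /= scaler0 addr0.
have s2 : scalar l2.
  move=> a X X'; rewrite /l2 -ls; congr (v2r _ 0 j); congr (_, _).
  by rewrite /= scaler0 addr0.
apply: (@smf_ext _ _ _ (fun x => \sum_i \sum_k A x i k * l1 (delta_mx i k) +
   \sum_i \sum_k B x i k * l2 (delta_mx i k))) => // [x _|].
  rewrite -(scalar_mx s1) -(scalar_mx s2) /l1 /l2 -[X in X + _]mul1r -ls.
  congr (v2r _ 0 j); congr (_, _); first by rewrite /= scale1r addr0.
  by rewrite /= scaler0 add0r.
have H p q (C : V -> 'M[R]_(p, q)) (c : 'I_p -> 'I_q -> R) : smm U C ->
    smf U (fun x => \sum_i \sum_k C x i k * c i k).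
  move=> sC; apply: smf_sum => // i _; apply: smf_sum => // k _.
  by apply: smf_mul => //; exact: smf_cst.
by apply: smf_add => //; exact: H.
Qed.

Lemma Y_fieldE (c : rd_so) (u : frameE) : Y_field M c u =
  (u.2 *m c.1, - dQ M u.1 (u.2 *m c.1) *m u.2 + u.2 *m vsval c.2).
Proof. by rewrite /Y_field; congr (_, _); rewrite /= addr0. Qed.

Lemma Y_tangent (u : frameE) (c : rd_so) : OM u -> tangent OM u (Y_field M c u).
Proof.
move=> Ou; have [k [U [F [eN LE Uu]]]] := local_data Ou.
have Uu' : UO U u by [].
have /(frame_bundleE LE Uu')[Mu Ju gu] := Ou.
have Ja : Jac F u.1 *m (u.2 *m c.1) = 0 by rewrite mulmxA Ju mul0mx.
have gQ : u.2^T *m Qx F u.1 = 0 by rewrite -(Q_sym F u.1) -trmx_mul (QJ Ju) trmx0.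
have gDg a : u.2^T *m DQ F u.1 a *m u.2 = 0.
  exact: (second_form (QJ Ju) gQ (DQ_idem LE a Uu)).2.
have /(_ (vsval c.2)) := @soE R d; rewrite subvsP => /esym/eqP sA.
rewrite Y_fieldE; apply/(OM_tangent LE _ Uu' Ou); split; rewrite /=//.
  rewrite (dQE LE Uu Mu Ja) mulNmx addrC addrA subrr add0r mulmxA Ju mul0mx //.
rewrite (dQE LE Uu Mu Ja).
have e : u.2^T *m (- DQ F u.1 (u.2 *m c.1) *m u.2 + u.2 *m vsval c.2) = vsval c.2.
  by rewrite mulmxDr mulNmx mulmxN mulmxA gDg oppr0 add0r mulmxA gu mul1mx.
rewrite e -[X in X + _]trmxK trmx_mul trmxK e addrC.
exact: sA.
Qed.

Lemma Y_parallelism : parallelism OM (Y_field M) (thetaY_form M).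
Proof.
split.
- by move=> u c; exact: Y_tangent.
- move=> u v Ou tv; have [e1 e2 ec eso] := tangent_frame Ou tv.
  rewrite Y_fieldE /thetaY_form /theta_form /= ec vsprojK// e1 -e2.
  by rewrite addrCA mulNmx addNr addr0; case: (v).
- move=> u c Ou; have tY := Y_tangent c Ou.
  have [e1 e2 ec eso] := tangent_frame Ou tY.
  have [_ _ gu] : [/\ True, True & u.2^T *m u.2 = 1%:M].
    by have [k [U [F [eN LE Uu]]]] := local_data Ou; have /(frame_bundleE LE Uu)[_ _] := Ou.
  have e3 : u.2^T *m (Y_field M c u).2 = vsval c.2.
    have : u.2^T *m (u.2 *m (u.2^T *m (Y_field M c u).2)) =
       u.2^T *m ((Y_field M c u).2 + dQ M u.1 (Y_field M c u).1 *m u.2) by rewrite -e2.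
    rewrite mulmxA gu mul1mx => ->.
    by rewrite Y_fieldE /= addrC addrA mulNmx addrN add0r mulmxA gu mul1mx.
  rewrite /thetaY_form ec e3 vsvalK Y_fieldE /theta_form /= mulmxA gu mul1mx.
  by case: (c).
- move=> u Ou; have [k [U [F [eN LE Uu]]]] := local_data Ou.
  pose Yt (c : rd_so) (u : frameE) : frameE :=
    (u.2 *m c.1, - DQ F u.1 (u.2 *m c.1) *m u.2 + u.2 *m vsval c.2).
  have [oU _ _ _ _] := LE.
  have oO : vopen (UO U : set frameE) := oUO LE.
  exists (UO U), Yt; split=> //.
  + move=> c; have sg : smm (UO U) (fun u : frameE => u.2) := smm_snd LE.
    have sga : smm (UO U) (fun u : frameE => u.2 *m c.1).
      by apply: smm_mul => //; exact: smm_cst.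
    apply: smooth_pair => //; apply: smm_add => //; last first.
      by apply: smm_mul => //; exact: smm_cst.
    apply: smm_mul => //; apply: smm_opp => // i j.
    have sDQ l : smf (UO U) (fun u : frameE => (u.2 *m c.1) l 0 * dm (delta_mx l 0) (Qx F) u.1 i j).
      apply: smf_mul => //.
      have H1 := smm_dm oU (delta_mx l 0 : E) (sQx LE); have := smm_fst d LE H1 i j; exact.
    apply: smf_ext (smf_sum (index_enum _) oO (fun l (_ : true) => sDQ l)) => // x _.
    by rewrite /DQ summxE; apply: eq_bigr => l _; rewrite [RHS]mxE.
  + move=> x a c c'; rewrite /Yt; congr (_, _); first by rewrite /= mulmxDr -scalemxAr.
    rewrite /= mulmxDr -scalemxAr (DQ_linear F x.1 a) linearP /= mulmxDr -scalemxAr.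
    by rewrite mulmxDl -scalemxAl scalerDr addrACA.
  + move=> c x Ux Ox; have /(frame_bundleE LE Ux)[Mx Jx gx] := Ox.
    have Ja : Jac F x.1 *m (x.2 *m c.1) = 0 by rewrite mulmxA Jx mul0mx.
    by rewrite /Yt Y_fieldE (dQE LE Ux Mx Ja).
Qed.
End FrameParallelism.

Theorem theorem6p13 (R : realType) (T p : R) (omega : R -> R -> R) (N d : nat)
    (M : set 'cV[R]_N) (o : 'cV[R]_N) (uo : 'cV[R]_N * 'M[R]_(N, d)) :
  0 < T -> 2 <= p -> p < 3 -> control T omega ->
  submanifold d M -> M o -> frame_bundle M uo -> uo.1 = o ->
  let OM := frame_bundle (d := d) M in
  let intTheta (S : R) := integral_form p omega S OM (thetaY_form M) in
  [/\ (forall U, WGM_from p omega T OM uo U ->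
         is_integral_form p omega T OM (thetaY_form M) U (intTheta T U) /\
         WG_from p omega T 0 (intTheta T U)),
      (forall (Z : rpath ('cV[R]_d * subvs_of (so R d))%type) U (tau : \bar R),
         WG_from p omega T 0 Z ->
         rde_solution_until p omega T OM (Y_field M) Z uo U tau ->
         forall S : R, 0 <= S -> S <= T -> (S%:E < tau)%E ->
           eq_rpath S (intTheta S U) Z) &
      (forall U W (tau : \bar R), WGM_from p omega T OM uo U ->
         rde_solution_until p omega T OM (Y_field M) (intTheta T U) uo W tau ->
         forall S : R, 0 <= S -> S <= T -> (S%:E < tau)%E ->
           eq_rpath S U W)].
Proof.
move=> T0 p2 p3 Hct sM Mo Ouo uo1 OM intTheta.
exact: (parallelism_inverse T0 p2 p3 Hct (Y_parallelism sM) uo (@beta0_lin R N d) (beta0_extends sM)).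
Qed.
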